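(* Let $A:L^2(\mathbb{R}_+)\rightarrow L^2(\mathbb{R}_+)$ be a continuous linear operator such that $A(\widetilde{\mathcal{M}})\subset\widetilde{\mathcal{M}}$. Then there exist a function $\alpha\in H^2_{\mathbb{C}_+}$ with $\alpha(w)\neq 0$ for every $w\in\mathbb{C}_+$, and an analytic function $\xi:\mathbb{C}_+\rightarrow\mathbb{C}_+$, such that \[ A=\mathcal{L}^{-1}M_\kappa C_\xi\mathcal{L},\quad\text{with}\quad \kappa=\sqrt{2\pi}\,(1+\xi)\alpha. \]
   Context: $\mathbb{C}_+$ is the open right half plane, $\mathbb{D}$ the open unit disk, $\mathbb{R}_+$ the half line $[0,\infty)$; $L^2(\mathbb{R}_+)$ consists of complex-valued functions. $H^2_{\mathbb{C}_+}$ is the Hardy space of analytic functions on $\mathbb{C}_+$ whose square integrals along vertical lines of constant positive real part are uniformly bounded; $H^2_{\mathbb{D}}$ is the Hardy space of analytic functions on $\mathbb{D}$ with square summable Taylor coefficients. The Fourier-Laplace transform $\mathcal{L}:L^2(\mathbb{R}_+)\to H^2_{\mathbb{C}_+}$, $(\mathcal{L}f)(w)=\frac{1}{\sqrt{2\pi}}\int_0^\infty f(t)e^{-wt}\,dt$, is a surjective isometry. The map $\Phi:H^2_{\mathbb{C}_+}\to H^2_{\mathbb{D}}$, $(\Phi F)(z)=\frac{2\sqrt{\pi}}{1+z}F\!\left(\frac{1-z}{1+z}\right)$, is a surjective isometry. Put $\mathcal{H}=\Phi\mathcal{L}:L^2(\mathbb{R}_+)\to H^2_{\mathbb{D}}$.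 A nonzero $G\in H^2_{\mathbb{D}}$ is outer if there is a scalar $\lambda$ with $|\lambda|=1$ such that $G(z)=\lambda\exp\!\left(\frac{1}{2\pi}\int_0^{2\pi}\frac{e^{i\theta}+z}{e^{i\theta}-z}\log|G(e^{i\theta})|\,d\theta\right)$ for all $z\in\mathbb{D}$, where $G(e^{i\theta})$ denotes the boundary function. A function $f\in L^2(\mathbb{R}_+)$ is minimum phase if $\mathcal{H}f$ is outer; $\mathcal{M}$ is the set of all minimum phase functions. For $\tau\ge 0$, $(T_\tau f)(t)=f(t-\tau)$ if $t\geq\tau$ and $0$ if $t<\tau$. $\widetilde{\mathcal{M}}=\{T_\tau f : f\in\mathcal{M},\ \tau\geq 0\}$. For analytic $\kappa$ on $\mathbb{C}_+$ and analytic $\xi:\mathbb{C}_+\to\mathbb{C}_+$, $(M_\kappa F)(w)=\kappa(w)F(w)$ and $(C_\xi F)(w)=F(\xi(w))$ for $F$ analytic on $\mathbb{C}_+$. *)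

(* Defs.v *)
From HB Require Import structures.
From mathcomp Require Import all_boot all_order all_algebra.
From mathcomp Require Import all_classical all_reals all_analysis.
From mathcomp Require Import measurable_realfun complex ring lra.

Set Implicit Arguments.
Unset Strict Implicit.
Unset Printing Implicit Defensive.
Import Order.TTheory GRing.Theory Num.Theory.
Import numFieldNormedType.Exports.
Import Quotient.
Export Quotient.Exports.

Local Open Scope classical_set_scope.
Local Open Scope ring_scope.
Local Open Scope complex_scope.
Local Open Scope quotient_scope.

(* real-closed puts no topology on R[i]; this is the one given by the modulus,
   for which [derivable F w 1] is complex differentiability of F at w. *)
HB.instance Definition _ (R : realType) := NormedModule.copy R[i] R[i]^o.

Local Notation Re := (@complex.Re _).
Local Notation Im := (@complex.Im _).

Section Complex.
Context {R : realType}.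
Implicit Types (z w : R[i]) (F : R[i] -> R[i]).

Definition cmod z : R := Normc.normc z.

Definition cexp z : R[i] :=
  (expR (Re z))%:C * (cos (Im z) +i* sin (Im z)).

Definition cintegral (D : set R) (f : R -> R[i]) : R[i] :=
  (\int[lebesgue_measure]_(t in D) Re (f t))%R
  +i* (\int[lebesgue_measure]_(t in D) Im (f t))%R.

Definition right_half_plane : set R[i] := [set w | 0 < Re w].
Definition unit_disk : set R[i] := [set z | cmod z < 1].

Definition analytic_on (U : set R[i]) F := forall z, U z -> derivable F z 1.

(* Analytic functions on an open set U are encoded as total functions of which
   only the values on U are used. *)
Definition hardy_half_plane F :=
  analytic_on right_half_plane F /\
  exists M : R, forall x : R, 0 < x ->
    (\int[lebesgue_measure]_y ((cmod (F (x +i* y)) ^+ 2)%:E) <= M%:E)%E.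

Definition hardy_disk F :=
  exists a : nat -> R[i],
    cvgn (series (fun n => cmod (a n) ^+ 2)) /\
    forall z, unit_disk z -> series (fun n => a n * z ^+ n) @ \oo --> F z.

(* The radial limit. For a nonzero F in the Hardy space of the disk it exists and
   is nonzero at almost every theta, so the default values of [lim] and of
   [ln 0] do not affect the integral in [outer]. *)
Definition boundary_function F (theta : R) : R[i] :=
  lim (F (r%:C * cexp (0 +i* theta)) @[r --> (1 : R)^'-]).

Definition outer F :=
  [/\ hardy_disk F,
      exists2 z, unit_disk z & F z != 0
    & exists2 lambda : R[i], cmod lambda = 1 &
      forall z, unit_disk z ->
        F z = lambda * cexp ((2 * pi)^-1%:C *
          cintegral `[0, 2 * pi]
            (fun theta => (cexp (0 +i* theta) + z) / (cexp (0 +i* theta) - z)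
                          * (ln (cmod (boundary_function F theta)))%:C))].

End Complex.

Section L2.
Context {R : realType}.
Local Notation mu := (@lebesgue_measure R).
Implicit Types (f g : R -> R[i]).

Definition half_line : set R := `[0, +oo[.

Lemma measurable_half_line : measurable half_line.
Proof. exact: measurable_itv. Qed.

Definition measurableC f :=
  measurable_fun half_line (fun t => Re (f t)) /\
  measurable_fun half_line (fun t => Im (f t)).

(* Squared L^2-norm over the half-line. *)
Definition energy f : \bar R :=
  \int[mu]_(t in half_line) (cmod (f t) ^+ 2)%:E.

Lemma cmodE (z : R[i]) : cmod z ^+ 2 = Re z ^+ 2 + Im z ^+ 2.
Proof. by case: z => a b; rewrite /cmod/= sqr_sqrtr// addr_ge0 ?sqr_ge0. Qed.

Lemma cmodM (z w : R[i]) : cmod (z * w) = cmod z * cmod w.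
Proof. exact: Normc.normcM. Qed.

Lemma measurable_cmod2 f : measurableC f ->
  measurable_fun half_line (EFin \o (fun t => cmod (f t) ^+ 2)).
Proof.
move=> [mr mi]; apply/measurable_EFinP.
under eq_fun do rewrite cmodE.
by apply: measurable_funD; apply: measurable_funX.
Qed.

Lemma measurableC0 : measurableC 0.
Proof. by split; exact: (measurable_cst (0 : R)). Qed.

Lemma measurableC_lin (a : R[i]) f g :
  measurableC f -> measurableC g -> measurableC (a *: f + g).
Proof.
move=> [fr fi] [gr gi]; split.
- have -> : (fun t => Re ((a *: f + g) t)) =
     (fun t => Re a * Re (f t) - Im a * Im (f t) + Re (g t)).
    by apply/funext => t; case: a => a1 a2; rewrite !fctE; case: (f t); case: (g t).
  apply: measurable_funD => //; apply: measurable_funB;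
    by apply: measurable_funM.
- have -> : (fun t => Im ((a *: f + g) t)) =
     (fun t => Re a * Im (f t) + Im a * Re (f t) + Im (g t)).
    by apply/funext => t; case: a => a1 a2; rewrite !fctE; case: (f t); case: (g t).
  apply: measurable_funD => //; apply: measurable_funD;
    by apply: measurable_funM.
Qed.

Lemma energy_ge0 f : (0 <= energy f)%E.
Proof. by apply: integral_ge0 => t _; rewrite lee_fin sqr_ge0. Qed.

Lemma energyZ (a : R[i]) f : measurableC f ->
  energy (a *: f) = ((cmod a ^+ 2)%:E * energy f)%E.
Proof.
move=> mf; rewrite /energy -ge0_integralZl//.
- by apply: eq_integral => t _; rewrite cmodM exprMn EFinM.
- exact: measurable_half_line.
- exact: measurable_cmod2.
- by move=> t _; rewrite lee_fin sqr_ge0.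
- by rewrite lee_fin sqr_ge0.
Qed.

Lemma cmodD2 (s : R) (z w : R[i]) : 0 < s ->
  cmod (z + w) ^+ 2 <= (1 + s) * cmod z ^+ 2 + (1 + s^-1) * cmod w ^+ 2.
Proof.
move=> s0; rewrite !cmodE; case: z w => [a b] [c d]/=.
rewrite -subr_ge0.
have -> : (1 + s) * (a ^+ 2 + b ^+ 2) + (1 + s^-1) * (c ^+ 2 + d ^+ 2)
  - ((a + c) ^+ 2 + (b + d) ^+ 2) =
  s^-1 * ((s * a - c) ^+ 2 + (s * b - d) ^+ 2).
  by field; rewrite gt_eqF.
by rewrite mulr_ge0 ?invr_ge0 ?(ltW s0)// addr_ge0 ?sqr_ge0.
Qed.

Lemma energyD (s : R) f g : 0 < s -> measurableC f -> measurableC g ->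
  (energy (f + g)%R <=
   (1 + s)%:E * energy f + (1 + s^-1)%:E * energy g)%E.
Proof.
move=> s0 mf mg.
have s1 : 0 <= 1 + s by rewrite addr_ge0// ltW.
have s2 : 0 <= 1 + s^-1 by rewrite addr_ge0// invr_ge0 ltW.
have mD := measurable_half_line.
have p f' t : half_line t -> (0 <= (cmod (f' t) ^+ 2)%:E)%E.
  by move=> _; rewrite lee_fin sqr_ge0.
rewrite /energy -!ge0_integralZl//; try exact: measurable_cmod2; try exact: p.
have mfg a h : measurableC h ->
    measurable_fun half_line (fun t => (a%:E * (cmod (h t) ^+ 2)%:E)%E).
  by move=> mh; exact: (measurable_funeM a%:E (measurable_cmod2 mh)).
rewrite -ge0_integralD//; last 4 first.
- by move=> t Dt; rewrite mule_ge0 ?lee_fin ?sqr_ge0.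
- exact: mfg.
- by move=> t Dt; rewrite mule_ge0 ?lee_fin ?sqr_ge0.
- exact: mfg.
apply: ge0_le_integral => //.
- by move=> t Dt; rewrite lee_fin sqr_ge0.
- by apply: measurable_cmod2; rewrite -[f]scale1r; exact: measurableC_lin.
- by apply: emeasurable_funD; exact: mfg.
- by move=> t Dt; rewrite -!EFinM -EFinD lee_fin; exact: cmodD2.
Qed.

(* Square-integrable functions; values off the half-line are irrelevant. *)
Definition L2_pred : {pred R -> R[i]} :=
  fun f => `[< measurableC f /\ (energy f < +oo)%E >].

Lemma L2_predP f : reflect (measurableC f /\ (energy f < +oo)%E) (f \in L2_pred).
Proof. exact: asboolP. Qed.

Lemma L2_submod_closed : submod_closed L2_pred.
Proof.
split.
  apply/L2_predP; split; first exact: measurableC0.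
  rewrite /energy; under eq_integral do rewrite cmodE expr0n addr0.
  by rewrite integral0.
move=> a f g /L2_predP[mf ef] /L2_predP[mg eg]; apply/L2_predP.
have maf : measurableC (a *: f).
  by rewrite -[a *: f]addr0; apply: measurableC_lin => //; exact: measurableC0.
split; first exact: measurableC_lin.
apply: (le_lt_trans (energyD ltr01 maf mg)).
rewrite lte_add_pinfty// lte_mul_pinfty ?lee_fin ?addr_ge0 ?invr_ge0//.
by rewrite energyZ// lte_mul_pinfty// lee_fin sqr_ge0.
Qed.

HB.instance Definition _ := GRing.isSubmodClosed.Build R[i] (R -> R[i]) L2_pred
  L2_submod_closed.

Record L2fun := MkL2fun { L2val :> R -> R[i]; L2valP : L2val \in L2_pred }.

HB.instance Definition _ := [isSub for L2val].
HB.instance Definition _ := [Choice of L2fun by <:].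
HB.instance Definition _ := [SubChoice_isSubLmodule of L2fun by <:].

Definition L2null : {pred L2fun} :=
  fun f : L2fun => `[< {ae mu, forall t, half_line t -> f t = 0} >].

Lemma L2nullP (f : L2fun) :
  reflect {ae mu, forall t, half_line t -> f t = 0} (f \in L2null).
Proof. exact: asboolP. Qed.

Lemma L2null_lin (a : R[i]) (f g : L2fun) :
  f \in L2null -> g \in L2null -> a *: f + g \in L2null.
Proof.
move=> /L2nullP f0 /L2nullP g0; apply/L2nullP.
have F := ae_filter_ringOfSetsType mu.
move: f0 g0; apply: (@filterS2 _ _ F) => t f0 g0 Dt.
by rewrite /= !fctE/= f0// g0// scaler0 addr0.
Qed.

Lemma L2null0 : 0 \in L2null.
Proof. by apply/L2nullP; apply: aeW. Qed.

Lemma L2null_zmod_closed : zmod_closed L2null.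
Proof.
split; first exact: L2null0.
by move=> f g f0 g0; rewrite addrC -scaleN1r; exact: L2null_lin.
Qed.

HB.instance Definition _ := GRing.isZmodClosed.Build L2fun L2null
  L2null_zmod_closed.

(* Classes of square-integrable functions modulo equality almost everywhere on
   the half-line. *)
Definition L2 := {quot L2null}.
HB.instance Definition _ := EqQuotient.on L2.
HB.instance Definition _ := GRing.Zmodule.on L2.
HB.instance Definition _ := ZmodQuotient.on L2.

Implicit Types (x y : L2) (a b : R[i]).

Lemma L2eqP (f g : L2fun) : reflect (\pi_L2 f = \pi_L2 g) (f - g \in L2null).
Proof. by rewrite idealrBE; exact: eqP. Qed.

Definition L2scale a x : L2 := \pi_L2 (a *: repr x).

Lemma pi_L2Z a (f : L2fun) : \pi_L2 (a *: f) = L2scale a (\pi_L2 f).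
Proof.
apply/L2eqP; rewrite -scalerBr -[_ *: _]addr0; apply: L2null_lin L2null0.
by apply/L2eqP; rewrite reprK.
Qed.

Lemma L2scaleA a b x : L2scale a (L2scale b x) = L2scale (a * b) x.
Proof. by rewrite -[x]reprK -(pi_L2Z b) -!pi_L2Z scalerA. Qed.

Lemma L2scale1 : left_id 1 L2scale.
Proof. by move=> x; rewrite -[x]reprK -pi_L2Z scale1r. Qed.

Lemma L2scaleDr : right_distributive L2scale +%R.
Proof.
move=> a x y; rewrite -[x]reprK -[y]reprK -raddfD -!pi_L2Z -raddfD.
by rewrite scalerDr.
Qed.

Lemma L2scaleDl x : {morph L2scale^~ x : a b / a + b}.
Proof. by move=> a b; rewrite -[x]reprK -!pi_L2Z -raddfD scalerDl. Qed.

HB.instance Definition _ := GRing.Zmodule_isLmodule.Build R[i] L2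
  L2scaleA L2scale1 L2scaleDr L2scaleDl.

Definition L2norm x : R := Num.sqrt (fine (energy (repr x))).

Lemma energy_null (f g : L2fun) : f - g \in L2null -> energy f = energy g.
Proof.
move=> /L2nullP fg.
have /L2_predP[mf _] := L2valP f; have /L2_predP[mg _] := L2valP g.
apply: ge0_ae_eq_integral.
- exact: measurable_half_line.
- exact: measurable_cmod2.
- exact: measurable_cmod2.
- by move=> t _; rewrite lee_fin sqr_ge0.
- by move=> t _; rewrite lee_fin sqr_ge0.
have F := ae_filter_ringOfSetsType mu.
move: fg; apply: (@filterS _ _ F) => t fg Dt.
by move/eqP: (fg Dt); rewrite subr_eq0 => /eqP ->.
Qed.

Lemma L2normE (f : L2fun) : L2norm (\pi_L2 f) = Num.sqrt (fine (energy f)).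
Proof.
by congr (Num.sqrt (fine _)); apply: energy_null; apply/L2eqP; rewrite reprK.
Qed.

Lemma L2norm_ge0 x : 0 <= L2norm x.
Proof. exact: sqrtr_ge0. Qed.

Lemma energyE (f : L2fun) : energy f = (L2norm (\pi_L2 f) ^+ 2)%:E.
Proof.
have /L2_predP[_ ef] := L2valP f.
rewrite L2normE sqr_sqrtr ?fine_ge0 ?energy_ge0// fineK//.
by rewrite ge0_fin_numE ?energy_ge0.
Qed.

Lemma L2normZ a x : L2norm (a *: x) = cmod a * L2norm x.
Proof.
rewrite -[x]reprK; set f := repr x.
have /L2_predP[mf _] := L2valP f.
have -> : a *: \pi_L2 f = \pi_L2 (a *: f) by rewrite pi_L2Z.
have h := energyZ a mf; move: h.
rewrite -[X in energy X]/(L2val (a *: f)) !energyE -EFinM -exprMn.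
have a0 : 0 <= cmod a by case: a => ? ?; exact: sqrtr_ge0.
case=> h; have := congr1 (@Num.sqrt R) h.
by rewrite !sqrtr_sqr !ger0_norm ?mulr_ge0 ?L2norm_ge0.
Qed.

Lemma L2normD x y : L2norm (x + y) <= L2norm x + L2norm y.
Proof.
rewrite -[x]reprK -[y]reprK -raddfD; set f := repr x; set g := repr y.
have /L2_predP[mf _] := L2valP f; have /L2_predP[mg _] := L2valP g.
set p := L2norm (\pi f); set q := L2norm (\pi g); set r := L2norm _.
have p0 : 0 <= p by exact: L2norm_ge0.
have q0 : 0 <= q by exact: L2norm_ge0.
have r0 : 0 <= r by exact: L2norm_ge0.
have key s : 0 < s -> r ^+ 2 <= (1 + s) * p ^+ 2 + (1 + s^-1) * q ^+ 2.
  move=> s0; have := energyD s0 mf mg.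
  have -> : (f : R -> R[i]) + (g : R -> R[i]) = (f + g : L2fun) by [].
  by rewrite !energyE -!EFinM -EFinD lee_fin.
rewrite -(@ler_pXn2r _ 2) ?nnegrE ?addr_ge0//.
apply/ler_addgt0Pr => e e0.
have [pq0|pq0] := eqVneq (p + q) 0.
  have p00 : p = 0 by lra.
  have q00 : q = 0 by lra.
  have := key 1 ltr01; rewrite p00 q00 invr1; nra.
have {}pq0 : 0 < p + q by rewrite lt_neqAle eq_sym pq0 addr_ge0.
pose d := e / (2 * (p + q)).
have d0 : 0 < d by rewrite divr_gt0// mulr_gt0.
have pd0 : 0 < p + d by rewrite ltr_wpDl.
have qd0 : 0 < q + d by rewrite ltr_wpDl.
apply: (le_trans (key ((q + d) / (p + d)) (divr_gt0 qd0 pd0))).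
have -> : (p + q) ^+ 2 + e = (p + q + 2 * d) * (p + q).
  by rewrite /d; field; rewrite gt_eqF.
have -> : (1 + (q + d) / (p + d)) * p ^+ 2 + (1 + ((q + d) / (p + d))^-1) * q ^+ 2
  = (p + q + 2 * d) * (p * (p / (p + d)) + q * (q / (q + d))).
  by field; rewrite !gt_eqF.
apply: ler_wpM2l; first lra.
apply: lerD; apply: ler_piMr => //; rewrite ler_pdivrMr// mul1r; lra.
Qed.

Lemma L2norm0_eq0 x : L2norm x = 0 -> x = 0.
Proof.
rewrite -[x]reprK; set f := repr x => f0.
have /L2_predP[mf _] := L2valP f.
have : energy f = 0%E by rewrite energyE f0 expr0n.
have absE : energy f = (\int[mu]_(t in half_line) `|(cmod (f t) ^+ 2)%:E|)%E.
  by apply: eq_integral => t _; rewrite gee0_abs// lee_fin sqr_ge0.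
rewrite absE => h.
have /(_ h) f00 :=
  (ae_eq_integral_abs mu measurable_half_line (measurable_cmod2 mf)).1.
rewrite -[RHS](raddf0 \pi_L2); apply/L2eqP; rewrite subr0.
apply/L2nullP; have F := ae_filter_ringOfSetsType mu.
move: f00; apply: (@filterS _ _ F) => t f00 Dt.
have [/eqP] := f00 Dt.
by rewrite sqrf_eq0 => /eqP; exact: Normc.eq0_normc.
Qed.

Let N x : R[i] := (L2norm x)%:C.

Let ND x y : N (x + y) <= N x + N y.
Proof. by rewrite -rmorphD/= lecR L2normD. Qed.

Let NZ a x : N (a *: x) = `|a| * N x.
Proof. by rewrite /N L2normZ rmorphM. Qed.

Let N0 x : N x = 0 -> x = 0.
Proof. by move=> [] /L2norm0_eq0. Qed.

HB.instance Definition _ := Lmodule_isNormed.Build R[i] L2 ND NZ N0.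

End L2.
Arguments L2 : clear implicits.

Section Shift.
Context {R : realType}.
Local Notation mu := (@lebesgue_measure R).
Implicit Types (f : R -> R[i]) (tau : R).

Definition shift_fun tau f : R -> R[i] :=
  fun t => if tau <= t then f (t - tau) else 0.

Let sub tau : measurableTypeR R -> measurableTypeR R := fun t : R => t - tau.

Let msub tau : measurable_fun setT (sub tau).
Proof. by apply: measurable_funB => //; exact: measurable_cst. Qed.

Let half_line_sub tau (t : R) : (t - tau \in half_line) = (tau <= t).
Proof.
by apply/idP/idP; rewrite inE /half_line/= in_itv/= andbT subr_ge0.
Qed.

Lemma lebesgue_measure_shift tau (A : set R) :
  measurable A -> pushforward mu (sub tau) A = mu A.
Proof.
move=> mA; pose phi : {mfun _ >-> _} :=
  HB.pack (sub tau) (isMeasurableFun.Build _ _ _ _ _ (msub tau)).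
apply/esym/(@lebesgue_measure_unique _ (pushforward mu phi)) => //= _ [[a b]] _ <-.
rewrite /pushforward.
have -> : phi @^-1` `]a, b]%classic = `]a + tau, b + tau]%classic.
  by apply/seteqP; split => t /=; rewrite !in_itv/= /sub ltrBrDr lerBlDr.
rewrite !lebesgue_measure_itv/= !lte_fin ltrD2r; case: ifP => // _.
by congr EFin; ring.
Qed.

Lemma measurable_shift tau (u : R -> R) : measurable_fun half_line u ->
  measurable_fun half_line (fun t => if tau <= t then u (t - tau) else 0).
Proof.
move=> mu0; have mT : measurable_fun setT (u \_ half_line).
  by apply/(measurable_restrictT _ _).1 => //; exact: measurable_half_line.
have := measurableT_comp mT (msub tau).
move=> /(@measurable_funTS _ _ _ _ half_line); apply: eq_measurable_fun => t _.
by rewrite /= patchE /sub half_line_sub.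
Qed.

Lemma shift_L2 tau (f : R -> R[i]) : f \in L2_pred -> shift_fun tau f \in L2_pred.
Proof.
move=> /L2_predP[mf ef]; apply/L2_predP.
have msf : measurableC (shift_fun tau f).
  case: mf => mr mi; split.
  - have := measurable_shift tau mr; apply: eq_measurable_fun => t _.
    by rewrite /shift_fun; case: ifP.
  - have := measurable_shift tau mi; apply: eq_measurable_fun => t _.
    by rewrite /shift_fun; case: ifP.
split => //; apply: le_lt_trans ef; rewrite /energy.
set E := fun t => (cmod (f t) ^+ 2)%:E.
have mE : measurable_fun half_line E by exact: measurable_cmod2.
have mET : measurable_fun setT (E \_ half_line).
  by apply/(measurable_restrictT _ _).1 => //; exact: measurable_half_line.
have E0 t : (0 <= (E \_ half_line) t)%E.
  by rewrite patchE; case: ifP => // _; rewrite lee_fin sqr_ge0.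
rewrite [leRHS]integral_mkcond.
have -> : (\int[mu]_t (E \_ half_line) t =
    \int[mu]_t ((E \_ half_line) \o sub tau) t)%E.
  rewrite -[in RHS](preimage_setT (sub tau)) -ge0_integral_pushforward//.
  by apply: eq_measure_integral => A mA _; exact/esym/lebesgue_measure_shift.
rewrite integral_mkcond; apply: ge0_le_integral => //.
- by move=> t _; rewrite patchE; case: ifP => // _; rewrite lee_fin sqr_ge0.
- apply/(measurable_restrictT _ _).1; first exact: measurable_half_line.
  exact: measurable_cmod2.
- exact: measurableT_comp mET (msub tau).
- move=> t _; rewrite [leLHS]patchE; case: ifP => _; last exact: E0.
  rewrite /shift_fun.
  have [taut|taut] := boolP (tau <= t).
    by rewrite /= patchE /sub half_line_sub taut.
  by rewrite cmodE expr0n addr0; exact: E0.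
Qed.

(* [shift] and [laplace] are computed on the representative chosen by [repr];
   the results do not depend on it. *)
Definition shift tau (x : L2 R) : L2 R :=
  \pi_(L2 R) (MkL2fun (shift_L2 tau (L2valP (repr x)))).

End Shift.

Section Transforms.
Context {R : realType}.
Implicit Types (F kappa xi : R[i] -> R[i]) (f : L2 R) (w z : R[i]).

Definition laplace f w : R[i] :=
  (Num.sqrt (2 * pi))^-1%:C *
  cintegral half_line (fun t => repr f t * cexp (- (w * t%:C))).

(* On [hardy_half_plane] this is the inverse of [laplace]; elsewhere, where no
   square-integrable preimage exists, it takes the junk value 0. *)
Definition laplace_inv F : L2 R :=
  xget 0 [set f | forall w, right_half_plane w -> laplace f w = F w].

Definition Phi F z : R[i] :=
  (2 * Num.sqrt pi)%:C / (1 + z) * F ((1 - z) / (1 + z)).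

Definition minimum_phase : set (L2 R) := [set f | outer (Phi (laplace f))].

Definition shifted_minimum_phase : set (L2 R) :=
  [set g | exists f tau, [/\ minimum_phase f, 0 <= tau & g = shift tau f]].

Definition mult_op kappa F w := kappa w * F w.
Definition comp_op xi F w := F (xi w).

End Transforms.

(* Main.v *)
Require Import Defs.
From HB Require Import structures.
From mathcomp Require Import all_boot all_order all_algebra.
From mathcomp Require Import all_classical all_reals all_analysis.
From mathcomp Require Import measurable_realfun complex ring lra.

(** Fix a point [w] of the right half-plane and consider the functional
    [Lam f = laplace (A f) w]. It is bounded, and it has no zero on minimum phase
    functions: [A f] is then a delayed minimum phase function, so its transform
    is an exponential times a transform whose image under [Phi] is outer, and
    outer functions have no zeros in the disk. The theorem is a
    Gleason-Kahane-Zelazko statement for such functionals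
    ([nonvanishing_functional]): [Lam] is a multiple of the evaluation
    [f |-> laplace f xi] at some point [xi] of the half-plane.

    Only the functions [e_k t = t ^ k * exp (- t)] have to be tested. With
    [u = 1 / (1 + v)], the transform of [e_k / k!] at [v] is a constant times
    [u ^ (k + 1)], so for [|t| < 1] the combination
    [sum_k 'C(n, k) * (- t) ^ k * e_k / k!] has a transform proportional to
    [u * (1 - t * u) ^ n], which [Phi] carries to a multiple of
    [(1 - a * z) ^ n] with [|a| < 1]. Such powers are outer ([outer_power]): the
    Schwarz integral of [log |1 - a * exp (i * theta)|] is computed from the
    power series of the logarithm. Hence, with
    [m_k = Lam e_k / (k! * Lam e_0)], no polynomial
    [sum_k 'C(n, k) * (- t) ^ k * m_k] vanishes for [|t| < 1]. It is therefore a
    product of at most [n] factors [1 + y * t] with [|y| <= 1], and for the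
    elementary symmetric functions [s_k] of such numbers [s_1 * s_k] differs from
    [(k + 1) * s_(k + 1)] by at most [k * 'C(n, k)]. Dividing by
    [n * 'C(n, k)] and letting [n] grow gives [m_(k + 1) = m_1 * m_k]
    ([powers_of_nonvanishing]). So [Lam e_k = Lam e_0 * k! * b ^ k] for
    [b = m_1], which up to a common factor is the value at [xi = 1 / b - 1] of
    the transform of [e_k].

    That [xi] lies in the half-plane means [|2 * b - 1| < 1]. This is where
    boundedness enters: on the Laguerre functions, which are orthogonal and of
    equal norm, [Lam] takes values proportional to [(2 * b - 1) ^ k], and these
    have to be square summable ([functional_disk_bound]). As the [e_k] span a
    dense subspace ([functional_eq0_pow_exp]), [Lam] is then the multiple of the
    evaluation at [xi] on all of the space. Density is obtained from Lerch's
    approximation of the indicators of half-lines by combinations of the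
    functions [exp (- n * t)] ([exp_dense]).

    Letting [w] vary, [xi + 1] is the quotient of the transforms of [A e_0] and
    [A e_1], so [xi] is analytic, and [alpha] is the transform of [A e_0]. What
    remains is that transforms belong to the Hardy space ([hardy_laplace]) and
    determine the function ([laplace_injective]). The first is a computation
    with partial fractions for sums of exponentials, extended to the whole space
    by Fatou's lemma. *)

Set Implicit Arguments.
Unset Strict Implicit.
Unset Printing Implicit Defensive.
Import Order.TTheory GRing.Theory Num.Theory.
Import numFieldNormedType.Exports.
Local Open Scope classical_set_scope.
Local Open Scope ring_scope.
Local Open Scope complex_scope.
Local Open Scope quotient_scope.

Local Notation Re := (@complex.Re _).
Local Notation Im := (@complex.Im _).

(** * Complex numbers and complex-valued functions of a real variable *)

Section ComplexNumbers.
Context {R : realType}.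
Implicit Types (z w : R[i]) (r : R).

Lemma complex_ext z w : Re z = Re w -> Im z = Im w -> z = w.
Proof. by case: z w => a b [c d] /= -> ->. Qed.

Lemma ReD z w : Re (z + w) = Re z + Re w. Proof. by case: z w => a b []. Qed.
Lemma ImD z w : Im (z + w) = Im z + Im w. Proof. by case: z w => a b []. Qed.
Lemma ReN z : Re (- z) = - Re z. Proof. by case: z. Qed.
Lemma ImN z : Im (- z) = - Im z. Proof. by case: z. Qed.
Lemma ReB z w : Re (z - w) = Re z - Re w. Proof. by rewrite ReD ReN. Qed.
Lemma ImB z w : Im (z - w) = Im z - Im w. Proof. by rewrite ImD ImN. Qed.
Lemma ReM z w : Re (z * w) = Re z * Re w - Im z * Im w.
Proof. by case: z w => a b []. Qed.
Lemma ImM z w : Im (z * w) = Re z * Im w + Im z * Re w.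
Proof. by case: z w => a b []. Qed.
Lemma Re_conj z : Re z^* = Re z. Proof. by case: z. Qed.
Lemma Im_conj z : Im z^* = - Im z. Proof. by case: z. Qed.

Definition ReIm := (ReD, ImD, ReN, ImN, ReM, ImM, Re_conj, Im_conj).

Lemma Re_sum I (s : seq I) (P : pred I) (F : I -> R[i]) :
  Re (\sum_(i <- s | P i) F i) = \sum_(i <- s | P i) Re (F i).
Proof. by apply: (big_morph (@complex.Re R)) => // z w; rewrite ReD. Qed.

Lemma Im_sum I (s : seq I) (P : pred I) (F : I -> R[i]) :
  Im (\sum_(i <- s | P i) F i) = \sum_(i <- s | P i) Im (F i).
Proof. by apply: (big_morph (@complex.Im R)) => // z w; rewrite ImD. Qed.

Lemma normCE z : `|z| = (cmod z)%:C. Proof. by []. Qed.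

Lemma cmod_ge0 z : 0 <= cmod z.
Proof. by case: z => a b; exact: sqrtr_ge0. Qed.

Lemma cmod0 : cmod (0 : R[i]) = 0. Proof. exact: Normc.normc0. Qed.
Lemma cmod1 : cmod (1 : R[i]) = 1. Proof. exact: Normc.normc1. Qed.
Lemma cmodN z : cmod (- z) = cmod z.
Proof. by apply: complexI; rewrite -!normCE normrN. Qed.
Lemma cmodBC z w : cmod (z - w) = cmod (w - z).
Proof. by rewrite -cmodN opprB. Qed.
Lemma cmodD z w : cmod (z + w) <= cmod z + cmod w.
Proof. exact: le_normcD. Qed.
Lemma cmodB z w : cmod (z - w) <= cmod z + cmod w.
Proof. by rewrite -(cmodN w) cmodD. Qed.
Lemma cmodV z : cmod z^-1 = (cmod z)^-1.
Proof. exact: Normc.normcV. Qed.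
Lemma cmodX z n : cmod (z ^+ n) = cmod z ^+ n.
Proof. by elim: n => [|n ih]; rewrite ?expr0 ?cmod1// !exprS cmodM ih. Qed.
Lemma cmod_real r : cmod r%:C = `|r|.
Proof. by rewrite /cmod /= expr0n addr0 sqrtr_sqr. Qed.
Lemma cmod_ge0_real r : 0 <= r -> cmod r%:C = r.
Proof. by move=> r0; rewrite cmod_real ger0_norm. Qed.
Lemma cmod_nat n : cmod (n%:R : R[i]) = n%:R.
Proof. by rewrite -(rmorph_nat (real_complex R)) cmod_ge0_real. Qed.
Lemma cmod_eq0 z : (cmod z == 0) = (z == 0).
Proof.
apply/eqP/eqP => [|->]; last exact: cmod0.
exact: Normc.eq0_normc.
Qed.
Lemma cmod_gt0 z : (0 < cmod z) = (z != 0).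
Proof. by rewrite lt_neqAle cmod_ge0 andbT eq_sym cmod_eq0. Qed.
Lemma cmod_conj z : cmod z^* = cmod z.
Proof. by case: z => a b; rewrite /cmod /= sqrrN. Qed.

Lemma cmod_dist z w : `|cmod z - cmod w| <= cmod (z - w).
Proof.
rewrite ler_norml; apply/andP; split.
  by have := cmodD (w - z) z; rewrite subrK (cmodBC w z); lra.
by have := cmodD (z - w) w; rewrite subrK; lra.
Qed.

Lemma cmod_sum I (s : seq I) (P : pred I) (F : I -> R[i]) :
  cmod (\sum_(i <- s | P i) F i) <= \sum_(i <- s | P i) cmod (F i).
Proof.
elim/big_rec2: _ => [|i y x _ ih]; first by rewrite cmod0.
by rewrite (le_trans (cmodD _ _))// lerD2l.
Qed.

Lemma Re_le_cmod z : `|Re z| <= cmod z.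
Proof.
rewrite -(@ler_pXn2r _ 2) ?nnegrE ?cmod_ge0// cmodE real_normK ?num_real//.
by rewrite lerDl sqr_ge0.
Qed.

Lemma Im_le_cmod z : `|Im z| <= cmod z.
Proof.
rewrite -(@ler_pXn2r _ 2) ?nnegrE ?cmod_ge0// cmodE real_normK ?num_real//.
by rewrite lerDr sqr_ge0.
Qed.

Lemma cmod_le_ReIm z : cmod z <= `|Re z| + `|Im z|.
Proof.
rewrite {1}[z](_ : _ = (Re z)%:C + 'i%C * (Im z)%:C); last first.
  by apply: complex_ext; rewrite !ReIm /=; ring.
rewrite (le_trans (cmodD _ _))// cmodM !cmod_real.
by rewrite /cmod /= expr0n add0r expr1n sqrtr1 mul1r.
Qed.

Lemma mul_conj z : z * z^* = (cmod z ^+ 2)%:C.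
Proof.
by apply: complex_ext; rewrite !ReIm cmodE /=; ring.
Qed.

Lemma Re_ge_Ncmod z : - cmod z <= Re z.
Proof. by rewrite lerNl (le_trans (ler_norm _))// normrN Re_le_cmod. Qed.

Lemma natr_gt0 n : 0 < Re (n.+1%:R : R[i]).
Proof. by rewrite -(rmorph_nat (real_complex R)) /= ltr0n. Qed.

Lemma re1_gt0 : 0 < Re (1 : R[i]).
Proof. exact: ltr01. Qed.

Lemma cexpD z w : cexp (z + w) = cexp z * cexp w.
Proof.
apply: complex_ext; rewrite /cexp !ReIm /= ?expRD ?cosD ?sinD; ring.
Qed.

Lemma cexp0 : cexp (0 : R[i]) = 1.
Proof. by apply: complex_ext; rewrite /cexp !ReIm /= expR0 cos0 sin0; ring. Qed.

Lemma cmod_cexp z : cmod (cexp z) = expR (Re z).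
Proof.
rewrite /cexp cmodM cmod_ge0_real ?expR_ge0// /cmod /=.
by rewrite cos2Dsin2 sqrtr1 mulr1.
Qed.

Lemma cexp_neq0 z : cexp z != 0.
Proof. by rewrite -cmod_gt0 cmod_cexp expR_gt0. Qed.

Lemma cexp_real r : cexp r%:C = (expR r)%:C.
Proof. by rewrite /cexp /= cos0 sin0 complexr0 mulr1. Qed.

Lemma cexpMn z n : cexp (z *+ n) = cexp z ^+ n.
Proof.
elim: n => [|n ih]; first by rewrite mulr0n expr0 cexp0.
by rewrite mulrS cexpD ih exprS.
Qed.

End ComplexNumbers.

Section RealVariable.
Context {R : realType}.
Implicit Types (f g : R -> R[i]) (s : R) (d : R[i]).

Lemma is_derive_fun_mul (f g : R -> R) (s a b : R) :
  is_derive s 1 f a -> is_derive s 1 g b ->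
  is_derive s 1 (fun t => f t * g t) (a * g s + f s * b).
Proof.
move=> fa gb; have fg := is_deriveM fa gb.
by apply: (is_derive_eq fg); transitivity (f s * b + g s * a) => //; ring.
Qed.

Lemma is_derive_fun_sub (f g : R -> R) (s a b : R) :
  is_derive s 1 f a -> is_derive s 1 g b ->
  is_derive s 1 (fun t => f t - g t) (a - b).
Proof. by move=> fa gb; exact: is_deriveB fa gb. Qed.

Lemma is_derive_fun_add (f g : R -> R) (s a b : R) :
  is_derive s 1 f a -> is_derive s 1 g b ->
  is_derive s 1 (fun t => f t + g t) (a + b).
Proof. by move=> fa gb; exact: is_deriveD fa gb. Qed.

Lemma is_derive_fun_comp (f g : R -> R) (s a b : R) :
  is_derive (g s) 1 f a -> is_derive s 1 g b ->
  is_derive s 1 (fun t => f (g t)) (a * b).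
Proof. by move=> fa gb; exact: is_derive1_comp fa gb. Qed.

Lemma is_derive_fun_eq (f : R -> R) (s a b : R) :
  is_derive s 1 f a -> a = b -> is_derive s 1 f b.
Proof. by move=> ? <-. Qed.

(** The derivative is taken componentwise because [R] and [R[i]] are not normed
    modules over a common field. *)
Definition cderiv f s d :=
  is_derive s 1 (fun t => Re (f t)) (Re d) /\
  is_derive s 1 (fun t => Im (f t)) (Im d).

Lemma cderiv_cst c s : cderiv (fun=> c) s 0.
Proof. by split; exact: is_derive_cst. Qed.

Lemma cderivD f g s d e :
  cderiv f s d -> cderiv g s e -> cderiv (fun t => f t + g t) s (d + e).
Proof.
move=> [f1 f2] [g1 g2]; split.
- under eq_fun do rewrite ReD; rewrite ReD; exact: is_deriveD.
- under eq_fun do rewrite ImD; rewrite ImD; exact: is_deriveD.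
Qed.

Lemma cderivM f g s d e : cderiv f s d -> cderiv g s e ->
  cderiv (fun t => f t * g t) s (d * g s + f s * e).
Proof.
move=> [f1 f2] [g1 g2]; split.
- under eq_fun do rewrite ReM.
  apply: (is_derive_fun_eq (is_derive_fun_sub (is_derive_fun_mul f1 g1)
    (is_derive_fun_mul f2 g2))).
  by rewrite !ReIm; ring.
- under eq_fun do rewrite ImM.
  apply: (is_derive_fun_eq (is_derive_fun_add (is_derive_fun_mul f1 g2)
    (is_derive_fun_mul f2 g1))).
  by rewrite !ReIm; ring.
Qed.

Lemma cderiv_eq f s d e : cderiv f s d -> d = e -> cderiv f s e.
Proof. by move=> ? <-. Qed.

Lemma cderiv_ext f g s d e :
  cderiv f s d -> f =1 g -> d = e -> cderiv g s e.
Proof. by move=> fd /funext <- <-. Qed.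

Lemma cderivZ c g s e : cderiv g s e -> cderiv (fun t => c * g t) s (c * e).
Proof.
move=> ge; apply: cderiv_eq (cderivM (cderiv_cst c s) ge) _.
by rewrite mul0r add0r.
Qed.

Lemma cderiv_real s : cderiv (fun t => t%:C) s 1.
Proof. by split => /=; [exact: is_derive_id|exact: is_derive_cst]. Qed.

Lemma cderiv_cexp g s d :
  cderiv g s d -> cderiv (fun t => cexp (g t)) s (d * cexp (g s)).
Proof.
move=> [g1 g2]; rewrite /cexp; split.
- under eq_fun do rewrite ReM /= mul0r subr0.
  apply: (is_derive_fun_eq (is_derive_fun_mul
    (is_derive_fun_comp (is_derive_expR _) g1)
    (is_derive_fun_comp (is_derive_cos _) g2))).
  by rewrite !ReIm /=; ring.
- under eq_fun do rewrite ImM /= mul0r addr0.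
  apply: (is_derive_fun_eq (is_derive_fun_mul
    (is_derive_fun_comp (is_derive_expR _) g1)
    (is_derive_fun_comp (is_derive_sin _) g2))).
  by rewrite !ReIm /=; ring.
Qed.

Lemma cderivX g s d n : cderiv g s d ->
  cderiv (fun t => g t ^+ n) s (n%:R * d * g s ^+ n.-1).
Proof.
move=> gd; elim: n => [|n ih].
  by rewrite !mul0r; exact: cderiv_cst.
under eq_fun do rewrite exprS.
apply: cderiv_eq (cderivM gd ih) _.
case: n {ih} => [|n]; rewrite /= ?expr0; first by ring.
by rewrite -natr1 exprS; ring.
Qed.

Lemma cderiv_sum n (F : nat -> R -> R[i]) (d : nat -> R[i]) s :
  (forall i, (i < n)%N -> cderiv (F i) s (d i)) ->
  cderiv (fun t => \sum_(i < n) F i t) s (\sum_(i < n) d i).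
Proof.
elim: n => [|n ih] h.
  under eq_fun do rewrite big_ord0.
  rewrite big_ord0; exact: cderiv_cst.
under eq_fun do rewrite big_ord_recr.
by rewrite big_ord_recr /=; apply: cderivD; [apply: ih => i /ltnW; exact: h|exact: h].
Qed.

Lemma derive_continuous (h : R -> R) (s d : R) : is_derive s 1 h d ->
  {for s, continuous h}.
Proof. by move=> hd; apply: differentiable_continuous; apply/derivable1_diffP. Qed.

(** There is no mean value theorem for complex values; treating the real and the
    imaginary part separately costs the factor 2. *)
Lemma cmod_mean_value f (d : R -> R[i]) (a b M : R) : a <= b ->
  (forall s, a <= s <= b -> cderiv f s (d s)) ->
  (forall s, a <= s <= b -> cmod (d s) <= M) ->
  cmod (f b - f a) <= 2 * (M * (b - a)).
Proof.
move=> ab fd dM.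
have part (h : R -> R) (e : R -> R) :
    (forall s, a <= s <= b -> is_derive s 1 h (e s)) ->
    (forall s, a <= s <= b -> `|e s| <= M) -> `|h b - h a| <= M * (b - a).
  move=> he eM.
  have [||c cab ->] := @MVT_segment _ h e a b ab.
  - move=> x; rewrite in_itv /= => /andP[ax xb].
    by apply: he; rewrite !ltW.
  - apply: continuous_in_subspaceT => x; rewrite inE /= in_itv /= => xab.
    exact: derive_continuous (he _ xab).
  - rewrite normrM (ger0_norm (_ : 0 <= b - a)) ?subr_ge0//.
    by rewrite ler_wpM2r ?subr_ge0// eM// -in_itv.
rewrite (le_trans (cmod_le_ReIm _))// mulr_natl mulr2n ReB ImB; apply: lerD.
- apply: (part (fun s => Re (f s)) (fun s => Re (d s))) => s sab; first by case: (fd s sab).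
  exact: le_trans (Re_le_cmod _) (dM _ sab).
- apply: (part (fun s => Im (f s)) (fun s => Im (d s))) => s sab; first by case: (fd s sab).
  exact: le_trans (Im_le_cmod _) (dM _ sab).
Qed.

Lemma cmod_cexp_sub1 (z : R[i]) : cmod (cexp z - 1) <= 2 * (cmod z * expR (cmod z)).
Proof.
have h s : 0 <= s <= 1 -> cderiv (fun t => cexp (t%:C * z)) s (z * cexp (s%:C * z)).
  move=> _; apply: cderiv_eq.
    by apply: cderiv_cexp; apply: cderivM; [exact: cderiv_real|exact: cderiv_cst].
  by cbn beta; ring.
have M s : 0 <= s <= 1 -> cmod (z * cexp (s%:C * z)) <= cmod z * expR (cmod z).
  move=> /andP[s0 s1]; rewrite cmodM ler_wpM2l ?cmod_ge0// cmod_cexp ler_expR.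
  rewrite (le_trans (ler_norm _))// (le_trans (Re_le_cmod _))// cmodM.
  by rewrite cmod_ge0_real// ler_piMl ?cmod_ge0.
have := cmod_mean_value ler01 h M.
by rewrite mul1r mul0r cexp0 subr0 mulr1.
Qed.

Lemma cmod_cexp_sub1_sub (z : R[i]) :
  cmod (cexp z - 1 - z) <= 4 * (cmod z ^+ 2 * expR (cmod z)).
Proof.
have h s : 0 <= s <= 1 -> cderiv (fun t => cexp (t%:C * z) - t%:C * z) s
    (z * (cexp (s%:C * z) - 1)).
  move=> _; apply: cderiv_eq.
    apply: cderivD.
      by apply: cderiv_cexp; apply: cderivM; [exact: cderiv_real|exact: cderiv_cst].
    under eq_fun do rewrite -mulNr mulrC.
    apply: (@cderivZ z (fun t => - t%:C) s (-1)).
    under eq_fun do rewrite -mulN1r.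
    apply: cderiv_eq; first by apply: cderivZ; exact: cderiv_real.
    by cbn beta; ring.
  by cbn beta; ring.
have M s : 0 <= s <= 1 -> cmod (z * (cexp (s%:C * z) - 1)) <=
    2 * (cmod z ^+ 2 * expR (cmod z)).
  move=> /andP[s0 s1]; rewrite cmodM.
  have -> : 2 * (cmod z ^+ 2 * expR (cmod z)) =
    cmod z * (2 * (cmod z * expR (cmod z))) by ring.
  rewrite ler_wpM2l ?cmod_ge0// (le_trans (cmod_cexp_sub1 _))// ler_wpM2l//.
  have sz : cmod (s%:C * z) <= cmod z.
    by rewrite cmodM cmod_ge0_real// ler_piMl ?cmod_ge0.
  by apply: ler_pM; rewrite ?cmod_ge0 ?expR_ge0// ler_expR.
have := cmod_mean_value ler01 h M.
rewrite !mul1r mul0r cexp0 !subr0 mulr1.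
by rewrite (_ : cexp z - z - 1 = cexp z - 1 - z); [nra|ring].
Qed.

End RealVariable.

(** * Integrals of complex-valued functions *)

Section ComplexLimits.
Context {R : realType} {T : Type} (F : set_system T).
Context {FF : Filter F}.
Implicit Types (u : T -> R[i]) (l : R[i]).

(** The topology of [R[i]] comes from a norm with values in [R[i]] itself; this
    lemma brings convergence back to real sequences. *)
Lemma complex_cvgE u l :
  u @ F --> l <-> cmod (u x - l) @[x --> F] --> (0 : R).
Proof.
split => [/cvgrPdist_lt ul|/cvgrPdist_lt ul]; apply/cvgrPdist_lt => e e0.
- have e0' : 0 < e%:C :> R[i] by rewrite ltcR.
  have := ul _ e0'; apply: filterS => x.
  by rewrite normCE ltcR sub0r normrN ger0_norm ?cmod_ge0// cmodBC.
- have e0' : 0 < Re e by move: e0; rewrite ltcE => /andP[].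
  have eE : e = (Re e)%:C.
    by move: e0; rewrite ltcE => /andP[/eqP ie _]; apply: complex_ext.
  have := ul _ e0'; apply: filterS => x.
  by rewrite sub0r normrN ger0_norm ?cmod_ge0// eE normCE ltcR cmodBC -eE.
Qed.

End ComplexLimits.

Section ComplexIntegral.
Context {R : realType}.
Local Notation mu := (@lebesgue_measure R).
Implicit Types (D : set (measurableTypeR R)) (f g : R -> R[i]) (h : R -> R).

Definition cmeasurable D f :=
  measurable_fun D (fun t => Re (f t)) /\ measurable_fun D (fun t => Im (f t)).

Definition cintegrable D f :=
  mu.-integrable D (EFin \o (fun t => Re (f t))) /\
  mu.-integrable D (EFin \o (fun t => Im (f t))).

Lemma cmeasurable_cst D c : cmeasurable D (fun=> c).
Proof. by split; exact: measurable_cst. Qed.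

Lemma cmeasurableD D f g : cmeasurable D f -> cmeasurable D g ->
  cmeasurable D (fun t => f t + g t).
Proof.
move=> [f1 f2] [g1 g2]; split.
- by under eq_fun do rewrite ReD; exact: measurable_funD.
- by under eq_fun do rewrite ImD; exact: measurable_funD.
Qed.

Lemma cmeasurableM D f g : cmeasurable D f -> cmeasurable D g ->
  cmeasurable D (fun t => f t * g t).
Proof.
move=> [f1 f2] [g1 g2]; split.
- under eq_fun do rewrite ReM.
  by apply: measurable_funB; exact: measurable_funM.
- under eq_fun do rewrite ImM.
  by apply: measurable_funD; exact: measurable_funM.
Qed.

Lemma cmeasurableZ D c f : cmeasurable D f -> cmeasurable D (fun t => c * f t).
Proof. by move=> mf; apply: cmeasurableM mf; exact: cmeasurable_cst. Qed.

Lemma cmeasurable_conj D f : cmeasurable D f -> cmeasurable D (fun t => (f t)^*).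
Proof.
move=> [f1 f2]; split; first by under eq_fun do rewrite Re_conj.
by under eq_fun do rewrite Im_conj; exact: measurable_funN.
Qed.

Lemma cmeasurable_real D h : measurable_fun D h -> cmeasurable D (fun t => (h t)%:C).
Proof. by move=> mh; split => //=; exact: measurable_cst. Qed.

Lemma cmeasurable_sum D n (F : nat -> R -> R[i]) :
  (forall i, cmeasurable D (F i)) -> cmeasurable D (fun t => \sum_(i < n) F i t).
Proof.
move=> mF; elim: n => [|n ih].
  by under eq_fun do rewrite big_ord0; exact: cmeasurable_cst.
by under eq_fun do rewrite big_ord_recr; exact: cmeasurableD.
Qed.

Lemma cderiv_measurable D f (d : R -> R[i]) : measurable D ->
  (forall s, cderiv f s (d s)) -> cmeasurable D f.
Proof.
move=> mD fd; split; apply: measurable_funTS; apply: continuous_measurable_fun => s;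
  by have [? ?] := fd s; apply: derive_continuous; eassumption.
Qed.

Lemma cmod_measurable D f : cmeasurable D f -> measurable_fun D (fun t => cmod (f t)).
Proof.
move=> [f1 f2]; have -> : (fun t => cmod (f t)) =
    (fun t => Num.sqrt (Re (f t) ^+ 2 + Im (f t) ^+ 2)).
  by apply/funext => t; rewrite -cmodE sqrtr_sqr ger0_norm// cmod_ge0.
apply: (@measurableT_comp _ _ _ _ _ _ (@Num.sqrt R)).
  by apply: continuous_measurable_fun => x; exact: sqrt_continuous.
by apply: measurable_funD; exact: measurable_funX.
Qed.

Lemma cmeasurable_inv D f : measurable D ->
  cmeasurable D f -> cmeasurable D (fun t => (f t)^-1).
Proof.
move=> mD mf; have -> : (fun t => (f t)^-1) =
    (fun t => ((cmod (f t) ^+ 2)^-1)%:C * (f t)^*).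
  apply/funext => t; have [->|f0] := eqVneq (f t) 0.
    by rewrite invr0 cmod0 expr0n invr0 mul0r.
  apply: (mulfI f0); rewrite divff// mulrCA mul_conj -rmorphM /= mulVf//.
  by rewrite expf_neq0// cmod_eq0.
apply: cmeasurableM; last exact: cmeasurable_conj.
apply: cmeasurable_real.
have -> : (fun t => (cmod (f t) ^+ 2)^-1) = (fun t => (cmod (f t) ^+ 2) `^ (-1)).
  by apply/funext => t; rewrite powR_inv1// sqr_ge0.
apply: (@measurableT_comp _ _ _ _ _ _ (fun x : R => x `^ (-1))).
  exact: measurable_powR.
by apply: measurable_funX; exact: cmod_measurable.
Qed.

Lemma cintegrable_dominated D f h : measurable D -> cmeasurable D f ->
  mu.-integrable D (EFin \o h) -> (forall t, D t -> cmod (f t) <= h t) ->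
  cintegrable D f.
Proof.
move=> mD [f1 f2] ih fh; split.
- apply: le_integrable ih => //; first exact/measurable_EFinP.
  move=> t Dt /=; rewrite lee_fin (le_trans (Re_le_cmod _))//.
  by rewrite (le_trans (fh t Dt))// ler_norm.
- apply: le_integrable ih => //; first exact/measurable_EFinP.
  move=> t Dt /=; rewrite lee_fin (le_trans (Im_le_cmod _))//.
  by rewrite (le_trans (fh t Dt))// ler_norm.
Qed.

Lemma cintegrable_measurable D f : cintegrable D f -> cmeasurable D f.
Proof. by move=> [/measurable_int/measurable_EFinP f1 /measurable_int/measurable_EFinP f2]. Qed.

Lemma cintegrable_cmod D f : measurable D -> cintegrable D f ->
  mu.-integrable D (EFin \o (fun t => cmod (f t))).
Proof.
move=> mD fi; have mf := cintegrable_measurable fi; case: fi => f1 f2.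
have ig := integrableD mD (integrable_norm f1) (integrable_norm f2).
apply: le_integrable ig => //.
- by apply/measurable_EFinP; exact: cmod_measurable.
- move=> t Dt /=; rewrite lee_fin ger0_norm ?cmod_ge0//.
  by rewrite ger0_norm ?addr_ge0// cmod_le_ReIm.
Qed.

Lemma eq_cintegral D f g : (forall t, D t -> f t = g t) ->
  cintegral D f = cintegral D g.
Proof.
move=> fg; rewrite /cintegral; congr (_ +i* _);
  by apply: eq_Rintegral => t; rewrite inE => /fg ->.
Qed.

Lemma cintegrableD D f g : measurable D -> cintegrable D f -> cintegrable D g ->
  cintegrable D (fun t => f t + g t).
Proof.
move=> mD [f1 f2] [g1 g2]; split.
- by under eq_fun do rewrite ReD; exact: (integrableD mD f1 g1).
- by under eq_fun do rewrite ImD; exact: (integrableD mD f2 g2).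
Qed.

Lemma cintegralD D f g : measurable D -> cintegrable D f -> cintegrable D g ->
  cintegral D (fun t => f t + g t) = cintegral D f + cintegral D g.
Proof.
move=> mD [f1 f2] [g1 g2]; apply: complex_ext; rewrite !ReIm /=.
- by under eq_Rintegral do rewrite ReD; rewrite RintegralD.
- by under eq_Rintegral do rewrite ImD; rewrite RintegralD.
Qed.

Lemma cintegrableZ D c f : measurable D -> cintegrable D f ->
  cintegrable D (fun t => c * f t).
Proof.
move=> mD [f1 f2]; split.
- under eq_fun do rewrite ReM.
  have := integrableB mD (integrableZl mD (Re c) f1) (integrableZl mD (Im c) f2).
  by apply: eq_integrable => // t _; rewrite /= -!EFinM -EFinB.
- under eq_fun do rewrite ImM.
  have := integrableD mD (integrableZl mD (Re c) f2) (integrableZl mD (Im c) f1).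
  by apply: eq_integrable => // t _; rewrite /= -!EFinM -EFinD.
Qed.

Lemma integrable_EFinZ D h (r : R) : measurable D -> mu.-integrable D (EFin \o h) ->
  mu.-integrable D (EFin \o (fun t => r * h t)).
Proof. by move=> mD ih; exact: (integrableZl mD r ih). Qed.

Lemma cintegralZ D c f : measurable D -> cintegrable D f ->
  cintegral D (fun t => c * f t) = c * cintegral D f.
Proof.
move=> mD [f1 f2]; apply: complex_ext; rewrite !ReIm /=.
- under eq_Rintegral do rewrite ReM.
  by rewrite RintegralB ?RintegralZl//; exact: integrable_EFinZ.
- under eq_Rintegral do rewrite ImM.
  by rewrite RintegralD ?RintegralZl//; exact: integrable_EFinZ.
Qed.

Lemma cintegrableB D f g : measurable D -> cintegrable D f -> cintegrable D g ->
  cintegrable D (fun t => f t - g t).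
Proof.
move=> mD fi gi; under eq_fun do rewrite -[- g _]mulN1r.
by apply: cintegrableD => //; exact: cintegrableZ.
Qed.

Lemma cintegralB D f g : measurable D -> cintegrable D f -> cintegrable D g ->
  cintegral D (fun t => f t - g t) = cintegral D f - cintegral D g.
Proof.
move=> mD fi gi; under eq_fun do rewrite -[- g _]mulN1r.
by rewrite cintegralD ?cintegralZ ?mulN1r//; exact: cintegrableZ.
Qed.

Lemma cintegral0 D : cintegral D (fun=> 0 : R[i]) = 0.
Proof. by apply: complex_ext; rewrite /= /Rintegral integral0_eq. Qed.

Lemma cintegrable0 D : measurable D -> cintegrable D (fun=> 0 : R[i]).
Proof. by move=> mD; split; exact: integrable0. Qed.

Lemma cintegrable_sum D n (F : nat -> R -> R[i]) : measurable D ->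
  (forall i, cintegrable D (F i)) -> cintegrable D (fun t => \sum_(i < n) F i t).
Proof.
move=> mD iF; elim: n => [|n ih].
  by under eq_fun do rewrite big_ord0; exact: cintegrable0.
under eq_fun do rewrite big_ord_recr; by apply: cintegrableD.
Qed.

Lemma cintegral_sum D n (F : nat -> R -> R[i]) : measurable D ->
  (forall i, cintegrable D (F i)) ->
  cintegral D (fun t => \sum_(i < n) F i t) = \sum_(i < n) cintegral D (F i).
Proof.
move=> mD iF; elim: n => [|n ih].
  rewrite big_ord0 -[RHS](cintegral0 D).
  by apply: eq_cintegral => t _; rewrite big_ord0.
rewrite big_ord_recr /= -ih -cintegralD//; last exact: cintegrable_sum.
by apply: eq_cintegral => t _; rewrite big_ord_recr.
Qed.

(** The factor 2 comes from estimating the two components separately. *)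
Lemma cmod_cintegral D f h : measurable D -> cmeasurable D f ->
  mu.-integrable D (EFin \o h) -> (forall t, D t -> cmod (f t) <= h t) ->
  cmod (cintegral D f) <= 2 * \int[mu]_(t in D) h t.
Proof.
move=> mD mf ih fh; have [f1 f2] := cintegrable_dominated mD mf ih fh.
rewrite (le_trans (cmod_le_ReIm _))// mulr_natl mulr2n /=; apply: lerD.
- rewrite (le_trans (le_normr_Rintegral mD f1))// le_Rintegral//.
  + exact: (integrable_norm f1).
  + by move=> t Dt; rewrite (le_trans (Re_le_cmod _))// fh.
- rewrite (le_trans (le_normr_Rintegral mD f2))// le_Rintegral//.
  + exact: (integrable_norm f2).
  + by move=> t Dt; rewrite (le_trans (Im_le_cmod _))// fh.
Qed.

Lemma Rintegral_dominated_cvg D (u : nat -> R -> R) (v h : R -> R) : measurable D ->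
  (forall n, measurable_fun D (u n)) -> measurable_fun D v ->
  mu.-integrable D (EFin \o h) ->
  {ae mu, forall t, D t -> u n t @[n --> \oo] --> v t} ->
  (forall n t, D t -> `|u n t| <= h t) ->
  mu.-integrable D (EFin \o v) /\
  (\int[mu]_(t in D) u n t)%R @[n --> \oo] --> (\int[mu]_(t in D) v t)%R.
Proof.
move=> mD mU mv ih uv uh.
have [|||||iv _ uv'] := @dominated_convergence _ _ _ mu D mD
  (fun n => EFin \o u n) (EFin \o v) (EFin \o h).
- by move=> n; exact/measurable_EFinP.
- exact/measurable_EFinP.
- have FF := ae_filter_ringOfSetsType mu.
  move: uv; apply: (@filterS _ _ FF) => t uv Dt.
  by apply: cvg_EFin (uv Dt); exact: nearW.
- exact: ih.
- by apply: aeW => t n Dt /=; rewrite lee_fin uh.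
split=> //.
have fv : (\int[mu]_(t in D) (EFin \o v) t)%E \is a fin_num.
  exact: integrable_fin_num.
apply: fine_cvg; rewrite fineK//; exact: uv'.
Qed.

End ComplexIntegral.

Section Calculus.
Context {R : realType}.
Local Notation mu := (@lebesgue_measure R).

Lemma cderiv_cvg (f : R -> R[i]) (s : R) d : cderiv f s d -> f x @[x --> s] --> f s.
Proof.
move=> [f1 f2]; apply/complex_cvgE.
have c1 := derive_continuous f1; have c2 := derive_continuous f2.
apply: (@squeeze_cvgr _ _ _ _ (cst 0)
  (fun x => `|Re (f x) - Re (f s)| + `|Im (f x) - Im (f s)|)).
- by apply: nearW => x; rewrite cmod_ge0 /= -ReB -ImB cmod_le_ReIm.
- exact: cvg_cst.
- have part (h : R -> R) : {for s, continuous h} ->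
      `|h x - h s| @[x --> s] --> (0 : R).
    move=> ch; have := cvg_norm (cvgB ch (cvg_cst (h s))).
    by rewrite subrr normr0; exact.
  have := cvgD (part _ c1) (part _ c2).
  by rewrite addr0; exact.
Qed.

Lemma cintegral_FTC (F f f' : R -> R[i]) (a b : R) : a < b ->
  (forall s, cderiv F s (f s)) -> (forall s, cderiv f s (f' s)) ->
  cintegral `[a, b] f = F b - F a.
Proof.
move=> ab Ff ff'.
have part (G g g' : R -> R) : (forall s : R, is_derive s 1 G (g s)) ->
    (forall s : R, is_derive s 1 g (g' s)) ->
    (\int[mu]_(x in `[a, b]) g x)%R = G b - G a.
  move=> Gg gg'.
  rewrite /Rintegral (@continuous_FTC2 _ g G a b ab)//.
  - apply: continuous_in_subspaceT => x _; exact: derive_continuous (gg' x).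
  - split=> [x _||]; first by have := Gg x => -[].
    + by apply: cvg_at_right_filter; exact: derive_continuous (Gg a).
    + by apply: cvg_at_left_filter; exact: derive_continuous (Gg b).
  - move=> x _; rewrite derive1E; have Gx := Gg x; exact: derive_val.
apply: complex_ext => /=.
- rewrite ReB; apply: (part (fun s => Re (F s)) _ (fun s => Re (f' s))) => s;
    by have [] := Ff s; have [] := ff' s.
- rewrite ImB; apply: (part (fun s => Im (F s)) _ (fun s => Im (f' s))) => s;
    by have [] := Ff s; have [] := ff' s.
Qed.

Lemma cintegrable_bounded (a b M : R) (f : R -> R[i]) :
  cmeasurable (`[a, b]%classic : set (measurableTypeR R)) f ->
  (forall t, cmod (f t) <= M) ->
  cintegrable (`[a, b]%classic : set (measurableTypeR R)) f.
Proof.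
move=> mf fM; apply: (@cintegrable_dominated _ _ _ (cst M)) => //.
apply: measurable_bounded_integrable => //.
- have := lebesgue_measure_itv (Interval (BLeft a) (BRight b)); rewrite /= => ->.
  by case: ifP; rewrite -?EFinB ltry.
- by exists `|M|; split; [exact: num_real|move=> x Mx t _ /=; exact: ltW].
Qed.

End Calculus.

Lemma le_lim0 (R : realType) (x : R) (u : nat -> R) :
  (forall n, x <= u n) -> u n @[n --> \oo] --> 0 -> x <= 0.
Proof.
move=> xu u0; rewrite -(cvg_lim (@Rhausdorff R) u0); apply: limr_ge.
  by apply/cvg_ex; exists 0.
exact: nearW.
Qed.

(** * The Schwarz integral on the circle *)

Section Circle.
Context {R : realType}.

Definition circle (t : R) : R[i] := cexp (0 +i* t).

Lemma cmod_circle t : cmod (circle t) = 1.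
Proof. by rewrite cmod_cexp /= expR0. Qed.

Lemma circle_neq0 t : circle t != 0.
Proof. exact: cexp_neq0. Qed.

Lemma circle_conj t : circle t * (circle t)^* = 1.
Proof. by rewrite mul_conj cmod_circle expr1n. Qed.

Lemma cderiv_circle t : cderiv circle t ('i%C * circle t).
Proof.
by apply: cderiv_cexp; split => /=; [exact: is_derive_cst|exact: is_derive_id].
Qed.

Lemma cderiv_circle_conj t :
  cderiv (fun s => (circle s)^*) t (- 'i%C * (circle t)^*).
Proof.
have [c1 c2] := cderiv_circle t; split.
- under eq_fun do rewrite Re_conj.
  by apply: (is_derive_fun_eq c1); rewrite !ReIm /=; ring.
- under eq_fun do rewrite Im_conj.
  have := is_derive_fun_sub (is_derive_cst (0 : R) t 1) c2.
  under eq_fun do rewrite sub0r.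
  by move=> h; apply: (is_derive_fun_eq h); rewrite !ReIm /=; ring.
Qed.

End Circle.

Section SchwarzKernel.
Context {R : realType}.
Implicit Types (z : R[i]) (f g : R -> R[i]).

Local Notation I := (`[0, 2 * pi]%classic : set (measurableTypeR R)).

Definition circle_mean f : R[i] :=
  ((2 * pi)^-1 : R)%:C * cintegral (`[0, 2 * pi]%classic : set R) f.

Let mI : measurable I. Proof. exact: measurable_itv. Qed.

Let pi2_gt0 : 0 < 2 * pi :> R. Proof. by rewrite mulr_gt0// pi_gt0. Qed.

Definition circle_bounded f :=
  cmeasurable I f /\ exists M : R, forall t, cmod (f t) <= M.

Lemma circle_bounded_integrable f : circle_bounded f -> cintegrable I f.
Proof. by move=> [mf [M fM]]; exact: cintegrable_bounded mf fM. Qed.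

Lemma circle_boundedD f g : circle_bounded f -> circle_bounded g ->
  circle_bounded (fun t => f t + g t).
Proof.
move=> [mf [M fM]] [mg [N gN]]; split; first exact: cmeasurableD.
by exists (M + N) => t; rewrite (le_trans (cmodD _ _))// lerD.
Qed.

Lemma circle_boundedM f g : circle_bounded f -> circle_bounded g ->
  circle_bounded (fun t => f t * g t).
Proof.
move=> [mf [M fM]] [mg [N gN]]; split; first exact: cmeasurableM.
by exists (M * N) => t; rewrite cmodM ler_pM ?cmod_ge0.
Qed.

Lemma circle_bounded_cst c : circle_bounded (fun=> c).
Proof. by split; [exact: cmeasurable_cst|exists (cmod c)]. Qed.

Lemma circle_boundedZ c f : circle_bounded f -> circle_bounded (fun t => c * f t).
Proof. by apply: circle_boundedM; exact: circle_bounded_cst. Qed.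

Lemma circle_boundedX f n : circle_bounded f -> circle_bounded (fun t => f t ^+ n).
Proof.
move=> bf; elim: n => [|n ih]; first exact: circle_bounded_cst.
by under eq_fun do rewrite exprS; exact: circle_boundedM.
Qed.

Lemma circle_bounded_circle : circle_bounded (@circle R).
Proof.
split; first by apply: (cderiv_measurable mI) => s; exact: cderiv_circle.
by exists 1 => t; rewrite cmod_circle.
Qed.

Lemma circle_bounded_conj f : circle_bounded f -> circle_bounded (fun t => (f t)^*).
Proof.
move=> [mf [M fM]]; split; first exact: cmeasurable_conj.
by exists M => t; rewrite cmod_conj.
Qed.

Lemma circle_bounded_sum n (F : nat -> R -> R[i]) :
  (forall i, circle_bounded (F i)) -> circle_bounded (fun t => \sum_(i < n) F i t).
Proof.
move=> bF; elim: n => [|n ih].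
  by under eq_fun do rewrite big_ord0; exact: circle_bounded_cst.
by under eq_fun do rewrite big_ord_recr; exact: circle_boundedD.
Qed.

Lemma circle_meanD f g : circle_bounded f -> circle_bounded g ->
  circle_mean (fun t => f t + g t) = circle_mean f + circle_mean g.
Proof.
move=> /circle_bounded_integrable fi /circle_bounded_integrable gi.
by rewrite /circle_mean (cintegralD mI fi gi) mulrDr.
Qed.

Lemma circle_meanZ c f : circle_bounded f ->
  circle_mean (fun t => c * f t) = c * circle_mean f.
Proof.
move=> /circle_bounded_integrable fi.
by rewrite /circle_mean (cintegralZ _ mI fi) mulrCA.
Qed.

Lemma circle_mean_sum n (F : nat -> R -> R[i]) :
  (forall i, circle_bounded (F i)) ->
  circle_mean (fun t => \sum_(i < n) F i t) = \sum_(i < n) circle_mean (F i).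
Proof.
move=> bF; rewrite /circle_mean (cintegral_sum _ mI) ?mulr_sumr// => i.
exact: circle_bounded_integrable.
Qed.

Lemma eq_circle_mean f g : (forall t, f t = g t) -> circle_mean f = circle_mean g.
Proof. by move=> fg; congr (_ * _); exact: eq_cintegral. Qed.

Lemma cmod_circle_mean f M : cmeasurable I f -> (forall t, cmod (f t) <= M) ->
  cmod (circle_mean f) <= 2 * M.
Proof.
move=> mf fM; rewrite cmodM cmod_ge0_real; last by rewrite invr_ge0 ltW.
rewrite ler_pdivrMl//.
have iM : (@lebesgue_measure R).-integrable I (EFin \o cst M).
  have /circle_bounded_integrable[//] := circle_bounded_cst M%:C.
apply: (le_trans (cmod_cintegral mI mf iM (fun t _ => fM t))).
have -> : (\int[lebesgue_measure]_(t in I) (cst M : R -> R) t)%R = M * (2 * pi).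
  rewrite Rintegral_cst//; congr (_ * _).
  have := lebesgue_measure_itv (Interval (BLeft (0 : R)) (BRight (2 * pi))).
  by rewrite /= => ->; rewrite lte_fin pi2_gt0 -EFinB subr0.
by rewrite le_eqVlt; apply/orP; left; apply/eqP; ring.
Qed.

Lemma circle_mean1 : circle_mean (fun=> 1) = 1.
Proof.
have h s : cderiv (fun t => t%:C) s (1 : R[i]) by exact: cderiv_real.
rewrite /circle_mean (cintegral_FTC pi2_gt0 h (fun s => cderiv_cst 1 s)).
by rewrite subr0 -rmorphM /= mulVf// gt_eqF.
Qed.

Lemma circle2pi : circle (2 * pi) = 1 :> R[i].
Proof.
rewrite /circle /cexp /= expR0 mul1r mulr_natl cos2pi sin2pi.
by apply: complex_ext; rewrite /=.
Qed.

Lemma circle0 : circle 0 = 1 :> R[i].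
Proof. by rewrite /circle (_ : 0 +i* 0 = 0) ?cexp0. Qed.

Lemma imaginary_neq0 : 'i%C != 0 :> R[i].
Proof. by apply/eqP => -[] /eqP; rewrite oner_eq0. Qed.

(** Such a function is the derivative of the periodic function [c^-1 * f]. *)
Lemma circle_mean_eigen f (c : R[i]) : (forall t, cderiv f t (c * f t)) ->
  c != 0 -> f 0 = f (2 * pi) -> circle_mean f = 0.
Proof.
move=> fc c0 fp.
have h s : cderiv (fun t => c^-1 * f t) s (f s).
  by apply: cderiv_eq (cderivZ _ (fc s)) _; rewrite mulKf.
rewrite /circle_mean (cintegral_FTC pi2_gt0 h fc).
by rewrite fp subrr mulr0.
Qed.

Lemma circle_mean_exp k : circle_mean (fun t => circle t ^+ k.+1) = 0.
Proof.
apply: (@circle_mean_eigen _ (k.+1%:R * 'i%C)).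
- move=> t; apply: cderiv_eq (cderivX k.+1 (cderiv_circle t)) _.
  by rewrite /= exprS; ring.
- by rewrite mulf_neq0 ?imaginary_neq0// pnatr_eq0.
- by rewrite circle0 circle2pi.
Qed.

Lemma circle_mean_conj_exp k : circle_mean (fun t => (circle t)^* ^+ k.+1) = 0.
Proof.
apply: (@circle_mean_eigen _ (k.+1%:R * - 'i%C)).
- move=> t; apply: cderiv_eq (cderivX k.+1 (cderiv_circle_conj t)) _.
  by rewrite /= exprS; ring.
- by rewrite mulf_neq0 ?oppr_eq0 ?imaginary_neq0// pnatr_eq0.
- by rewrite circle0 circle2pi.
Qed.

Section Kernel.
Variable z : R[i].
Hypothesis z1 : cmod z < 1.

(** On the circle this is the Cauchy kernel [e / (e - z)], with [e] the point of
    the circle; written with a conjugate it shows its geometric series in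
    [z * e^*]. *)
Definition cauchy_kernel (t : R) : R[i] := (1 - z * (circle t)^*)^-1.

Lemma cauchy_denominator t : 1 - cmod z <= cmod (1 - z * (circle t)^*).
Proof.
have := cmodD (1 - z * (circle t)^*) (z * (circle t)^*).
by rewrite subrK cmod1 cmodM cmod_conj cmod_circle mulr1; lra.
Qed.

Lemma cauchy_denominator_neq0 t : 1 - z * (circle t)^* != 0.
Proof.
by rewrite -cmod_gt0 (lt_le_trans _ (cauchy_denominator t))// subr_gt0.
Qed.

(** One step of the geometric series. Iterating this identity under the integral
    replaces summing the series. *)
Lemma cauchy_kernel_step t : cauchy_kernel t = 1 + z * ((circle t)^* * cauchy_kernel t).
Proof.
rewrite /cauchy_kernel; have := cauchy_denominator_neq0 t.
set d := (circle t)^* => d0; field.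
exact: d0.
Qed.

Lemma circle_bounded_cauchy : circle_bounded cauchy_kernel.
Proof.
split.
  apply: cmeasurable_inv mI _.
  have [mc _] := circle_bounded_conj circle_bounded_circle.
  have := cmeasurableD (cmeasurable_cst I 1) (cmeasurableZ (- z) mc).
  by congr cmeasurable; apply/funext => t; rewrite mulNr.
exists (1 - cmod z)^-1 => t; rewrite cmodV lef_pV2 ?posrE ?subr_gt0//.
  exact: cauchy_denominator.
by rewrite (lt_le_trans _ (cauchy_denominator t))// subr_gt0.
Qed.

Let bP := circle_bounded_cauchy.
Let be := circle_bounded_circle.
Let bc := circle_bounded_conj be.

(** The functional equation of the kernel expresses the coefficient as
    [z ^ m] times a later one, for every [m], and all of them are bounded. *)
Lemma circle_mean_cauchy_conj_exp k :
  circle_mean (fun t => cauchy_kernel t * (circle t)^* ^+ k.+1) = 0.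
Proof.
pose b k := circle_mean (fun t => cauchy_kernel t * (circle t)^* ^+ k).
have step j : b j.+1 = z * b j.+2.
  rewrite /b -circle_meanZ; last by apply: circle_boundedM bP _; exact: circle_boundedX.
  rewrite -[RHS]add0r -(circle_mean_conj_exp j) -circle_meanD.
  - apply: eq_circle_mean => t; cbn beta.
    rewrite {1}cauchy_kernel_step [_ ^+ j.+2]exprS.
    by move: (circle t)^* (cauchy_kernel t) => c P; ring.
  - exact: circle_boundedX.
  - by apply: circle_boundedZ; apply: circle_boundedM bP _; exact: circle_boundedX.
have iter m : b k.+1 = z ^+ m * b (k.+1 + m)%N.
  elim: m => [|m ->]; first by rewrite expr0 mul1r addn0.
  by rewrite addnS exprSr addSn step mulrA.
have bM : exists M, forall j, cmod (b j) <= M.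
  have [_ [M PM]] := bP; exists (2 * M) => j; apply: cmod_circle_mean.
    by case: (circle_boundedM bP (circle_boundedX j bc)).
  by move=> t; rewrite cmodM cmodX cmod_conj cmod_circle expr1n mulr1.
have [M {}bM] := bM.
have z1' : `|cmod z| < 1 by rewrite ger0_norm ?cmod_ge0.
have lim0 := cvg_geometric M z1'.
apply/eqP; rewrite -cmod_eq0 eq_le cmod_ge0 andbT.
apply: le_lim0 lim0 => m; rewrite -/(b k.+1) (iter m) cmodM cmodX /= mulrC.
by apply: ler_wpM2r; [rewrite exprn_ge0// cmod_ge0|exact: bM].
Qed.

Lemma circle_mean_cauchy : circle_mean cauchy_kernel = 1.
Proof.
have h t : cauchy_kernel t = 1 + z * (cauchy_kernel t * (circle t)^* ^+ 1).
  by rewrite {1}cauchy_kernel_step expr1; ring.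
rewrite (eq_circle_mean h) circle_meanD ?circle_meanZ.
- by rewrite circle_mean_cauchy_conj_exp mulr0 addr0 circle_mean1.
- exact: circle_boundedM bP (circle_boundedX 1 bc).
- exact: circle_bounded_cst.
- by apply: circle_boundedZ; exact: circle_boundedM bP (circle_boundedX 1 bc).
Qed.

Lemma circle_mean_cauchy_exp k :
  circle_mean (fun t => cauchy_kernel t * circle t ^+ k) = z ^+ k.
Proof.
elim: k => [|k ih].
  by under eq_circle_mean do rewrite expr0 mulr1; rewrite circle_mean_cauchy.
have h t : cauchy_kernel t * circle t ^+ k.+1 =
    circle t ^+ k.+1 + z * (cauchy_kernel t * circle t ^+ k).
  rewrite {1}cauchy_kernel_step exprS -[in RHS](mul1r (cauchy_kernel t)).
  by rewrite -[in RHS](circle_conj t); ring.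
rewrite (eq_circle_mean h) circle_meanD ?circle_meanZ ?ih ?circle_mean_exp.
- by rewrite add0r exprS.
- exact: circle_boundedM bP (circle_boundedX k be).
- exact: circle_boundedX be.
- by apply: circle_boundedZ; exact: circle_boundedM bP (circle_boundedX k be).
Qed.

Definition schwarz_kernel t := (circle t + z) / (circle t - z).

Lemma schwarz_kernelE t : schwarz_kernel t = 2 * cauchy_kernel t - 1.
Proof.
rewrite /schwarz_kernel /cauchy_kernel.
have e0 := circle_neq0 t; have d0 := cauchy_denominator_neq0 t.
have E : circle t - z = circle t * (1 - z * (circle t)^*).
  by rewrite mulrBr mulr1 mulrCA circle_conj mulr1.
have -> : circle t + z = 2 * circle t - circle t * (1 - z * (circle t)^*).
  by rewrite -E; ring.
rewrite E; move: (circle t) (1 - _) e0 d0 => e d e0 d0.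
by field; rewrite d0 e0.
Qed.

Lemma circle_bounded_schwarz : circle_bounded schwarz_kernel.
Proof.
have -> : schwarz_kernel = (fun t => 2 * cauchy_kernel t - 1).
  by apply/funext => t; exact: schwarz_kernelE.
by apply: circle_boundedD; [exact: circle_boundedZ|exact: circle_bounded_cst].
Qed.

Lemma circle_mean_schwarzM f : circle_bounded f ->
  circle_mean (fun t => schwarz_kernel t * f t) =
  2 * circle_mean (fun t => cauchy_kernel t * f t) - circle_mean f.
Proof.
move=> bf; rewrite -circle_meanZ; last exact: circle_boundedM.
rewrite -mulN1r -circle_meanZ// -circle_meanD.
- by apply: eq_circle_mean => t; rewrite schwarz_kernelE; ring.
- by apply: circle_boundedZ; exact: circle_boundedM.
- exact: circle_boundedZ.
Qed.

Lemma circle_mean_schwarz : circle_mean schwarz_kernel = 1.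
Proof.
have := circle_mean_schwarzM (circle_bounded_cst 1).
under eq_circle_mean do rewrite mulr1; move=> ->.
under eq_circle_mean do rewrite mulr1.
by rewrite circle_mean_cauchy circle_mean1; ring.
Qed.

(** The Schwarz formula for a monomial: the real part splits into the power and
    its conjugate, and the kernel reproduces the first and annihilates the
    second. *)
Lemma circle_mean_schwarz_exp (c : R[i]) k :
  circle_mean (fun t => schwarz_kernel t * (Re (c * circle t ^+ k.+1))%:C) =
  c * z ^+ k.+1.
Proof.
have h t : schwarz_kernel t * (Re (c * circle t ^+ k.+1))%:C =
    c / 2 * (schwarz_kernel t * circle t ^+ k.+1) +
    c^* / 2 * (schwarz_kernel t * (circle t)^* ^+ k.+1).
  by rewrite ReJ_add rmorphM rmorphXn /=; field.
have b1 := circle_boundedX k.+1 be; have b2 := circle_boundedX k.+1 bc.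
have b3 := circle_boundedM circle_bounded_schwarz b1.
have b4 := circle_boundedM circle_bounded_schwarz b2.
rewrite (eq_circle_mean h) circle_meanD; try exact: circle_boundedZ.
rewrite !circle_meanZ// !circle_mean_schwarzM// circle_mean_cauchy_conj_exp.
rewrite circle_mean_cauchy_exp circle_mean_exp circle_mean_conj_exp.
by field.
Qed.

End Kernel.

End SchwarzKernel.

(** * The logarithm of 1 - z *)

Section LogSeries.
Context {R : realType}.
Implicit Types (z : R[i]).

(** The Taylor polynomial of [- log (1 - z)]. *)
Definition log_series (n : nat) (z : R[i]) : R[i] :=
  \sum_(k < n) k.+1%:R^-1 * z ^+ k.+1.

Lemma geometric_sum_le (rho : R) n : 0 <= rho -> rho < 1 ->
  \sum_(k < n) rho ^+ k <= (1 - rho)^-1.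
Proof.
move=> r0 r1; rewrite -[leRHS]mul1r ler_pdivlMr ?subr_gt0//.
rewrite mulrC -opprB mulNr -subrX1 opprB gerBl.
exact: exprn_ge0.
Qed.

Lemma cmod_log_series n z (rho : R) : cmod z <= rho -> rho < 1 ->
  cmod (log_series n z) <= (1 - rho)^-1.
Proof.
move=> zr r1; have r0 : 0 <= rho by exact: le_trans (cmod_ge0 z) zr.
rewrite (le_trans (cmod_sum _ _ _))//.
apply: (le_trans _ (geometric_sum_le n r0 r1)).
apply: ler_sum => k _; rewrite cmodM cmodV cmod_nat cmodX.
rewrite (@le_trans _ _ (cmod z ^+ k.+1))//.
  by rewrite ler_piMl ?exprn_ge0 ?cmod_ge0// invf_le1// ler1n.
rewrite exprS (@le_trans _ _ (cmod z ^+ k))//.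
  by rewrite ler_piMl ?exprn_ge0 ?cmod_ge0// (le_trans zr)// ltW.
by rewrite lerXn2r// ?nnegrE ?cmod_ge0.
Qed.

(** Along the segment from 0 to [z] the function [(1 - x) * exp (log_series n x)]
    starts at 1, and its derivative reduces to the first omitted power because
    [(1 - x)] times the sum of the first [n] powers is [1 - x ^ n]. This avoids
    complex logarithms. *)
Lemma cmod_one_sub_mul_exp_log n z (rho : R) : cmod z <= rho -> rho < 1 ->
  cmod ((1 - z) * cexp (log_series n z) - 1) <=
  2 * expR (1 - rho)^-1 * rho ^+ n.
Proof.
move=> zr r1; have r0 : 0 <= rho by exact: le_trans (cmod_ge0 z) zr.
have dlin s : cderiv (fun t => t%:C * z) s z.
  by apply: cderiv_eq (cderivM (cderiv_real s) (cderiv_cst z s)) _; cbn beta; ring.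
have dlog s : cderiv (fun t => log_series n (t%:C * z)) s
    (\sum_(k < n) z * (s%:C * z) ^+ k).
  apply: (cderiv_sum (F := fun k t => k.+1%:R^-1 * (t%:C * z) ^+ k.+1)
    (d := fun k => z * (s%:C * z) ^+ k)) => k _.
  apply: cderiv_eq (cderivZ _ (cderivX k.+1 (dlin s))) _.
  by rewrite /= !mulrA mulVf ?mul1r// pnatr_eq0.
have h s : 0 <= s <= 1 -> cderiv
    (fun t => (1 - t%:C * z) * cexp (log_series n (t%:C * z))) s
    (- (z * (s%:C * z) ^+ n) * cexp (log_series n (s%:C * z))).
  move=> _; have d1 := cderivD (cderiv_cst 1 s) (cderivZ (-1) (dlin s)).
  have d2 := cderivM d1 (cderiv_cexp (dlog s)).
  have -> : (fun t => (1 - t%:C * z) * cexp (log_series n (t%:C * z))) =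
     (fun t => (1 + -1 * (t%:C * z)) * cexp (log_series n (t%:C * z))).
    by apply/funext => t; rewrite mulN1r.
  apply: (cderiv_eq d2); rewrite -mulr_sumr.
  have g := subrX1 (s%:C * z) n.
  set x := s%:C * z in g *; set S := \sum_(i < n) x ^+ i in g *.
  have -> : x ^+ n = 1 + (x - 1) * S by rewrite -g addrC subrK.
  by ring.
have M s : 0 <= s <= 1 ->
    cmod (- (z * (s%:C * z) ^+ n) * cexp (log_series n (s%:C * z))) <=
    expR (1 - rho)^-1 * rho ^+ n.
  move=> /andP[s0 s1].
  have szr : cmod (s%:C * z) <= rho.
    by rewrite cmodM cmod_ge0_real// (le_trans _ zr)// ler_piMl ?cmod_ge0.
  rewrite cmodM cmodN cmodM cmodX cmod_cexp mulrC.
  apply: ler_pM; rewrite ?expR_ge0 ?mulr_ge0 ?exprn_ge0 ?cmod_ge0//.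
    rewrite ler_expR (le_trans (ler_norm _))// (le_trans (Re_le_cmod _))//.
    exact: cmod_log_series.
  rewrite (@le_trans _ _ (cmod (s%:C * z) ^+ n))//.
    by rewrite ler_piMl ?exprn_ge0 ?cmod_ge0// (le_trans zr)// ltW.
  by rewrite lerXn2r// ?nnegrE ?cmod_ge0.
have := cmod_mean_value ler01 h M.
rewrite !mul1r !mul0r !subr0.
have -> : log_series n 0 = 0.
  by apply: big1 => k _; rewrite expr0n mulr0.
by rewrite cexp0 !mulr1 mulrA.
Qed.

Lemma ln_near1 (x eta : R) : `|x - 1| <= eta -> eta <= 1 / 2 -> `|ln x| <= 2 * eta.
Proof.
move=> xe e2; have x0 : 1 / 2 <= x by move: xe; rewrite ler_norml; lra.
have xp : 0 < x by lra.
have up (y : R) : 0 < y -> ln y <= y - 1.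
  by move=> y0; have := @le_ln1Dx _ (y - 1); rewrite addrCA subrr addr0; apply; lra.
rewrite ler_norml; apply/andP; split.
  have := up x^-1; rewrite invr_gt0 lnV ?posrE// => /(_ xp) h.
  have : x^-1 - 1 <= 2 * eta; last by lra.
  rewrite -(ler_pM2r xp) mulrBl mulVf ?gt_eqF//.
  move: xe; rewrite ler_norml => /andP[h1 h2]; nra.
have := up x xp; move: xe; rewrite ler_norml; lra.
Qed.

Lemma ln_cmod_one_sub n z (rho : R) : cmod z <= rho -> rho < 1 ->
  2 * expR (1 - rho)^-1 * rho ^+ n <= 1 / 2 ->
  `|ln (cmod (1 - z)) + Re (log_series n z)| <=
  2 * (2 * expR (1 - rho)^-1 * rho ^+ n).
Proof.
move=> zr r1 small; have h := cmod_one_sub_mul_exp_log n zr r1.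
have d0 : 0 < cmod (1 - z).
  have := cmodD (1 - z) z; rewrite subrK cmod1; lra.
have -> : ln (cmod (1 - z)) + Re (log_series n z) =
    ln (cmod ((1 - z) * cexp (log_series n z))).
  by rewrite cmodM cmod_cexp lnM ?posrE ?expR_gt0// expRK.
apply: ln_near1 small; apply: le_trans h.
set w := _ * cexp _; rewrite ler_norml; apply/andP; split.
  by have := cmodD (w - 1) (- w); rewrite cmodN -(cmodN (w - 1 - w)) addrAC subrr
    sub0r opprK cmod1; lra.
by have := cmodD (w - 1) 1; rewrite subrK cmod1; lra.
Qed.

End LogSeries.

(** * Powers of linear polynomials are outer *)

Section OuterPowers.
Context {R : realType}.
Implicit Types (z a c : R[i]) (F : R[i] -> R[i]).
Local Notation I := (`[0, 2 * pi]%classic : set (measurableTypeR R)).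

Lemma geometric_small (K rho : R) : 0 <= rho -> rho < 1 ->
  exists N, K * rho ^+ N <= 1 / 2.
Proof.
move=> r0 r1; have r1' : `|rho| < 1 by rewrite ger0_norm.
have /cvgr_lt /(_ (1 / 2)) := cvg_geometric K r1'.
have h : (0 : R) < 1 / 2 by rewrite divr_gt0.
by move=> /(_ h) [N _ /(_ N)] /= hN; exists N; apply: ltW; apply: hN => /=.
Qed.

Section Fixed.
Variables a : R[i].
Hypothesis a1 : cmod a < 1.

Local Notation lna := (fun t : R => (ln (cmod (1 - a * circle t)))%:C : R[i]).

Lemma cmod_mul_circle t : cmod (a * circle t) <= cmod a.
Proof. by rewrite cmodM cmod_circle mulr1. Qed.

Lemma circle_bounded_log_series n : circle_bounded (fun t => log_series n (a * circle t)).
Proof.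
apply: (@circle_bounded_sum R n (fun k t => k.+1%:R^-1 * (a * circle t) ^+ k.+1)) => k.
apply: circle_boundedZ; apply: circle_boundedX; apply: circle_boundedZ.
exact: circle_bounded_circle.
Qed.

Lemma circle_bounded_Re (f : R -> R[i]) : circle_bounded f ->
  circle_bounded (fun t => (Re (f t))%:C).
Proof.
move=> [[mf _] [M fM]]; split; first exact: cmeasurable_real.
by exists M => t; rewrite cmod_real (le_trans (Re_le_cmod _)).
Qed.

Lemma circle_bounded_ln : circle_bounded lna.
Proof.
split.
  apply: cmeasurable_real; apply: (measurableT_comp (@measurable_ln R)).
  apply: cmod_measurable; have [me _] := @circle_bounded_circle R.
  have := cmeasurableD (cmeasurable_cst I 1) (cmeasurableZ (- a) me).
  by congr cmeasurable; apply/funext => t; rewrite mulNr.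
have [N hN] := geometric_small (2 * expR (1 - cmod a)^-1) (cmod_ge0 a) a1.
exists ((1 - cmod a)^-1 + 1) => t.
have h := ln_cmod_one_sub (cmod_mul_circle t) a1 hN.
have h' := le_trans (Re_le_cmod _) (cmod_log_series N (cmod_mul_circle t) a1).
rewrite cmod_real -[ln _](addrK (Re (log_series N (a * circle t)))).
rewrite (le_trans (ler_normB _ _))// addrC lerD// (le_trans h)//.
by move: hN; lra.
Qed.

Lemma circle_mean_schwarz_log_series z n : cmod z < 1 ->
  circle_mean (fun t => schwarz_kernel z t * (Re (log_series n (a * circle t)))%:C)
  = log_series n (a * z).
Proof.
move=> z1.
have h t : schwarz_kernel z t * (Re (log_series n (a * circle t)))%:C =
  \sum_(k < n) schwarz_kernel z t *
    (Re (k.+1%:R^-1 * a ^+ k.+1 * circle t ^+ k.+1))%:C.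
  rewrite Re_sum rmorph_sum mulr_sumr; apply: eq_bigr => k _.
  by rewrite exprMn mulrA.
rewrite (eq_circle_mean h) (@circle_mean_sum R n (fun k t =>
   schwarz_kernel z t * (Re (k.+1%:R^-1 * a ^+ k.+1 * circle t ^+ k.+1))%:C)).
  by apply: eq_bigr => k _; rewrite circle_mean_schwarz_exp// exprMn mulrA.
move=> k; apply: circle_boundedM; first exact: circle_bounded_schwarz.
apply: circle_bounded_Re; apply: circle_boundedZ; apply: circle_boundedX.
exact: circle_bounded_circle.
Qed.

(** Replacing the logarithm by its Taylor polynomials, whose Schwarz integrals are
    known exactly, makes an error that is geometrically small uniformly on the
    circle. So [(1 - a * z) * cexp (- J)], with [J] the Schwarz integral, is
    within a geometrically small distance of 1. *)
Lemma cexp_schwarz_ln z : cmod z < 1 ->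
  cexp (circle_mean (fun t => schwarz_kernel z t * lna t)) = 1 - a * z.
Proof.
move=> z1; set J := circle_mean _; set K := 2 * expR (1 - cmod a)^-1.
have K0 : 0 <= K by rewrite mulr_ge0 ?expR_ge0.
have bS := circle_bounded_schwarz z1.
have [_ [M SM]] := bS.
have M0 : 0 <= M by exact: le_trans (cmod_ge0 _) (SM 0).
have [N hN] := geometric_small K (cmod_ge0 a) a1.
(* The index is shifted by [N] so that the error is at most 1/2, as needed to take
   logarithms. *)
pose e n := K * cmod a ^+ (N + n)%N.
have e0 n : 0 <= e n by rewrite mulr_ge0 ?exprn_ge0 ?cmod_ge0.
have e1 n : e n <= 1 / 2.
  rewrite (le_trans _ hN)// ler_wpM2l// exprD ler_piMr ?exprn_ge0 ?cmod_ge0//.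
  by rewrite exprn_ile1 ?cmod_ge0// ltW.
have dJ n : cmod (J + log_series (N + n) (a * z)) <= 4 * M * e n.
  rewrite -circle_mean_schwarz_log_series// -circle_meanD.
  - have -> : 4 * M * e n = 2 * (M * (2 * e n)) by ring.
    apply: cmod_circle_mean.
      apply: cmeasurableD.
        by case: (circle_boundedM bS circle_bounded_ln).
      by case: (circle_boundedM bS (circle_bounded_Re (circle_bounded_log_series (N + n)))).
    move=> t; rewrite -mulrDr cmodM ler_pM ?cmod_ge0//.
    by rewrite -rmorphD cmod_real ln_cmod_one_sub ?cmod_mul_circle// e1.
  - exact: circle_boundedM bS circle_bounded_ln.
  - exact: circle_boundedM bS (circle_bounded_Re (circle_bounded_log_series (N + n))).
have az : cmod (a * z) <= cmod a.
  by rewrite cmodM ler_piMr ?cmod_ge0// ltW.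
pose w := (1 - a * z) * cexp (- J).
suff w1 : w = 1.
  have -> : cexp J = w * cexp J by rewrite w1 mul1r.
  by rewrite /w -mulrA -cexpD addNr cexp0 mulr1.
pose C := 1 + cmod w * (2 * (4 * M * expR (4 * M))).
have C0 : 0 <= C by rewrite addr_ge0// !mulr_ge0 ?cmod_ge0 ?expR_ge0.
have bound n : cmod (w - 1) <= (C * (K * cmod a ^+ N)) * cmod a ^+ n.
  have -> : (C * (K * cmod a ^+ N)) * cmod a ^+ n = C * e n.
    by rewrite /e exprD; ring.
  set d := J + log_series (N + n) (a * z).
  have E : w * cexp d = (1 - a * z) * cexp (log_series (N + n) (a * z)).
    by rewrite /w /d -mulrA -cexpD addrA addNr add0r.
  have -> : w - 1 = (w * cexp d - 1) - w * (cexp d - 1) by ring.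
  rewrite (le_trans (cmodB _ _))// /C mulrDl mul1r; apply: lerD.
    by rewrite E cmod_one_sub_mul_exp_log.
  rewrite cmodM -!mulrA ler_wpM2l ?cmod_ge0//.
  rewrite (le_trans (cmod_cexp_sub1 d))// ler_wpM2l//.
  have -> : 4 * (M * (expR (4 * M) * e n)) = (4 * M * e n) * expR (4 * M) by ring.
  rewrite ler_pM ?cmod_ge0 ?expR_ge0 ?dJ// ler_expR (le_trans (dJ n))//.
  by rewrite ler_piMr ?mulr_ge0// (le_trans (e1 n))//; lra.
apply/eqP; rewrite -subr_eq0 -cmod_eq0 eq_le cmod_ge0 andbT.
have a1' : `|cmod a| < 1 by rewrite ger0_norm ?cmod_ge0.
have lim0 := cvg_geometric (C * (K * cmod a ^+ N)) a1'.
exact: le_lim0 bound lim0.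
Qed.

End Fixed.

Lemma hardy_disk_polynomial F (p : {poly R[i]}) :
  (forall z, unit_disk z -> F z = p.[z]) -> hardy_disk F.
Proof.
move=> Fp; exists (fun n => p`_n); split.
  apply: (@cvgP _ _ (series (fun n => cmod p`_n ^+ 2) (size p))).
  apply: cvg_near_cst; exists (size p) => // n /= pn.
  rewrite /series /= (big_cat_nat (n := size p))//= [X in _ + X]big_nat_cond.
  rewrite [X in _ + X]big1 ?addr0// => i /andP[/andP[pi _] _].
  by rewrite nth_default// cmod0 expr0n.
move=> z z1; rewrite Fp//; apply: cvg_near_cst; exists (size p) => // n /= pn.
by rewrite /series /= (horner_coef_wide _ pn) big_mkord.
Qed.

(** Along each radius [F] agrees with a function differentiable up to the circle,
    so the radial limit is its value at 1. *)
Lemma boundary_function_eq F (G : R -> R -> R[i]) (theta : R) :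
  (forall r, 0 <= r < 1 -> F (r%:C * circle theta) = G theta r) ->
  (exists d, cderiv (G theta) 1 d) -> boundary_function F theta = G theta 1.
Proof.
move=> FG [d Gd]; rewrite /boundary_function; apply: cvg_lim.
  exact: norm_hausdorff.
have c := cvg_at_left_filter (cderiv_cvg Gd).
apply: cvg_trans c; apply: near_eq_cvg.
near=> r; rewrite FG//; apply/andP; split; last first.
  by near: r; exact: nbhs_left_lt.
by near: r; apply: nbhs_left_ge.
Unshelve. all: by end_near. Qed.

(** The boundary function is the polynomial itself, so its logarithm is
    [ln |c| + n * ln |1 - a * e|] on the circle; the unimodular constant is
    [c / |c|]. *)
Lemma outer_power F c a n : c != 0 -> cmod a < 1 ->
  (forall z, unit_disk z -> F z = c * (1 - a * z) ^+ n) -> outer F.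
Proof.
move=> c0 a1 FE; split.
- apply: (@hardy_disk_polynomial _ (c *: (1 - a *: 'X) ^+ n)) => z z1.
  by rewrite FE// !hornerE.
- have D0 : cmod (0 : R[i]) < 1 by rewrite cmod0 ltr01.
  by exists 0; rewrite ?(FE _ D0)// mulr0 subr0 expr1n mulr1.
have bE theta : boundary_function F theta = c * (1 - a * circle theta) ^+ n.
  rewrite (@boundary_function_eq F (fun t r => c * (1 - a * (r%:C * circle t)) ^+ n)).
  - by rewrite mul1r.
  - move=> r /andP[r0 r1].
    have D1 : cmod (r%:C * circle theta) < 1.
      by rewrite cmodM cmod_circle mulr1 cmod_ge0_real.
    by rewrite (FE _ D1).
  - have d1 := cderivZ (- a) (cderivM (cderiv_real 1) (cderiv_cst (circle theta) 1)).
    have d2 := cderivZ c (cderivX n (cderivD (cderiv_cst 1 1) d1)).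
    eexists; move: d2; congr cderiv.
    by apply/funext => r; rewrite mulNr.
exists (c / (cmod c)%:C).
  rewrite cmodM cmodV cmod_ge0_real ?cmod_ge0// divff// cmod_eq0//.
move=> z z1; rewrite FE//.
have d0 t : 1 - a * circle t != 0.
  rewrite -cmod_gt0; have := cmodD (1 - a * circle t) (a * circle t).
  by rewrite subrK cmod1 cmodM cmod_circle mulr1; lra.
have E t : (circle t + z) / (circle t - z) *
    (ln (cmod (boundary_function F t)))%:C =
    (ln (cmod c))%:C * schwarz_kernel z t +
    n%:R * (schwarz_kernel z t * (ln (cmod (1 - a * circle t)))%:C).
  rewrite bE cmodM cmodX lnM ?posrE ?cmod_gt0 ?exprn_gt0 ?cmod_gt0//.
  rewrite lnXn ?cmod_gt0// rmorphD rmorphMn /= -mulr_natl /schwarz_kernel.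
  by ring.
have bS := circle_bounded_schwarz z1.
have bl := circle_boundedM bS (circle_bounded_ln a1).
rewrite -/(circle_mean _) (eq_circle_mean E) circle_meanD; try exact: circle_boundedZ.
rewrite !circle_meanZ// circle_mean_schwarz// mulr1 cexpD cexp_real.
rewrite lnK ?posrE ?cmod_gt0// mulr_natl cexpMn cexp_schwarz_ln//.
rewrite !mulrA divfK//.
by rewrite -[0]/(0%:C) (inj_eq (@complexI R)) cmod_eq0.
Qed.

End OuterPowers.

(** * Exponential integrals on the half-line *)

Section HalfLineIntegrals.
Context {R : realType}.
Local Notation mu := (@lebesgue_measure R).
Local Notation H := (@half_line R : set (measurableTypeR R)).
Implicit Types (f : R -> R[i]) (w : R[i]).

Lemma mH : measurable H. Proof. exact: measurable_half_line. Qed.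
Hint Resolve mH : core.

Lemma half_lineE (t : R) : half_line t = (0 <= t) :> Prop.
Proof. by rewrite /half_line /= in_itv /= andbT. Qed.

Lemma integrable_exp (x : R) : 0 < x ->
  mu.-integrable H (EFin \o (fun t => expR (- (x * t)))).
Proof.
move=> x0; have h := integrable_exponential_pdf x0.
have h' : mu.-integrable H (EFin \o exponential_pdf x) by exact: integrableS h.
apply: (@eq_integrable _ _ _ mu H mH (EFin \o (fun t => x^-1 * exponential_pdf x t))).
  move=> t; rewrite inE half_lineE => t0 /=.
  by rewrite exponential_pdfE// mulKf ?gt_eqF// mulNr.
exact: integrable_EFinZ.
Qed.

Lemma pow_mul_exp_le (x t : R) k : 0 < x -> 0 <= t ->
  t ^+ k * expR (- (x * t)) <= (k`!%:R * (2 / x) ^+ k) * expR (- (x / 2 * t)).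
Proof.
move=> x0 t0; have xt0 : 0 <= x / 2 * t by rewrite mulr_ge0// divr_ge0// ltW.
have -> : - (x * t) = - (x / 2 * t) - (x / 2 * t) by field.
rewrite expRD mulrA ler_wpM2r ?expR_ge0// expRN ler_pdivrMr ?expR_gt0//.
have fk : 0 < k`!%:R :> R by rewrite ltr0n fact_gt0.
have : (x / 2 * t) ^+ k / k`!%:R <= expR (x / 2 * t).
  case: k fk => [|k] fk; last by have := expR_ge1Dxn k xt0; lra.
  by rewrite expr0 fact0 divr1 (le_trans _ (expR_ge1Dx _))// lerDl.
rewrite ler_pdivrMr// => h.
have -> : t ^+ k = (2 / x) ^+ k * (x / 2 * t) ^+ k.
  by rewrite -exprMn; congr (_ ^+ _); field; rewrite gt_eqF.
set p := (2 / x) ^+ k; set q := (x / 2 * t) ^+ k in h *.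
have p0 : 0 <= p by rewrite exprn_ge0// divr_ge0// ltW.
rewrite (le_trans (ler_wpM2l p0 h))// le_eqVlt; apply/orP; left.
by apply/eqP; ring.
Qed.

Lemma integrable_pow_exp (x : R) k : 0 < x ->
  mu.-integrable H (EFin \o (fun t => t ^+ k * expR (- (x * t)))).
Proof.
move=> x0; have x20 : 0 < x / 2 by rewrite divr_gt0.
apply: (le_integrable mH _ _ (integrable_EFinZ (k`!%:R * (2 / x) ^+ k) mH (integrable_exp x20))).
- apply/measurable_EFinP; apply: measurable_funM; first exact: measurable_funX.
  apply: measurableT_comp; first exact: measurable_expR.
  by apply: measurable_funN; exact: measurable_funM.
- move=> t /=; rewrite half_lineE => t0; rewrite lee_fin.
  rewrite ger0_norm ?mulr_ge0 ?exprn_ge0 ?expR_ge0//.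
  by rewrite (le_trans (pow_mul_exp_le k x0 t0))// ler_norm.
Qed.

(** The fundamental theorem on [[0, n]], where the truncated integrals converge by
    dominated convergence with dominating function [|f|]. *)
Lemma cintegral_half_line_FTC (F f f' : R -> R[i]) :
  (forall s, cderiv F s (f s)) -> (forall s, cderiv f s (f' s)) ->
  cintegrable H f -> cmod (F n%:R) @[n --> \oo] --> 0 ->
  cintegral half_line f = - F 0.
Proof.
move=> Ff ff' [i1 i2] F0.
have part (h : R -> R) : mu.-integrable H (EFin \o h) ->
    (\int[mu]_(t in `[0%R, n%:R]) h t)%R @[n --> \oo] --> (\int[mu]_(t in H) h t)%R.
  move=> ih.
  have E n : (\int[mu]_(t in `[0%R, n%:R]) h t)%R =
      (\int[mu]_(t in H) (h \_ `[0%R, n%:R]) t)%R.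
    rewrite -Rintegral_mkcondr; congr Rintegral; apply/seteqP; split => t /=.
      move=> t0n; split => //; rewrite half_lineE.
      by move: t0n; rewrite in_itv /= => /andP[t0 _].
    by move=> [].
  under eq_fun do rewrite E.
  have /measurable_int/measurable_EFinP mh := ih.
  have ihn := integrable_norm ih.
  have [|||_ //] := @Rintegral_dominated_cvg R H (fun n => h \_ `[0%R, n%:R]) h
     (fun t => `|h t|) mH _ mh ihn.
  - move=> n; apply/(measurable_restrict _ _ _).1 => //.
    by apply: measurable_funS mh => // t [].
  - apply: aeW => t; rewrite half_lineE => t0; apply: cvg_near_cst.
    have [N tN] : exists N : nat, t <= N%:R.
      exists (Num.truncn t).+1; exact/ltW/truncnS_gt.
    exists N => // n /= Nn; rewrite patchE mem_set//=.
    by rewrite in_itv /= t0 (le_trans tN)// ler_nat.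
  - move=> n t _; rewrite patchE; case: ifP => // _.
    by rewrite normr0.
have c1 := part _ i1; have c2 := part _ i2.
have FTC n : (0 < n)%N -> cintegral `[0, n%:R] f = F n%:R - F 0.
  by move=> n0; apply: cintegral_FTC ff' => //; rewrite ltr0n.
have FR n : (0 < n)%N -> (\int[mu]_(t in `[0%R, n%:R]) Re (f t))%R = Re (F n%:R) - Re (F 0).
  by move=> n0; rewrite -ReB -FTC.
have FI n : (0 < n)%N -> (\int[mu]_(t in `[0%R, n%:R]) Im (f t))%R = Im (F n%:R) - Im (F 0).
  by move=> n0; rewrite -ImB -FTC.
have small (p : R[i] -> R) : (forall z, `|p z| <= cmod z) ->
    p (F n%:R) @[n --> \oo] --> (0 : R).
  move=> pz; apply/cvgr0Pnorm_lt => e e0; move/cvgr0Pnorm_lt : F0 => /(_ e e0).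
  by apply: filterS => n; rewrite ger0_norm ?cmod_ge0//; apply: le_lt_trans.
apply: complex_ext => /=; rewrite ?ReN ?ImN.
- apply: (cvg_unique (@Rhausdorff R) c1).
  rewrite -[- _]add0r; apply: cvg_trans (cvgB (small _ Re_le_cmod) (cvg_cst (Re (F 0)))).
  by apply: near_eq_cvg; exists 1%N => // n /= n0; rewrite FR.
- apply: (cvg_unique (@Rhausdorff R) c2).
  rewrite -[- _]add0r; apply: cvg_trans (cvgB (small _ Im_le_cmod) (cvg_cst (Im (F 0)))).
  by apply: near_eq_cvg; exists 1%N => // n /= n0; rewrite FI.
Qed.

Definition pow_exp (k : nat) w (t : R) : R[i] := t%:C ^+ k * cexp (- (w * t%:C)).

Lemma cderiv_exp w s : cderiv (fun t => cexp (- (w * t%:C))) s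
  (- w * cexp (- (w * s%:C))).
Proof.
apply: (cderiv_ext (cderiv_cexp (cderivZ (- w) (cderiv_real s)))) => [t|].
  by rewrite mulNr.
by rewrite mulr1 !mulNr.
Qed.

Lemma cderiv_pow_exp k w s : cderiv (pow_exp k w) s
  (k%:R * pow_exp k.-1 w s - w * pow_exp k w s).
Proof.
apply: cderiv_eq (cderivM (cderivX k (cderiv_real s)) (cderiv_exp w s)) _.
by rewrite /pow_exp; ring.
Qed.

Lemma cmod_pow_exp k w t : 0 <= t ->
  cmod (pow_exp k w t) = t ^+ k * expR (- (Re w * t)).
Proof.
move=> t0; rewrite cmodM cmodX cmod_ge0_real// cmod_cexp.
by congr (_ * expR _); rewrite ReN ReM /= mulr0 subr0.
Qed.

Lemma cintegrable_pow_exp k w : 0 < Re w -> cintegrable H (pow_exp k w).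
Proof.
move=> w0; apply: cintegrable_dominated (integrable_pow_exp k w0) _ => //.
  exact: cderiv_measurable (cderiv_pow_exp k w).
by move=> t; rewrite half_lineE => t0; rewrite cmod_pow_exp.
Qed.

Lemma pow_exp_cvg0 k w : 0 < Re w -> cmod (pow_exp k w n%:R) @[n --> \oo] --> 0.
Proof.
move=> w0; have x20 : 0 < Re w / 2 by rewrite divr_gt0.
have e1 : `|expR (- (Re w / 2))| < 1.
  by rewrite ger0_norm ?expR_ge0// expR_lt1 oppr_lt0.
have lim0 := cvg_geometric (k`!%:R * (2 / Re w) ^+ k) e1.
apply: (@squeeze_cvgr _ _ _ _ (cst 0) _ _ _ _ _ lim0); last exact: cvg_cst.
apply: nearW => n; rewrite cmod_ge0 /= cmod_pow_exp//.
rewrite (le_trans (pow_mul_exp_le _ _ _))//.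
by rewrite -mulNr expRM_natr.
Qed.

Lemma right_half_plane_neq0 w : 0 < Re w -> w != 0.
Proof. by apply: contraTneq => ->; rewrite ltxx. Qed.

(** Integration by parts, in the form of the integral of the derivative of
    [pow_exp k w], gives a recurrence in [k]. *)
Lemma cintegral_pow_exp k w : 0 < Re w ->
  cintegral half_line (pow_exp k w) = k`!%:R / w ^+ k.+1.
Proof.
move=> w0; have wn0 := right_half_plane_neq0 w0.
have step j : j%:R * cintegral half_line (pow_exp j.-1 w) -
    w * cintegral half_line (pow_exp j w) = - pow_exp j w 0.
  have i1 := cintegrable_pow_exp j w0; have i2 := cintegrable_pow_exp j.-1 w0.
  have i3 := cintegrableZ j%:R mH i2; have i4 := cintegrableZ w mH i1.
  rewrite -(cintegralZ _ mH i1) -(cintegralZ _ mH i2) -(cintegralB mH i3 i4).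
  apply: (cintegral_half_line_FTC (cderiv_pow_exp j w)) (cintegrableB mH i3 i4) _.
    move=> s; apply: (cderiv_ext (cderivD (cderivZ j%:R (cderiv_pow_exp j.-1 w s))
      (cderivZ (- w) (cderiv_pow_exp j w s)))) => [t|]; last by [].
    by rewrite mulNr.
  exact: pow_exp_cvg0.
elim: k => [|k ih].
  have := step 0%N; rewrite mul0r sub0r /pow_exp expr0 !mul1r mulr0 oppr0 cexp0.
  by move/oppr_inj => E; apply: (mulfI wn0); rewrite E expr1 mulrC mulVf.
have := step k.+1; rewrite /= ih /pow_exp expr0n mul0r oppr0.
move/eqP; rewrite subr_eq0 => /eqP E.
apply: (mulfI wn0); rewrite -E factS natrM [w ^+ k.+2]exprS.
by field; rewrite wn0 expf_neq0.
Qed.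

End HalfLineIntegrals.
#[export] Hint Resolve mH : core.

(** * Square-integrable functions and their classes *)

Lemma L2_normE (R : realType) (x : L2 R) : `|x| = (L2norm x)%:C.
Proof. by []. Qed.

(* Comparing two norms up to conversion would unfold the integrals. *)
#[global] Opaque L2norm.

Section SquareIntegrable.
Context {R : realType}.
Local Notation mu := (@lebesgue_measure R).
Local Notation H := (@half_line R : set (measurableTypeR R)).
Implicit Types (f g : R -> R[i]) (x : L2 R).

Lemma L2_pred_integrable f : f \in L2_pred <->
  cmeasurable H f /\ mu.-integrable H (EFin \o (fun t => cmod (f t) ^+ 2)).
Proof.
split=> [/L2_predP[mf ef]|[mf /integrableP[_ ef]]].
- split=> //; apply/integrableP; split; first exact: measurable_cmod2.
  by under eq_integral => t _ do rewrite gee0_abs ?lee_fin ?sqr_ge0//.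
- apply/L2_predP; split=> //; move: ef; rewrite /energy.
  by under eq_integral => t _ do rewrite gee0_abs ?lee_fin ?sqr_ge0//.
Qed.

Lemma L2_pred_dominated f (h : R -> R) : cmeasurable H f ->
  mu.-integrable H (EFin \o h) -> (forall t, half_line t -> cmod (f t) ^+ 2 <= h t) ->
  f \in L2_pred.
Proof.
move=> mf ih fh; apply/L2_pred_integrable; split=> //.
apply: le_integrable ih => //; first exact: measurable_cmod2.
move=> t Ht /=; rewrite lee_fin ger0_norm ?sqr_ge0// (le_trans (fh t Ht))//.
exact: ler_norm.
Qed.

Lemma L2_predD f g : f \in L2_pred -> g \in L2_pred ->
  (fun t => f t + g t) \in L2_pred.
Proof. exact: rpredD. Qed.

Lemma L2_predZ c f : f \in L2_pred -> (fun t => c * f t) \in L2_pred.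
Proof. exact: rpredZ. Qed.

Lemma L2_predB f g : f \in L2_pred -> g \in L2_pred ->
  (fun t => f t - g t) \in L2_pred.
Proof. exact: rpredB. Qed.

(** Total in [f], so that classes of explicit functions can be written without
    carrying membership proofs. *)
Definition toL2 f : L2 R :=
  if pselect (f \in L2_pred) is left Hf then \pi_(L2 R) (MkL2fun Hf) else 0.

Lemma toL2E f (Hf : f \in L2_pred) : toL2 f = \pi_(L2 R) (MkL2fun Hf).
Proof.
rewrite /toL2; case: pselect => // Hf'.
by rewrite (bool_irrelevance Hf' Hf).
Qed.

Lemma L2_pred_repr x : (repr x : R -> R[i]) \in L2_pred.
Proof. exact: L2valP. Qed.
Hint Resolve L2_pred_repr : core.

Lemma toL2_repr x : toL2 (repr x) = x.
Proof.
by rewrite (toL2E (L2_pred_repr x)) -[RHS]reprK; congr (\pi); exact: val_inj.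
Qed.

Lemma repr_toL2 f : f \in L2_pred ->
  {ae mu, forall t, half_line t -> repr (toL2 f) t = f t}.
Proof.
move=> Hf; rewrite (toL2E Hf); set F := MkL2fun Hf.
have /L2eqP/L2nullP h : \pi_(L2 R) (repr (\pi_(L2 R) F)) = \pi_(L2 R) F by exact: reprK.
have FF := ae_filter_ringOfSetsType mu.
move: h; apply: (@filterS _ _ FF) => t h Ht.
by apply/eqP; rewrite -subr_eq0; apply/eqP; exact: h.
Qed.

Lemma toL2D f g : f \in L2_pred -> g \in L2_pred ->
  toL2 (fun t => f t + g t) = toL2 f + toL2 g.
Proof.
move=> Hf Hg; rewrite (toL2E Hf) (toL2E Hg) (toL2E (L2_predD Hf Hg)) -raddfD.
by congr (\pi); exact: val_inj.
Qed.

Lemma toL2Z c f : f \in L2_pred -> toL2 (fun t => c * f t) = c *: toL2 f.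
Proof.
move=> Hf; rewrite (toL2E Hf) (toL2E (L2_predZ c Hf)).
by rewrite [RHS](_ : _ = L2scale c (\pi_(L2 R) (MkL2fun Hf)))// -pi_L2Z; congr (\pi); exact: val_inj.
Qed.

Lemma toL2B f g : f \in L2_pred -> g \in L2_pred ->
  toL2 (fun t => f t - g t) = toL2 f - toL2 g.
Proof.
move=> Hf Hg; rewrite -[in RHS]scaleN1r -toL2Z// -toL2D ?L2_predZ//.
by congr toL2; apply/funext => t; rewrite mulN1r.
Qed.

Lemma L2_pred_sum n (F : nat -> R -> R[i]) : (forall i, F i \in L2_pred) ->
  (fun t => \sum_(i < n) F i t) \in L2_pred.
Proof.
move=> HF; elim: n => [|n ih].
  under eq_fun do rewrite big_ord0; exact: (rpred0 L2_pred).
by under eq_fun do rewrite big_ord_recr; exact: L2_predD.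
Qed.

Lemma toL2_sum n (F : nat -> R -> R[i]) : (forall i, F i \in L2_pred) ->
  toL2 (fun t => \sum_(i < n) F i t) = \sum_(i < n) toL2 (F i).
Proof.
move=> HF; elim: n => [|n ih].
  rewrite big_ord0; under eq_fun do rewrite big_ord0.
  have H0 : (fun=> 0 : R[i]) \in L2_pred by exact: (rpred0 L2_pred).
  by rewrite -[RHS](scale0r (toL2 (fun=> 0 : R[i]))) -toL2Z//; congr toL2; apply/funext => t; rewrite mulr0.
rewrite big_ord_recr /= -ih -toL2D//; last exact: L2_pred_sum.
by congr toL2; apply/funext => t; rewrite big_ord_recr.
Qed.

Lemma toL2_ae f g : f \in L2_pred -> g \in L2_pred ->
  {ae mu, forall t, half_line t -> f t = g t} -> toL2 f = toL2 g.
Proof.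
move=> Hf Hg fg; rewrite (toL2E Hf) (toL2E Hg); apply/L2eqP/L2nullP.
have FF := ae_filter_ringOfSetsType mu.
move: fg; apply: (@filterS _ _ FF) => t fg Ht.
by rewrite /= !fctE /= fg// subrr.
Qed.

#[global] Opaque toL2.

Lemma L2norm_toL2 f : f \in L2_pred ->
  L2norm (toL2 f) ^+ 2 = (\int[mu]_(t in half_line) cmod (f t) ^+ 2)%R.
Proof.
by move=> Hf; rewrite (toL2E Hf) L2normE sqr_sqrtr ?fine_ge0 ?energy_ge0.
Qed.

Lemma L2norm_0 : L2norm (0 : L2 R) = 0.
Proof. by rewrite -(scale0r (0 : L2 R)) L2normZ cmod0 mul0r. Qed.

Lemma mul_integrable f g : f \in L2_pred -> g \in L2_pred ->
  cintegrable H (fun t => f t * g t).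
Proof.
move=> /L2_pred_integrable[mf ef] /L2_pred_integrable[mg eg].
apply: (cintegrable_dominated mH _ (integrableD mH ef eg)).
  exact: cmeasurableM.
move=> t _; rewrite cmodM; set a := cmod (f t); set b := cmod (g t); nra.
Qed.

Lemma cmod_pairing_sum f g : f \in L2_pred -> g \in L2_pred ->
  cmod (cintegral half_line (fun t => f t * g t)) <=
  L2norm (toL2 f) ^+ 2 + L2norm (toL2 g) ^+ 2.
Proof.
move=> Hf Hg; have [mf ef] := (L2_pred_integrable f).1 Hf.
have [mg eg] := (L2_pred_integrable g).1 Hg.
rewrite [X in _ <= X + _](L2norm_toL2 Hf) [X in _ <= _ + X](L2norm_toL2 Hg).
have ifg : mu.-integrable H (EFin \o (fun t => 2^-1 * (cmod (f t) ^+ 2 + cmod (g t) ^+ 2))).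
  by apply: integrable_EFinZ => //; exact: (integrableD mH ef eg).
apply: (le_trans (cmod_cintegral mH (cmeasurableM mf mg) ifg _)).
  move=> t _; rewrite cmodM; set a := cmod (f t); set b := cmod (g t).
  have := sqr_ge0 (a - b); nra.
rewrite RintegralZl//; last exact: (integrableD mH ef eg).
by rewrite RintegralD// mulrA mulfV ?mul1r// pnatr_eq0.
Qed.

(** Scaling [p] and [q] to at most 1 turns a bound by a sum of squares into a bound
    by a product. The scaling factors are [(p + d)^-1] and [(q + d)^-1] with a
    small positive [d], as [p] or [q] may vanish. *)
Lemma le_mul_of_scaled_sum (p q X : R) : 0 <= p -> 0 <= q ->
  (forall a b, 0 < a -> 0 < b -> a * b * X <= (a * p) ^+ 2 + (b * q) ^+ 2) ->
  X <= 2 * (p * q).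
Proof.
move=> p0 q0 key; apply/ler_addgt0Pr => e e0.
pose d := Num.min 1 (e / (2 * (1 + p + q))).
have pq : 0 < 1 + p + q by lra.
have d0 : 0 < d by rewrite lt_min ltr01 divr_gt0// mulr_gt0.
have d1 : d <= 1 by rewrite ge_min lexx.
have de : 2 * (1 + p + q) * d <= e.
  have : d <= e / (2 * (1 + p + q)) by rewrite ge_min lexx orbT.
  by rewrite ler_pdivlMr ?mulr_gt0// mulrC.
have pd : 0 < p + d by lra.
have qd : 0 < q + d by lra.
have := key (p + d)^-1 (q + d)^-1; rewrite !invr_gt0 => /(_ pd qd).
have h1 : ((p + d)^-1 * p) ^+ 2 <= 1.
  rewrite exprn_ile1 ?mulr_ge0 ?invr_ge0 ?(ltW pd)//.
  by rewrite ler_pdivrMl// mulr1; lra.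
have h2 : ((q + d)^-1 * q) ^+ 2 <= 1.
  rewrite exprn_ile1 ?mulr_ge0 ?invr_ge0 ?(ltW qd)//.
  by rewrite ler_pdivrMl// mulr1; lra.
move=> h; have : (p + d)^-1 * (q + d)^-1 * X <= 2 by lra.
rewrite -invfM ler_pdivrMl ?mulr_gt0// => {}h.
by apply: (le_trans h); nra.
Qed.

Lemma cmod_pairing f g : f \in L2_pred -> g \in L2_pred ->
  cmod (cintegral half_line (fun t => f t * g t)) <=
  2 * (L2norm (toL2 f) * L2norm (toL2 g)).
Proof.
move=> Hf Hg; apply: le_mul_of_scaled_sum; [exact: L2norm_ge0|exact: L2norm_ge0|].
move=> a b a0 b0.
have h : cmod (cintegral half_line (fun t => a%:C * f t * (b%:C * g t))) <= _ :=
  cmod_pairing_sum (L2_predZ a%:C Hf) (L2_predZ b%:C Hg).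
have E t : half_line t -> a%:C * f t * (b%:C * g t) = (a * b)%:C * (f t * g t).
  by move=> _; rewrite rmorphM /=; ring.
move: h; rewrite (eq_cintegral E) (cintegralZ _ mH (mul_integrable Hf Hg)).
rewrite (toL2Z _ Hf) (toL2Z _ Hg) [X in _ <= X ^+ 2 + _]L2normZ.
rewrite [X in _ <= _ + X ^+ 2]L2normZ cmodM.
rewrite (cmod_ge0_real (ltW a0)) (cmod_ge0_real (ltW b0)).
by rewrite (cmod_ge0_real (ltW (mulr_gt0 a0 b0))).
Qed.

Lemma pairing_ae f f' g : f \in L2_pred -> f' \in L2_pred -> g \in L2_pred ->
  {ae mu, forall t, half_line t -> f t = f' t} ->
  cintegral half_line (fun t => f t * g t) = cintegral half_line (fun t => f' t * g t).
Proof.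
move=> Hf Hf' Hg ff'.
have i1 := mul_integrable Hf Hg; have i2 := mul_integrable Hf' Hg.
apply/eqP; rewrite -subr_eq0 -(cintegralB mH i1 i2).
have -> : (fun t => f t * g t - f' t * g t) = (fun t => (f t - f' t) * g t).
  by apply/funext => t; rewrite mulrBl.
rewrite -cmod_eq0 eq_le cmod_ge0 andbT.
rewrite (le_trans (cmod_pairing (L2_predB Hf Hf') Hg))// toL2B//.
rewrite (toL2_ae Hf Hf' ff') subrr.
by rewrite L2norm_0 mul0r mulr0.
Qed.

End SquareIntegrable.
#[export] Hint Resolve L2_pred_repr : core.

(** * The Laplace transform *)

Section LaplaceTransform.
Context {R : realType}.
Local Notation mu := (@lebesgue_measure R).
Local Notation H := (@half_line R : set (measurableTypeR R)).
Implicit Types (f g : R -> R[i]) (v w : R[i]) (x y : L2 R).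

Local Notation c2pi := ((Num.sqrt (2 * pi) : R)^-1%:C : R[i]).

Lemma sqrt2pi_gt0 : 0 < Num.sqrt (2 * pi) :> R.
Proof. by rewrite sqrtr_gt0 mulr_gt0// pi_gt0. Qed.

Lemma pow_exp_L2 k w : 0 < Re w -> pow_exp k w \in L2_pred.
Proof.
move=> w0; have w20 : 0 < 2 * Re w by rewrite mulr_gt0.
apply: L2_pred_dominated (integrable_pow_exp (2 * k) w20) _.
  exact: cderiv_measurable mH (cderiv_pow_exp k w).
move=> t; rewrite half_lineE => t0; rewrite cmod_pow_exp// exprMn -exprM mulnC.
by rewrite -expRM_natl mulrN mulrA.
Qed.

Definition laplace_kernel w (t : R) : R[i] := cexp (- (w * t%:C)).

Lemma pow_exp0 w : pow_exp 0 w = laplace_kernel w.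
Proof. by apply/funext => t; rewrite /pow_exp expr0 mul1r. Qed.

Lemma laplace_kernel_L2 w : 0 < Re w -> laplace_kernel w \in L2_pred.
Proof. by rewrite -pow_exp0; exact: pow_exp_L2. Qed.

Lemma laplace_toL2 f w : 0 < Re w -> f \in L2_pred ->
  laplace (toL2 f) w = c2pi * cintegral half_line (fun t => f t * laplace_kernel w t).
Proof.
move=> w0 Hf; congr (_ * _).
exact: pairing_ae (laplace_kernel_L2 w0) (repr_toL2 Hf).
Qed.

Lemma laplaceD x y w : 0 < Re w -> laplace (x + y) w = laplace x w + laplace y w.
Proof.
move=> w0; have Hk := laplace_kernel_L2 w0.
rewrite -[x in LHS]toL2_repr -[y in LHS]toL2_repr -toL2D//.
rewrite laplace_toL2//; last exact: L2_predD.
rewrite -mulrDr -cintegralD//; try exact: mul_integrable.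
by congr (_ * _); apply: eq_cintegral => t _; rewrite mulrDl.
Qed.

Lemma laplaceZ a x w : 0 < Re w -> laplace (a *: x) w = a * laplace x w.
Proof.
move=> w0; have Hk := laplace_kernel_L2 w0.
rewrite -[x in LHS]toL2_repr -toL2Z//.
rewrite (laplace_toL2 w0 (L2_predZ a (L2_pred_repr x))).
rewrite mulrCA -(cintegralZ a mH (mul_integrable (L2_pred_repr x) Hk)).
by congr (_ * _); apply: eq_cintegral => t _; rewrite mulrA.
Qed.

Lemma laplace_bounded w : 0 < Re w ->
  exists2 C : R, 0 <= C & forall x, cmod (laplace x w) <= C * L2norm x.
Proof.
move=> w0; have Hk := laplace_kernel_L2 w0.
exists ((Num.sqrt (2 * pi))^-1 * (2 * L2norm (toL2 (laplace_kernel w)))).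
  by rewrite !mulr_ge0 ?invr_ge0 ?sqrtr_ge0 ?L2norm_ge0.
move=> x; rewrite cmodM cmod_ge0_real ?invr_ge0 ?sqrtr_ge0// -mulrA.
apply: ler_wpM2l; first by rewrite invr_ge0 sqrtr_ge0.
have := cmod_pairing (L2_pred_repr x) Hk; rewrite toL2_repr => h.
by apply: (le_trans h); rewrite [L2norm x * _]mulrC mulrA.
Qed.

Lemma laplace_pow_exp k v w : 0 < Re v -> 0 < Re w ->
  laplace (toL2 (pow_exp k v)) w = c2pi * (k`!%:R / (v + w) ^+ k.+1).
Proof.
move=> v0 w0; have vw : 0 < Re (v + w) by rewrite ReD addr_gt0.
rewrite laplace_toL2 ?pow_exp_L2//; congr (_ * _).
rewrite -cintegral_pow_exp//; apply: eq_cintegral => t _.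
by rewrite /pow_exp /laplace_kernel -mulrA -cexpD mulrDl opprD.
Qed.

Lemma laplace_kernel_shift tau w t :
  laplace_kernel w (t + tau) = cexp (- (w * tau%:C)) * laplace_kernel w t.
Proof. by rewrite /laplace_kernel -cexpD rmorphD mulrDr opprD addrC. Qed.

(** Extended by 0 to the line, the shifted function is the composition of [h] with
    a translation, and Lebesgue measure is translation invariant. *)
Lemma Rintegral_half_line_shift (h : R -> R) (tau : R) : 0 <= tau ->
  measurable_fun H h ->
  mu.-integrable H (EFin \o (fun t => if tau <= t then h (t - tau) else 0)) ->
  (\int[mu]_(t in half_line) (if tau <= t then h (t - tau) else 0))%R =
  (\int[mu]_(t in half_line) h t)%R.
Proof.
move=> tau0 mh ih.
pose sub : measurableTypeR R -> measurableTypeR R := fun t : R => t - tau.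
have msub : measurable_fun setT sub.
  by apply: measurable_funB => //; exact: measurable_cst.
have E : ((fun t => if tau <= t then h (t - tau) else 0) \_ H) = (h \_ H) \o sub.
  apply/funext => t; rewrite /= !patchE /sub.
  have -> : (t - tau \in (half_line : set R)) = (tau <= t).
    by apply/idP/idP; rewrite inE half_lineE subr_ge0.
  case: ifPn => tH; case: ifPn => // taut; move: tH; rewrite notin_setE half_lineE.
  by move/negP; rewrite -ltNge => /lt_le_trans/(_ tau0)/lt_le_trans/(_ taut); rewrite ltxx.
rewrite Rintegral_mkcond [RHS]Rintegral_mkcond E /Rintegral; congr fine.
have mhT : measurable_fun setT (EFin \o (h \_ H)).
  by apply/measurable_EFinP; apply/(measurable_restrictT _ _).1.
have := @integral_pushforward _ _ _ _ _ sub msub mu setT (EFin \o (h \_ H)) mhT.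
rewrite preimage_setT => <-//.
  by apply: eq_measure_integral => A mA _; exact: lebesgue_measure_shift.
have := (integrable_mkcond _ mH).1 ih; rewrite restrict_EFin E; exact.
Qed.

Lemma laplace_shift (tau : R) x w : 0 <= tau -> 0 < Re w ->
  laplace (Defs.shift tau x) w = cexp (- (w * tau%:C)) * laplace x w.
Proof.
move=> tau0 w0; have Hk := laplace_kernel_L2 w0.
have Hs := shift_L2 tau (L2_pred_repr x).
have -> : Defs.shift tau x = toL2 (shift_fun tau (repr x)).
  by rewrite (toL2E Hs) /Defs.shift; congr (\pi); exact: val_inj.
rewrite laplace_toL2// mulrCA; congr (_ * _).
have ig := mul_integrable (L2_pred_repr x) Hk.
pose g t := cexp (- (w * tau%:C)) * (repr x t * laplace_kernel w t).
rewrite -(cintegralZ _ mH ig) -/g.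
have mg : cmeasurable H g by exact: cintegrable_measurable (cintegrableZ _ mH ig).
have E t : shift_fun tau (repr x) t * laplace_kernel w t =
    if tau <= t then g (t - tau) else 0.
  rewrite /shift_fun; case: ifP => _; last by rewrite mul0r.
  have -> : laplace_kernel w t = cexp (- (w * tau%:C)) * laplace_kernel w (t - tau).
    by rewrite -laplace_kernel_shift subrK.
  by rewrite /g mulrCA.
have [i1 i2] := mul_integrable Hs Hk.
have E1 t : Re (shift_fun tau (repr x) t * laplace_kernel w t) =
    if tau <= t then Re (g (t - tau)) else 0 by rewrite E; case: ifP.
have E2 t : Im (shift_fun tau (repr x) t * laplace_kernel w t) =
    if tau <= t then Im (g (t - tau)) else 0 by rewrite E; case: ifP.
case: mg => m1 m2; apply: complex_ext => /=.
- under eq_Rintegral do rewrite E1.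
  apply: (Rintegral_half_line_shift (h := fun t => Re (g t))) => //.
  by move: i1; under eq_fun do rewrite E1.
- under eq_Rintegral do rewrite E2.
  apply: (Rintegral_half_line_shift (h := fun t => Im (g t))) => //.
  by move: i2; under eq_fun do rewrite E2.
Qed.

End LaplaceTransform.

(** * Analyticity of Laplace transforms *)

Section Analytic.
Context {R : realType}.
Local Notation mu := (@lebesgue_measure R).
Local Notation H := (@half_line R : set (measurableTypeR R)).
Implicit Types (F G : R[i] -> R[i]) (z h : R[i]) (x : L2 R).

Lemma analytic_quotient (U : set R[i]) F G : analytic_on U F -> analytic_on U G ->
  (forall z, U z -> G z != 0) -> analytic_on U (fun z => F z / G z - 1).
Proof.
move=> aF aG G0 z Uz.
have dF := aF z Uz; have dG := aG z Uz.
have dGV := derivableV (G0 z Uz) dG.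
have dFG := derivableM dF dGV.
exact: derivableB dFG (derivable_cst (1 : R[i]) z 1).
Qed.

Lemma analytic_on_eq (U : set R[i]) F G : open U -> (forall z, U z -> F z = G z) ->
  analytic_on U F -> analytic_on U G.
Proof.
move=> oU FG aF z Uz.
apply: (near_eq_derivable _ (aF z Uz)).
by apply: filterS (open_nbhs_nbhs (conj oU Uz)) => y /FG.
Qed.

Lemma open_right_half_plane : open (right_half_plane : set R[i]).
Proof.
rewrite openE => z z0; apply/nbhs_ballP.
have e0 : (0 : R[i]) < (Re z)%:C by rewrite ltcR.
exists (Re z)%:C => //= y; rewrite /ball /= normCE ltcR => h.
rewrite /right_half_plane /=.
have := le_lt_trans (le_trans (ler_norm _) (Re_le_cmod _)) h.
by rewrite ReB; lra.
Qed.

(** Under an integral, the second-order estimate of the exponential yields a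
    quadratic error bound of this form. *)
Lemma derivable_of_quadratic F z (D : R[i]) (K d : R) : 0 < d ->
  (forall h, cmod h <= d -> cmod (F (z + h) - F z - h * D) <= K * cmod h ^+ 2) ->
  derivable F z 1.
Proof.
move=> d0 FD; apply/cvg_ex; exists D; apply/complex_cvgE.
apply/cvgr0Pnorm_le => e e0.
have K1 : 0 < `|K| + 1 by rewrite ltr_pwDr.
pose r := Num.min d (e / (`|K| + 1)).
have r0 : 0 < r by rewrite lt_min d0 divr_gt0.
have rC : (0 : R[i]) < r%:C by rewrite ltcR.
apply/nbhs_ballP; exists r%:C => //= h.
rewrite /ball /= sub0r normrN normCE ltcR => hr h0.
rewrite ger0_norm ?cmod_ge0//.
have hd : cmod h <= d by rewrite (le_trans (ltW hr))// ge_min lexx.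
have he : cmod h * (`|K| + 1) <= e.
  rewrite -ler_pdivlMr// (le_trans (ltW hr))// ge_min lexx orbT//.
have hp : 0 < cmod h by rewrite cmod_gt0.
have -> : h^-1 *: (F (h%:A + z) - F z) - D = h^-1 * (F (z + h) - F z - h * D).
  have -> : h%:A = h by exact: mulr1.
  rewrite [h + z]addrC; transitivity (h^-1 * (F (z + h) - F z) - D) => //.
  by field.
rewrite cmodM cmodV ler_pdivrMl// (le_trans (FD h hd))//.
rewrite expr2 mulrCA ler_wpM2l ?cmod_ge0// (le_trans _ he)// mulrC.
rewrite ler_wpM2l ?cmod_ge0// (le_trans (ler_norm K))// lerDl//.
Qed.

(** Differentiation under the integral sign. For [|h| <= Re z / 2] the
    second-order Taylor error of [exp (- (z + h) t)] is at most
    [4 * |h| ^ 2 * t ^ 2 * exp (- (Re z / 2) t)], and this function of [t] is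
    square integrable, hence integrable against the given one. *)
Lemma analytic_laplace x : analytic_on right_half_plane (laplace x).
Proof.
move=> z z0; rewrite /right_half_plane /= in z0.
pose f : R -> R[i] := repr x.
have z20 : 0 < Re z / 2 by rewrite divr_gt0.
pose y : R[i] := (Re z / 2)%:C.
have y0 : 0 < Re y by [].
have Hf : f \in L2_pred by exact: L2_pred_repr.
have ig := cintegrable_cmod mH (mul_integrable Hf (pow_exp_L2 2 y0)).
pose G := fun t => cmod (f t * pow_exp 2 y t).
pose c : R[i] := (Num.sqrt (2 * pi) : R)^-1%:C.
pose D := - (c * cintegral half_line (fun t => f t * pow_exp 1 z t)).
pose K := cmod c * (2 * (4 * \int[mu]_(t in half_line) G t)%R).
apply: (@derivable_of_quadratic _ z D K _ z20) => h hz.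
have zh0 : 0 < Re (z + h).
  by rewrite ReD; have := Re_ge_Ncmod h; lra.
have i1 := mul_integrable Hf (laplace_kernel_L2 zh0).
have i2 := mul_integrable Hf (laplace_kernel_L2 z0).
have i3 := mul_integrable Hf (pow_exp_L2 1 z0).
have E : laplace x (z + h) - laplace x z - h * D =
    c * cintegral half_line (fun t => f t * (laplace_kernel (z + h) t -
      laplace_kernel z t + h * pow_exp 1 z t)).
  have -> : cintegral half_line (fun t => f t * (laplace_kernel (z + h) t -
      laplace_kernel z t + h * pow_exp 1 z t)) =
    cintegral half_line (fun t => f t * laplace_kernel (z + h) t) -
    cintegral half_line (fun t => f t * laplace_kernel z t) +
    h * cintegral half_line (fun t => f t * pow_exp 1 z t).
    rewrite -(cintegralB mH i1 i2) -(cintegralZ h mH i3) -cintegralD//.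
    - by apply: eq_cintegral => t _; ring.
    - exact: cintegrableB.
    - exact: cintegrableZ.
  by rewrite /D mulrN opprK mulrDr mulrBr [h * (c * _)]mulrCA.
rewrite E cmodM /K -mulrA ler_wpM2l ?cmod_ge0//.
have ig4 := integrable_EFinZ (4 * cmod h ^+ 2) mH ig.
have mg : cmeasurable H (fun t => f t * (laplace_kernel (z + h) t -
      laplace_kernel z t + h * pow_exp 1 z t)).
  have := cintegrable_measurable (cintegrableD mH (cintegrableB mH i1 i2)
    (cintegrableZ h mH i3)).
  by congr cmeasurable; apply/funext => t; ring.
have bound t : half_line t -> cmod (f t * (laplace_kernel (z + h) t -
      laplace_kernel z t + h * pow_exp 1 z t)) <= 4 * cmod h ^+ 2 * G t.
  rewrite half_lineE => t0; rewrite /G cmodM [cmod (f t * pow_exp _ _ _)]cmodM.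
  rewrite [X in _ <= X]mulrCA.
  rewrite ler_wpM2l ?cmod_ge0//.
  have -> : laplace_kernel (z + h) t - laplace_kernel z t + h * pow_exp 1 z t =
      laplace_kernel z t * (cexp (- (h * t%:C)) - 1 - - (h * t%:C)).
    rewrite /pow_exp expr1 -/(laplace_kernel z t).
    have -> : laplace_kernel (z + h) t = laplace_kernel z t * cexp (- (h * t%:C)).
      by rewrite /laplace_kernel -cexpD mulrDl opprD.
    by ring.
  rewrite cmodM cmod_pow_exp// /laplace_kernel cmod_cexp.
  have -> : Re (- (z * t%:C)) = - (Re z * t) by rewrite ReN ReM /= mulr0 subr0.
  have := cmod_cexp_sub1_sub (- (h * t%:C)).
  rewrite cmodN cmodM cmod_ge0_real// exprMn => b.
  apply: (le_trans (ler_wpM2l (expR_ge0 _) b)).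
  have -> : expR (- (Re z * t)) * (4 * (cmod h ^+ 2 * t ^+ 2 * expR (cmod h * t))) =
    4 * cmod h ^+ 2 * (t ^+ 2 * (expR (- (Re z * t)) * expR (cmod h * t))) by ring.
  rewrite -expRD; apply: ler_wpM2l; first by rewrite mulr_ge0// sqr_ge0.
  apply: ler_wpM2l; first exact: sqr_ge0.
  by rewrite ler_expR /=; nra.
have := cmod_cintegral mH mg ig4 bound; rewrite RintegralZl//.
by rewrite -[4 * _ * _]mulrA [cmod h ^+ 2 * _]mulrC !mulrA.
Qed.

End Analytic.

(** * Density of exponentials *)

Section Density.
Context {R : realType}.
Local Notation mu := (@lebesgue_measure R).
Local Notation H := (@half_line R : set (measurableTypeR R)).
Implicit Types (f g : R -> R[i]) (phi : R -> R) (x y : L2 R).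

(** Working with an arbitrary closed subspace keeps the density argument free of
    approximating sequences: membership passes to dominated limits. *)
Definition closed_subspace (V : set (L2 R)) :=
  [/\ V 0, forall a x y, V x -> V y -> V (a *: x + y) &
    forall x, (forall e : R, 0 < e -> exists2 v, V v & L2norm (x - v) < e) -> V x].

Lemma L2norm_dominated_cvg0 (u : nat -> R -> R[i]) f g :
  (forall n, u n \in L2_pred) -> f \in L2_pred -> g \in L2_pred ->
  (forall n t, half_line t -> cmod (u n t) <= cmod (g t)) ->
  {ae mu, forall t, half_line t -> cmod (f t - u n t) @[n --> \oo] --> 0} ->
  L2norm (toL2 f - toL2 (u n)) @[n --> \oo] --> 0.
Proof.
move=> Hu Hf Hg ug uf.
have [mf ef] := (L2_pred_integrable f).1 Hf.
have [mg eg] := (L2_pred_integrable g).1 Hg.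
have ih : mu.-integrable H (EFin \o (fun t => 2 * cmod (f t) ^+ 2 + 2 * cmod (g t) ^+ 2)).
  exact: (integrableD mH (integrable_EFinZ 2 mH ef) (integrable_EFinZ 2 mH eg)).
have [||||_] := @Rintegral_dominated_cvg R H (fun n t => cmod (f t - u n t) ^+ 2)
    (fun=> 0) _ mH _ _ ih.
- move=> n; apply: measurable_funX; apply: cmod_measurable.
  by have /L2_pred_integrable[] := L2_predB Hf (Hu n).
- exact: (measurable_cst (0 : R)).
- have FF := ae_filter_ringOfSetsType mu.
  move: uf; apply: (@filterS _ _ FF) => t uf Ht.
  rewrite (_ : (fun n => _) = (fun n => cmod (f t - u n t) * cmod (f t - u n t))).
    by rewrite -[X in _ --> X](mulr0 (0 : R)); apply: cvgM; exact: uf.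
  by apply/funext => n; rewrite expr2.
- move=> n t Ht; rewrite ger0_norm ?sqr_ge0//.
  have h1 := cmodB (f t) (u n t); have h2 := ug n t Ht.
  have h3 : cmod (f t - u n t) <= cmod (f t) + cmod (g t) by lra.
  apply: (@le_trans _ _ ((cmod (f t) + cmod (g t)) ^+ 2)).
    by rewrite lerXn2r// ?nnegrE ?addr_ge0 ?cmod_ge0.
  by have := sqr_ge0 (cmod (f t) - cmod (g t)); nra.
rewrite (_ : (\int[mu]_(t in half_line) (fun=> 0) t)%R = 0); last first.
  by rewrite /Rintegral integral0_eq.
move=> h; have sq : (fun n => L2norm (toL2 f - toL2 (u n))) =
    (fun n => Num.sqrt (\int[mu]_(t in half_line) cmod (f t - u n t) ^+ 2)%R).
  apply/funext => n; rewrite -(toL2B Hf (Hu n)) -(L2norm_toL2 (L2_predB Hf (Hu n))).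
  by rewrite sqrtr_sqr ger0_norm ?L2norm_ge0.
rewrite sq -(@sqrtr0 R); apply: cvg_trans (continuous_cvg _ _ h).
  by [].
exact: sqrt_continuous.
Qed.

Section ClosedSubspace.
Variable V : set (L2 R).
Hypothesis V_closed : closed_subspace V.

Lemma closed_add x y : V x -> V y -> V (x + y).
Proof. by have [_ l _] := V_closed => Vx Vy; rewrite -[x]scale1r; exact: l. Qed.

Lemma closed_scale a x : V x -> V (a *: x).
Proof. by have [V0 l _] := V_closed => Vx; rewrite -[_ *: _]addr0; exact: l. Qed.

Lemma closed_toL2_sum n (F : nat -> R -> R[i]) : (forall i, F i \in L2_pred) ->
  (forall i, V (toL2 (F i))) -> V (toL2 (fun t => \sum_(i < n) F i t)).
Proof.
move=> HF VF; rewrite toL2_sum//; elim: n => [|n ih].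
  by rewrite big_ord0; have [] := V_closed.
by rewrite big_ord_recr; exact: closed_add.
Qed.

Lemma closed_dominated (u : nat -> R -> R[i]) f g :
  (forall n, u n \in L2_pred) -> f \in L2_pred -> g \in L2_pred ->
  (forall n t, half_line t -> cmod (u n t) <= cmod (g t)) ->
  {ae mu, forall t, half_line t -> cmod (f t - u n t) @[n --> \oo] --> 0} ->
  (forall n, V (toL2 (u n))) -> V (toL2 f).
Proof.
move=> Hu Hf Hg ug uf Vu; have [_ _ l] := V_closed; apply: l => e e0.
have /cvgr0Pnorm_lt/(_ e e0) := L2norm_dominated_cvg0 Hu Hf Hg ug uf.
move=> [N _ /(_ N (leqnn N))]; rewrite ger0_norm ?L2norm_ge0// => h.
by exists (toL2 (u N)).
Qed.

(** The weight makes every bounded measurable function square integrable. *)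
Definition damped phi (t : R) : R[i] := (phi t * expR (- t))%:C.

Lemma damped1 : damped (fun=> 1) = laplace_kernel 1.
Proof.
apply/funext => t; rewrite /damped /laplace_kernel mul1r mul1r.
by rewrite -cexp_real rmorphN.
Qed.

Lemma measurable_expN : measurable_fun H (fun t : R => expR (- t)).
Proof.
by apply: (measurableT_comp (@measurable_expR R)); exact: measurable_funN.
Qed.

Lemma damped_measurable phi : measurable_fun H phi -> cmeasurable H (damped phi).
Proof.
move=> mp; apply: cmeasurable_real; apply: measurable_funM => //.
exact: measurable_expN.
Qed.

Lemma cmod_damped phi t : cmod (damped phi t) = `|phi t| * expR (- t).
Proof. by rewrite cmod_real normrM (ger0_norm (expR_ge0 _)). Qed.

Lemma damped_L2 phi (M : R) : measurable_fun H phi ->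
  (forall t, half_line t -> `|phi t| <= M) -> damped phi \in L2_pred.
Proof.
move=> mp pM; have two0 : (0 : R) < 2 by [].
apply: (@L2_pred_dominated _ _ (fun t => M ^+ 2 * expR (- (2 * t)))).
- exact: damped_measurable.
- exact: integrable_EFinZ (integrable_exp two0).
- move=> t Ht; rewrite cmod_damped exprMn -expRM_natl mulrN; apply: ler_wpM2r.
    exact: expR_ge0.
  have M0 := le_trans (normr_ge0 _) (pM t Ht).
  by rewrite lerXn2r// ?nnegrE// pM.
Qed.

Lemma closed_damped_limit (u : nat -> R -> R) phi (M : R) :
  (forall n, measurable_fun H (u n)) -> measurable_fun H phi ->
  (forall n t, half_line t -> `|u n t| <= M) ->
  (forall t, half_line t -> `|phi t| <= M) ->
  {ae mu, forall t, half_line t -> u n t @[n --> \oo] --> phi t} ->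
  (forall n, V (toL2 (damped (u n)))) -> V (toL2 (damped phi)).
Proof.
move=> mU mp uM pM uv; apply: (@closed_dominated _ _ (damped (fun=> M))).
- by move=> n; exact: damped_L2 (uM n).
- exact: damped_L2 pM.
- by apply: (@damped_L2 _ `|M|) => //; exact: measurable_cst.
- move=> n t Ht; rewrite !cmod_damped; apply: ler_wpM2r; first exact: expR_ge0.
  exact: le_trans (uM n t Ht) (ler_norm _).
- have FF := ae_filter_ringOfSetsType mu.
  move: uv; apply: (@filterS _ _ FF) => t uv Ht.
  rewrite (_ : (fun n => _) = (fun n => `|phi t - u n t| * expR (- t))).
    rewrite -[X in _ --> X](mul0r (expR (- t))) -(normr0 R) -(subrr (phi t)).
    apply: cvgM (cvg_cst _); apply: cvg_norm; apply: cvgB (uv Ht); exact: cvg_cst.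
  apply/funext => n; rewrite /damped -rmorphB -mulrBl cmod_real normrM.
  by rewrite (ger0_norm (expR_ge0 _)).
Qed.

End ClosedSubspace.
End Density.

Section LerchDensity.
Context {R : realType}.
Local Notation H := (@half_line R : set (measurableTypeR R)).

Variable V : set (L2 R).
Hypothesis V_closed : closed_subspace V.
Hypothesis V_exp : forall n, V (toL2 (laplace_kernel n.+1%:R)).

Lemma expR_partial_sum_le (X : R) K : 0 <= X ->
  \sum_(k < K) X ^+ k / k`!%:R <= expR X.
Proof.
move=> X0; rewrite -(big_mkord xpredT (fun k => X ^+ k / k`!%:R)).
apply: (@nondecreasing_cvgn_le _ (series (exp_coeff X))).
  apply/nondecreasing_seqP => n; rewrite seriesSr lerDl /exp_coeff /=.
  by rewrite divr_ge0 ?exprn_ge0.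
exact: is_cvg_series_exp_coeff.
Qed.

Lemma expR_partial_sum_cvg (X : R) :
  \sum_(k < K) X ^+ k / k`!%:R @[K --> \oo] --> expR X.
Proof.
rewrite (_ : (fun K => _) = series (exp_coeff X)).
  exact: is_cvg_series_exp_coeff.
by apply/funext => K; rewrite /series /= big_mkord.
Qed.

(** Lerch's approximation of the indicator of the ray from [a]: as [p] grows,
    [exp (p * (a - t))] tends to infinity before [a] and to 0 after it. *)
Definition lerch (p : nat) (a t : R) : R := expR (- expR (p%:R * (a - t))).

Lemma measurable_lerch p a : measurable_fun H (lerch p a).
Proof.
apply: (measurableT_comp (@measurable_expR R)); apply: measurable_funN.
apply: (measurableT_comp (@measurable_expR R)); apply: measurable_funM => //.
by apply: measurable_funB => //; exact: measurable_cst.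
Qed.

(** Expanding the outer exponential gives a series in [exp (- p * k * t)]; with the
    weight these are exponentials with the rates [k * p + 1]. *)
Lemma mem_lerch p a : V (toL2 (damped (lerch p a))).
Proof.
pose X t : R := expR (p%:R * (a - t)).
pose S K t : R := \sum_(k < K) (- X t) ^+ k / k`!%:R.
pose M := expR (expR (p%:R * a)).
have mS K : measurable_fun H (S K).
  apply: measurable_sum => k; apply: measurable_funM => //.
  apply: measurable_funX; apply: measurable_funN.
  apply: (measurableT_comp (@measurable_expR R)); apply: measurable_funM => //.
  by apply: measurable_funB => //; exact: measurable_cst.
apply: (@closed_damped_limit _ _ V_closed S _ M).
- exact: mS.
- exact: measurable_lerch.
- move=> K t; rewrite half_lineE => t0.
  rewrite (le_trans (ler_norm_sum _ _ _))//.
  have Xa : X t <= expR (p%:R * a).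
    by rewrite ler_expR; apply: ler_wpM2l => //; lra.
  have XM : expR (X t) <= M by rewrite ler_expR.
  apply: (le_trans (le_trans _ (expR_partial_sum_le K (expR_ge0 _ : 0 <= X t))) XM).
  apply: ler_sum => k _; rewrite normrM normrX normrN.
  by rewrite (ger0_norm (expR_ge0 _ : 0 <= X t)) ger0_norm ?invr_ge0.
- move=> t _; rewrite ger0_norm ?expR_ge0// ler_expR.
  by apply: (@le_trans _ _ 0); rewrite ?oppr_le0 ?expR_ge0.
- by apply: aeW => t _; exact: expR_partial_sum_cvg.
- move=> K.
  pose F k t := ((-1) ^+ k * expR (k%:R * (p%:R * a)) / k`!%:R)%:C *
     laplace_kernel (k * p).+1%:R t : R[i].
  have HF k : F k \in L2_pred.
    by apply: L2_predZ; apply: laplace_kernel_L2; exact: natr_gt0.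
  have -> : damped (S K) = (fun t => \sum_(k < K) F k t).
    apply/funext => t; rewrite /damped /S mulr_suml rmorph_sum; apply: eq_bigr => k _.
    rewrite /F /laplace_kernel -(rmorph_nat (real_complex R)) -rmorphM -rmorphN cexp_real -rmorphM.
    congr (_%:C); have -> : - X t = -1 * X t by rewrite mulN1r.
    rewrite exprMn -expRM_natl.
    have -> : - ((k * p).+1%:R * t) = k%:R * (p%:R * (a - t)) - k%:R * (p%:R * a) - t.
      by rewrite -natr1 natrM; ring.
    by rewrite !expRD !expRN; field; rewrite ?gt_eqF ?expR_gt0 ?ltr0n ?fact_gt0.
  apply: closed_toL2_sum => // k; rewrite toL2Z; first exact: closed_scale.
  exact: laplace_kernel_L2 (natr_gt0 _).
Qed.

Lemma mem_damped_ray a : V (toL2 (damped (\1_(`]a, +oo[%classic : set R)))).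
Proof.
apply: (@closed_damped_limit _ _ V_closed (fun n => lerch n a) _ 1).
- by move=> n; exact: measurable_lerch.
- exact: measurable_indic.
- move=> n t _; rewrite ger0_norm ?expR_ge0// -expR0 ler_expR.
  by rewrite oppr_le0 expR_ge0.
- by move=> t _; rewrite indicE; case: (_ \in _); rewrite ?normr1 ?normr0.
- exists [set a]; split; [exact: measurable_set1|exact: lebesgue_measure_set1|].
  move=> t /= h; apply: contrapT => ta; apply: h => _.
  have geo (s : R) : 0 < s -> (expR (- s) ^+ n)@[n --> \oo] --> (0 : R).
    move=> s0; have e1 : `|expR (- s)| < 1.
      by rewrite ger0_norm ?expR_ge0// expR_lt1 oppr_lt0.
    exact: cvg_expr e1.
  have [at_|ta'|E] := ltgtP a t; last by case: ta.
  + have ta0 : 0 < t - a by rewrite subr_gt0.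
    rewrite indicE mem_set; last by rewrite /= in_itv /= at_.
    apply: (@squeeze_cvgr _ _ _ _ (fun n => 1 - expR (- (t - a)) ^+ n) (cst 1)).
    * apply: nearW => n; rewrite /lerch /= -expRM_natl opprB.
      apply/andP; split; last by rewrite -expR0 ler_expR oppr_le0 expR_ge0.
      exact: expR_ge1Dx.
    * rewrite -[X in _ --> X]subr0; apply: cvgB; [exact: cvg_cst|exact: geo].
    * exact: cvg_cst.
  + have ta0 : 0 < a - t by rewrite subr_gt0.
    rewrite indicE memNset; last by rewrite /= in_itv /= andbT; apply/negP; rewrite -leNgt ltW.
    apply: (@squeeze_cvgr _ _ _ _ (cst 0) (fun n => expR (- (a - t)) ^+ n)).
    * apply: nearW => n; rewrite expR_ge0 /= /lerch -expRM_natl mulrN !expRN.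
      rewrite lef_pV2 ?posrE ?expR_gt0//.
      by have := expR_ge1Dx (expR (n%:R * (a - t))); lra.
    * exact: cvg_cst.
    * exact: geo.
- by move=> n; exact: mem_lerch.
Qed.

(** The rays form a pi-system generating the Borel sets, and the sets whose damped
    indicator belongs to the subspace form a Dynkin system. *)
Lemma mem_damped_indic (B : set (measurableTypeR R)) : measurable B ->
  V (toL2 (damped (\1_B))).
Proof.
move=> mB.
have i1 (C : set (measurableTypeR R)) t : `|\1_C t : R| <= 1.
  by rewrite indicE; case: (_ \in _); rewrite ?normr1 ?normr0.
have i2 (C : set (measurableTypeR R)) : measurable C -> measurable_fun H (\1_C : R -> R).
  by move=> mC; exact: measurable_indic.
have VT : V (toL2 (damped (\1_(setT : set (measurableTypeR R))))).
  by rewrite indicT damped1; exact: V_exp 0%N.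
apply: (@dynkin_induction _ (measurableTypeR R) (@RGenOInfty.G R)
  (fun B => V (toL2 (damped (\1_B))))).
- exact: RGenOInfty.measurableE.
- move=> _ _ [a ->] [b ->]; exists (Num.max a b).
  apply/seteqP; split => t /=; rewrite !in_itv /= !andbT gt_max.
    by move=> [-> ->].
  by move=> /andP[].
- exact: VT.
- by move=> _ [a ->]; exact: mem_damped_ray.
- move=> S mS VS; have l1 := damped_L2 (i2 _ mS) (fun t _ => i1 S t).
  have lT := damped_L2 (i2 _ measurableT) (fun t _ => i1 setT t).
  have -> : damped (\1_(~` S)) = (fun t => damped (\1_setT) t + -1 * damped (\1_S) t).
    apply/funext => t; rewrite mulN1r /damped -rmorphB /= -mulrBl.
    by congr ((_ * _)%:C); rewrite !indicE in_setT in_setC; case: (_ \in _); rewrite /= ?subrr ?subr0.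
  rewrite toL2D ?toL2Z//; last exact: L2_predZ.
  by apply: closed_add => //; exact: closed_scale.
- move=> F mF tF VF.
  apply: (@closed_damped_limit _ _ V_closed (fun n => \1_(\big[setU/set0]_(k < n) F k)) _ 1).
  + by move=> n; apply: i2; exact: bigsetU_measurable.
  + by apply: i2; exact: bigcup_measurable.
  + by move=> n t _; exact: i1.
  + by move=> t _; exact: i1.
  + apply: aeW => t _; apply: cvg_near_cst.
    have [[k _ Fk]|nF] := pselect ((\bigcup_k F k) t).
      exists k.+1 => // n /= kn; rewrite !indicE !mem_set//; first by exists k.
      by rewrite -bigcup_mkord; exists k.
    exists 0%N => // n _; rewrite !indicE !memNset//.
    by rewrite -bigcup_mkord => -[k _ Fk]; apply: nF; exists k.
  + move=> n.
    have -> : damped (\1_(\big[setU/set0]_(k < n) F k)) =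
        (fun t => \sum_(k < n) damped (\1_(F k)) t).
      apply/funext => t; rewrite /damped -rmorph_sum /= -mulr_suml.
      congr ((_ * _)%:C).
      elim: n => [|n ih]; first by rewrite !big_ord0 indic0.
      rewrite !big_ord_recr /= -ih !indicE in_setU.
      have [tFn|tFn] := boolP (t \in F n); last by rewrite orbF addr0.
      rewrite orbT memNset ?add0r// -bigcup_mkord => -[k kn Fk].
      have := tF k n I I; rewrite inE in tFn.
      by move=> /(_ (ex_intro _ t (conj Fk tFn))) E; move: kn; rewrite /= E ltnn.
    apply: (@closed_toL2_sum _ _ V_closed n (fun k => damped (\1_(F k)))) => k //.
    exact: damped_L2 (i2 _ (mF k)) (fun t _ => i1 (F k) t).
- by have : (@RGenOInfty.G R).-sigma.-measurable B by rewrite -RGenOInfty.measurableE.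
Qed.

End LerchDensity.

Section FullDensity.
Context {R : realType}.
Local Notation H := (@half_line R : set (measurableTypeR R)).
Implicit Types (f : R -> R[i]) (phi : R -> R) (x : L2 R).

Variable V : set (L2 R).
Hypothesis V_closed : closed_subspace V.
Hypothesis V_exp : forall n, V (toL2 (laplace_kernel n.+1%:R)).

Import HBNNSimple HBSimple.

Lemma damped_indic_L2 (B : set (measurableTypeR R)) : measurable B ->
  damped (\1_B) \in L2_pred.
Proof.
move=> mB; apply: (@damped_L2 _ _ 1); first exact: measurable_indic.
by move=> t _; rewrite indicE; case: (_ \in _); rewrite ?normr1 ?normr0.
Qed.

Lemma mem_damped_simple (s : {sfun (measurableTypeR R) >-> R}) :
  damped s \in L2_pred /\ V (toL2 (damped s)).
Proof.
have [n [c sE]] : exists n (c : nat -> R), forall t,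
    s t = \sum_(i < n) c i * \1_(s @^-1` [set c i]) t.
  by eexists; exists (nth 0 (finmap.enum_fset (fset_set (range s)))) => t; exact: fimfunEord.
pose F (i : nat) t := (c i)%:C * damped (\1_(s @^-1` [set c i])) t : R[i].
have mi i : measurable (s @^-1` [set c i] : set (measurableTypeR R)).
  exact: measurable_funPTI.
have E : damped s = (fun t => \sum_(i < n) F i t).
  apply/funext => t; rewrite /damped sE mulr_suml rmorph_sum.
  by apply: eq_bigr => i _; rewrite /F /damped -mulrA rmorphM.
have HF i : F i \in L2_pred by apply: L2_predZ; exact: damped_indic_L2.
rewrite E; split; first exact: L2_pred_sum.
apply: closed_toL2_sum => // i; rewrite toL2Z; last exact: damped_indic_L2.
by apply: closed_scale => //; exact: mem_damped_indic.
Qed.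

(** Simple functions increasing to [phi * exp] give, after damping, an approximation
    of [phi] dominated by [phi]. *)
Lemma mem_nonneg_valued phi : (fun t => (phi t)%:C) \in L2_pred ->
  (forall t, half_line t -> 0 <= phi t) -> V (toL2 (fun t => (phi t)%:C)).
Proof.
move=> Hphi phi0; have /L2_pred_integrable[[mphi _] _] := Hphi.
have mg : measurable_fun H (EFin \o (fun t => phi t * expR t)).
  apply/measurable_EFinP; apply: measurable_funM => //.
  by apply: measurable_funTS; exact: measurable_expR.
pose s := nnsfun_approx mH mg.
have g0 t : H t -> (0 <= (phi t * expR t)%R%:E)%E.
  by move=> Ht; rewrite /= lee_fin mulr_ge0 ?expR_ge0// phi0.
have sg t : H t -> s n t @[n --> \oo] --> phi t * expR t.
  move=> Ht; have := cvg_nnsfun_approx mH mg g0 Ht.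
  by move/fine_cvg.
have sle n t : H t -> s n t <= phi t * expR t.
  move=> Ht; have := sg t Ht => /[dup] /cvgP ct ct'.
  rewrite -(cvg_lim (@Rhausdorff R) ct').
  apply: nondecreasing_cvgn_le ct _ => m p mp.
  by have /lefP := nd_nnsfun_approx mH mg mp; exact.
apply: (@closed_dominated _ _ V_closed (fun n => damped (s n)) _ (fun t => (phi t)%:C)).
- by move=> n; case: (mem_damped_simple (s n)).
- exact: Hphi.
- exact: Hphi.
- move=> n t Ht; rewrite cmod_damped cmod_real ger0_norm; last exact: fun_ge0.
  rewrite (ger0_norm (phi0 t Ht)) -ler_pdivlMr ?expR_gt0//.
  by rewrite expRN invrK sle.
- apply: aeW => t Ht.
  have E : phi t = phi t * expR t * expR (- t) by rewrite -mulrA expRxMexpNx_1 mulr1.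
  rewrite (_ : (fun n => _) = (fun n => `|phi t * expR t - s n t| * expR (- t))).
    rewrite -[X in _ --> X](mul0r (expR (- t))) -(normr0 R) -(subrr (phi t * expR t)).
    apply: cvgM (cvg_cst _); apply: cvg_norm; apply: cvgB (sg t Ht); exact: cvg_cst.
  apply/funext => n; rewrite /damped -rmorphB cmod_real {1}E -mulrBl normrM.
  by rewrite (ger0_norm (expR_ge0 _)).
- by move=> n; case: (mem_damped_simple (s n)).
Qed.

Lemma mem_real_valued phi : (fun t => (phi t)%:C) \in L2_pred -> V (toL2 (fun t => (phi t)%:C)).
Proof.
move=> Hphi; have /L2_pred_integrable[[mphi _] ephi] := Hphi.
pose p t := Num.max (phi t) 0; pose q t := Num.max (- phi t) 0.
have mp : measurable_fun H p.
  by apply: measurable_maxr => //; exact: measurable_cst.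
have mq : measurable_fun H q.
  by apply: measurable_maxr; [exact: measurable_funN|exact: measurable_cst].
have Hp : (fun t => (p t)%:C) \in L2_pred.
  apply: L2_pred_dominated ephi _; first exact: cmeasurable_real.
  move=> t _; rewrite !cmod_real lerXn2r ?nnegrE//.
  by rewrite /p maxEle; case: ifP => _; rewrite ?normr0.
have Hq : (fun t => (q t)%:C) \in L2_pred.
  apply: L2_pred_dominated ephi _; first exact: cmeasurable_real.
  move=> t _; rewrite !cmod_real lerXn2r ?nnegrE//.
  by rewrite /q maxEle; case: ifP => _; rewrite ?normr0 ?normrN.
have -> : (fun t => (phi t)%:C) = (fun t => (p t)%:C + -1 * (q t)%:C).
  apply/funext => t; rewrite mulN1r -rmorphB; congr (_%:C).
  by rewrite /p /q !maxEle; case: ifP; case: ifP; lra.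
rewrite toL2D//; last exact: L2_predZ.
apply: closed_add => //; first by apply: mem_nonneg_valued => // t _; rewrite le_max lexx orbT.
rewrite toL2Z//; apply: closed_scale => //.
by apply: mem_nonneg_valued => // t _; rewrite le_max lexx orbT.
Qed.

(** Density of the span of the exponentials: a function is split into its real and
    imaginary parts, and these into their positive and negative parts. *)
Lemma exp_dense x : V x.
Proof.
rewrite -(toL2_repr x); set f : R -> R[i] := repr x.
have Hf : f \in L2_pred by exact: L2_pred_repr.
have /L2_pred_integrable[[m1 m2] ef] := Hf.
have Hr : (fun t => (Re (f t))%:C) \in L2_pred.
  apply: L2_pred_dominated ef _; first exact: cmeasurable_real.
  by move=> t _; rewrite cmod_real lerXn2r ?nnegrE ?cmod_ge0// Re_le_cmod.
have Hi : (fun t => (Im (f t))%:C) \in L2_pred.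
  apply: L2_pred_dominated ef _; first exact: cmeasurable_real.
  by move=> t _; rewrite cmod_real lerXn2r ?nnegrE ?cmod_ge0// Im_le_cmod.
have -> : f = (fun t => (Re (f t))%:C + 'i%C * (Im (f t))%:C).
  by apply/funext => t; apply: complex_ext; rewrite !ReIm /=; ring.
rewrite toL2D//; last exact: L2_predZ.
apply: closed_add => //; first exact: mem_real_valued.
by rewrite toL2Z//; apply: closed_scale => //; exact: mem_real_valued.
Qed.

End FullDensity.

(** * Bounded functionals *)

Lemma cvg_norm_sub0 (R : realType) (u : nat -> R) (l : R) :
  u n @[n --> \oo] --> l -> `|l - u n| @[n --> \oo] --> 0.
Proof.
move=> ul; have h : `|l - u n| @[n --> \oo] --> `|l - l|.
  by apply: cvg_norm; apply: cvgB ul; exact: cvg_cst.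
by rewrite subrr normr0 in h.
Qed.

Section BoundedFunctionals.
Context {R : realType}.
Implicit Types (g : R -> R[i]) (x y : L2 R) (Lam : L2 R -> R[i]).

Definition bounded_functional Lam :=
  (forall a x y, Lam (a *: x + y) = a * Lam x + Lam y) /\
  exists2 C : R, 0 <= C & forall x, cmod (Lam x) <= C * L2norm x.

Section Fixed.
Variable Lam : L2 R -> R[i].
Hypothesis Lam_bounded : bounded_functional Lam.

Lemma functionalD x y : Lam (x + y) = Lam x + Lam y.
Proof. by have [l _] := Lam_bounded; rewrite -[x]scale1r l mul1r scale1r. Qed.

Lemma functional0 : Lam 0 = 0.
Proof. by apply: (addrI (Lam 0)); rewrite -functionalD !addr0. Qed.

Lemma functionalZ a x : Lam (a *: x) = a * Lam x.
Proof. by have [l _] := Lam_bounded; rewrite -[_ *: _]addr0 l functional0 addr0. Qed.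

Lemma functionalB x y : Lam (x - y) = Lam x - Lam y.
Proof. by rewrite functionalD -scaleN1r functionalZ mulN1r. Qed.

Lemma functional_sum n (F : nat -> L2 R) :
  Lam (\sum_(i < n) F i) = \sum_(i < n) Lam (F i).
Proof.
elim: n => [|n ih]; first by rewrite !big_ord0 functional0.
by rewrite !big_ord_recr functionalD ih.
Qed.

Lemma kernel_closed : closed_subspace [set x | Lam x = 0].
Proof.
split => /=.
- exact: functional0.
- by move=> a x y x0 y0; have [-> _] := Lam_bounded; rewrite x0 y0 mulr0 addr0.
move=> x h; have [_ [C C0 LC]] := Lam_bounded.
apply/eqP; rewrite -cmod_eq0 eq_le cmod_ge0 andbT.
apply/ler_addgt0Pr => e e0; rewrite add0r.
have C1 : 0 < C + 1 by rewrite ltr_wpDl.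
have [v /= v0 xv] := h (e / (C + 1)) (divr_gt0 e0 C1).
rewrite -[Lam x]subr0 -v0 -functionalB (le_trans (LC _))//.
have := ltW xv; rewrite ler_pdivlMr// mulrC => {}xv.
by apply: (le_trans _ xv); rewrite ler_wpM2r ?L2norm_ge0// lerDl.
Qed.

Lemma functional_eq0_exp : (forall n, Lam (toL2 (laplace_kernel n.+1%:R)) = 0) ->
  forall x, Lam x = 0.
Proof. by move=> h x; exact: (exp_dense kernel_closed h x). Qed.

Lemma pow_exp_real (k : nat) (r t : R) :
  pow_exp k r%:C t = (t ^+ k * expR (- (r * t)))%:C.
Proof. by rewrite /pow_exp -rmorphM -rmorphN cexp_real -rmorphXn -rmorphM. Qed.

(** The Taylor series of [exp (- t / 2)] moves the base point [r] by 1/2. Its partial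
    sums are at most [exp (t / 2)] in absolute value, which leaves the square
    integrable bound [t ^ k * exp (- (r - 1/2) * t)]. *)
Lemma functional_pow_exp_step (r : R) : 1 <= r ->
  (forall k, Lam (toL2 (pow_exp k r%:C)) = 0) ->
  forall k, Lam (toL2 (pow_exp k (r + 2^-1)%:C)) = 0.
Proof.
move=> r1 h k; have r0 : 0 < Re (r%:C) by rewrite /=; lra.
have r2 : 0 < Re ((r + 2^-1)%:C) by rewrite /=; lra.
have r3 : 0 < Re ((r - 2^-1)%:C) by rewrite /=; lra.
pose F j t := ((- 2^-1) ^+ j / j`!%:R)%:C * pow_exp (k + j) r%:C t : R[i].
have HF j : F j \in L2_pred by apply: L2_predZ; exact: pow_exp_L2.
have E n t : \sum_(j < n) F j t =
    (t ^+ k * expR (- (r * t)) * \sum_(j < n) (- (2^-1 * t)) ^+ j / j`!%:R)%:C.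
  rewrite mulr_sumr rmorph_sum; apply: eq_bigr => j _.
  rewrite /F pow_exp_real -rmorphM; congr (_%:C).
  by rewrite -[- (2^-1 * t)]mulNr exprMn exprD; ring.
have E2 t : pow_exp k (r + 2^-1)%:C t = (t ^+ k * expR (- (r * t)) * expR (- (2^-1 * t)))%:C.
  by rewrite pow_exp_real mulrDl opprD expRD mulrA.
have E3 t : pow_exp k (r - 2^-1)%:C t = (t ^+ k * expR (- (r * t)) * expR (2^-1 * t))%:C.
  by rewrite pow_exp_real mulrBl opprB addrC expRD mulrA.
apply: (@closed_dominated _ _ kernel_closed (fun n t => \sum_(j < n) F j t) _
  (pow_exp k (r - 2^-1)%:C)).
- by move=> n; exact: L2_pred_sum.
- exact: pow_exp_L2.
- exact: pow_exp_L2.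
- move=> n t; rewrite half_lineE => t0; rewrite E E3 !cmod_real.
  rewrite normrM [X in _ <= X]normrM; apply: ler_wpM2l => //.
  rewrite (ger0_norm (expR_ge0 _)) (le_trans (ler_norm_sum _ _ _))//.
  have t20 : 0 <= 2^-1 * t by rewrite mulr_ge0.
  apply: (le_trans _ (expR_partial_sum_le n t20)); apply: ler_sum => j _.
  by rewrite normrM normrX normrN (ger0_norm t20) ger0_norm ?invr_ge0.
- apply: aeW => t _; pose c := t ^+ k * expR (- (r * t)).
  rewrite (_ : (fun n => _) = (fun n => `|c| *
      `|expR (- (2^-1 * t)) - \sum_(j < n) (- (2^-1 * t)) ^+ j / j`!%:R|)).
    rewrite -[X in _ --> X](mulr0 `|c|); apply: cvgM; first exact: cvg_cst.
    by apply: cvg_norm_sub0; exact: expR_partial_sum_cvg.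
  by apply/funext => n; rewrite E E2 -rmorphB -mulrBr cmod_real normrM.
- move=> n /=; rewrite toL2_sum// (functional_sum n (fun j => toL2 (F j))) big1// => j _.
  by rewrite toL2Z ?functionalZ ?h ?mulr0//; exact: pow_exp_L2.
Qed.

(** A single rate suffices when all powers of [t] are allowed: two steps of 1/2 at a
    time lead from rate 1 to all positive integers. *)
Lemma functional_eq0_pow_exp : (forall k, Lam (toL2 (pow_exp k 1)) = 0) ->
  forall x, Lam x = 0.
Proof.
move=> h; apply: functional_eq0_exp => n.
have step j : forall k, Lam (toL2 (pow_exp k (1 + j%:R / 2)%:C)) = 0.
  elim: j => [|j ih]; first by rewrite mul0r addr0.
  have -> : 1 + j.+1%:R / 2 = (1 + j%:R / 2) + 2^-1 :> R by rewrite -natr1; field.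
  by apply: functional_pow_exp_step => //; rewrite lerDl divr_ge0.
have := step (n * 2)%N 0%N; rewrite pow_exp0 natrM mulfK ?pnatr_eq0//.
by rewrite addrC natr1 rmorph_nat.
Qed.

End Fixed.

(** Bilinear rather than hermitian, so that [pairing x] is linear. *)
Definition pairing x y := cintegral half_line (fun t => repr x t * repr y t).

Lemma pairing_toL2 x g : g \in L2_pred ->
  pairing x (toL2 g) = cintegral half_line (fun t => repr x t * g t).
Proof.
move=> Hg; rewrite /pairing; transitivity (cintegral half_line (fun t => g t * repr x t)).
  rewrite -(pairing_ae (L2_pred_repr (toL2 g)) Hg (L2_pred_repr x) (repr_toL2 Hg)).
  by apply: eq_cintegral => t _; rewrite mulrC.
by apply: eq_cintegral => t _; rewrite mulrC.
Qed.

Lemma bounded_pairing x : bounded_functional (pairing x).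
Proof.
split=> [a y z|].
  have Hx := L2_pred_repr x; have Hy := L2_pred_repr y; have Hz := L2_pred_repr z.
  have -> : a *: y + z = toL2 (fun t => a * repr y t + repr z t).
    by rewrite toL2D ?toL2Z ?toL2_repr//; exact: L2_predZ.
  rewrite pairing_toL2; last by apply: L2_predD => //; exact: L2_predZ.
  have i1 := mul_integrable Hx Hy; have i2 := mul_integrable Hx Hz.
  rewrite /pairing -(cintegralZ _ mH i1) -(cintegralD mH (cintegrableZ a mH i1) i2).
  by apply: eq_cintegral => t _; ring.
exists (2 * L2norm x); first by rewrite mulr_ge0 ?L2norm_ge0.
move=> y; have := cmod_pairing (L2_pred_repr x) (L2_pred_repr y).
by rewrite !toL2_repr mulrA.
Qed.

Lemma bounded_laplace w : 0 < Re w -> bounded_functional (fun x => laplace x w).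
Proof.
move=> w0; split; last exact: laplace_bounded.
by move=> a x y; rewrite laplaceD// laplaceZ.
Qed.

(** If the transform vanishes at the positive integers, pairing with [x] vanishes on
    all exponentials, hence at the conjugate of [x], where it is the squared
    norm. *)
Lemma laplace_eq0 x : (forall w, right_half_plane w -> laplace x w = 0) -> x = 0.
Proof.
move=> h; apply: L2norm0_eq0; have Hx := L2_pred_repr x.
have Hc : (fun t => (repr x t)^*) \in L2_pred.
  have /L2_pred_integrable[mx ex] := Hx.
  apply: L2_pred_dominated ex _; first exact: cmeasurable_conj.
  by move=> t _; rewrite cmod_conj.
have p0 : pairing x (toL2 (fun t => (repr x t)^*)) = 0.
  apply: (functional_eq0_exp (bounded_pairing x)) => n.
  have n0 : 0 < Re (n.+1%:R : R[i]) := natr_gt0 n.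
  rewrite pairing_toL2; last exact: laplace_kernel_L2.
  have := h _ n0; rewrite /laplace => /eqP; rewrite mulf_eq0 => /orP[|/eqP//].
  by rewrite -cmod_eq0 cmod_real normr_eq0 invr_eq0 gt_eqF// sqrt2pi_gt0.
apply/eqP; rewrite -sqrf_eq0; apply/eqP.
rewrite -(toL2_repr x) (L2norm_toL2 Hx).
have := congr1 (@complex.Re R) p0; rewrite pairing_toL2//= => E.
rewrite -[RHS]E; apply: eq_Rintegral => t _.
by rewrite mul_conj.
Qed.

Lemma laplace_injective x y :
  (forall w, right_half_plane w -> laplace x w = laplace y w) -> x = y.
Proof.
move=> h; apply/eqP; rewrite -subr_eq0; apply/eqP; apply: laplace_eq0 => w w0.
by rewrite (functionalB (bounded_laplace w0)) h// subrr.
Qed.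

End BoundedFunctionals.

(** * The Hardy space of the half-plane *)

Section CauchyDensity.
Context {R : realType}.
Local Notation mu := (@lebesgue_measure R).
Local Notation RT := (setT : set (measurableTypeR R)).

Definition cauchy_density (a y : R) : R := a / (a ^+ 2 + y ^+ 2).

Lemma is_derive_atan_scaled (a y : R) : 0 < a ->
  is_derive y 1 (fun s : R => atan (s / a)) (cauchy_density a y).
Proof.
move=> a0; have d1 : is_derive y 1 (fun s : R => s * a^-1) a^-1.
  have := is_derive_fun_mul (is_derive_id y 1) (is_derive_cst a^-1 y 1).
  by rewrite mul1r mulr0 addr0.
have d2 : is_derive (y * a^-1) 1 (@atan R) (1 + (y / a) ^+ 2)^-1.
  by apply: DeriveDef; [exact: derivable_atan|rewrite -derive1E derive1_atan].
have d3 := @is_derive_fun_comp _ (@atan R) (fun s => s / a) y _ _ d2 d1.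
apply: (is_derive_fun_eq d3); rewrite /cauchy_density.
have h : a ^+ 2 + y ^+ 2 != 0.
  by rewrite gt_eqF// ltr_pwDl ?exprn_gt0// sqr_ge0.
by field; rewrite h gt_eqF.
Qed.

Lemma cauchy_density_continuous (a : R) : 0 < a ->
  continuous (cauchy_density a).
Proof.
move=> a0 y; apply: cvgM; first exact: cvg_cst.
apply: cvgV; first by rewrite gt_eqF// ltr_pwDl ?exprn_gt0// sqr_ge0.
by apply: cvgD; [exact: cvg_cst|exact: exprn_continuous].
Qed.

Lemma cauchy_density_integral (a : R) : 0 < a ->
  (\int[mu]_(y in RT) (cauchy_density a y)%:E = pi%:E)%E.
Proof.
move=> a0; have c := cauchy_density_continuous a0.
have pos (y : R) : 0 <= cauchy_density a y.
  by rewrite divr_ge0 ?(ltW a0)// addr_ge0// sqr_ge0.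
rewrite (@ge0_symfun_integralT R (cauchy_density a))//; last first.
  by move=> y; rewrite /= /cauchy_density sqrrN.
rewrite -set_itvcy (@ge0_continuous_FTC2y _ _ (fun s => atan (s / a)) 0 (pi / 2)).
- by rewrite mul0r atan0 sube0 -EFinM mulrC divfK.
- by move=> y _; exact: pos.
- exact: continuous_subspaceT.
- apply: (@cvg_comp _ _ _ (fun s : R => s / a) (@atan R) _ +oo%R); last exact: cvgy_atan.
  by apply: gt0_cvgMly; [rewrite invr_gt0|exact: cvg_id].
- by move=> y _; have := is_derive_atan_scaled y a0 => -[].
- apply: cvg_at_right_filter; exact: derive_continuous (is_derive_atan_scaled 0 a0).
- by move=> y _; have d := is_derive_atan_scaled y a0; rewrite derive1E; exact: derive_val.
Qed.

Lemma cauchy_density_integrable (a : R) : 0 < a ->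
  mu.-integrable RT (EFin \o cauchy_density a).
Proof.
move=> a0; have pos (y : R) : 0 <= cauchy_density a y.
  by rewrite divr_ge0 ?(ltW a0)// addr_ge0// sqr_ge0.
apply/integrableP; split.
  apply/measurable_EFinP; apply: continuous_measurable_fun.
  exact: cauchy_density_continuous.
under eq_integral => y _ do rewrite gee0_abs ?lee_fin ?pos//.
by rewrite cauchy_density_integral// ltry.
Qed.

Lemma Rintegral_cauchy_density (a : R) : 0 < a ->
  (\int[mu]_(y in RT) cauchy_density a y)%R = pi.
Proof. by move=> a0; rewrite /Rintegral cauchy_density_integral. Qed.

End CauchyDensity.

Section HardyHalfPlane.
Context {R : realType}.
Local Notation mu := (@lebesgue_measure R).
Local Notation H := (@half_line R : set (measurableTypeR R)).
Local Notation RT := (setT : set (measurableTypeR R)).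
Implicit Types (p : {poly R[i]}) (b : nat -> R).

Lemma integrable_sum_ord (D : set (measurableTypeR R)) n (F : nat -> R -> R) :
  measurable D -> (forall i, mu.-integrable D (EFin \o F i)) ->
  mu.-integrable D (EFin \o (fun t => \sum_(i < n) F i t)).
Proof.
move=> mD iF; elim: n => [|n ih].
  by under eq_fun do rewrite big_ord0; exact: integrable0.
by under eq_fun do rewrite big_ord_recr; exact: (integrableD mD ih (iF n)).
Qed.

Lemma Rintegral_sum_ord (D : set (measurableTypeR R)) n (F : nat -> R -> R) :
  measurable D -> (forall i, mu.-integrable D (EFin \o F i)) ->
  (\int[mu]_(t in D) \sum_(i < n) F i t)%R = \sum_(i < n) (\int[mu]_(t in D) F i t)%R.
Proof.
move=> mD iF; elim: n => [|n ih].
  by rewrite big_ord0 /Rintegral integral0_eq// => t _; rewrite big_ord0.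
rewrite big_ord_recr /= -ih -RintegralD//; last exact: integrable_sum_ord.
by apply: eq_Rintegral => t _; rewrite big_ord_recr.
Qed.

Lemma Rintegral_exp (a : R) : 0 < a ->
  (\int[mu]_(t in half_line) expR (- (a * t)))%R = a^-1.
Proof.
move=> a0; have h : cintegral half_line (pow_exp 0 a%:C) = (a%:C)^-1.
  by rewrite cintegral_pow_exp// fact0 expr1 mul1r.
have E := congr1 (@complex.Re R) h.
transitivity (Re (a%:C)^-1); last first.
  by rewrite -(rmorphV (real_complex R)) ?unitfE ?gt_eqF.
rewrite -E; apply: eq_Rintegral => t _.
by rewrite pow_exp_real expr0 mul1r.
Qed.

(** Sums of exponentials with real coefficients, and their Laplace transforms up to a
    constant. For real coefficients the squared modulus on a vertical line is a
    real quadratic form, which avoids complex partial fractions. *)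
Definition real_exp_sum n b (t : R) := \sum_(i < n) b i * expR (- (i.+1%:R * t)).

Definition real_pole_sum n b (w : R[i]) : R[i] :=
  \sum_(i < n) (b i)%:C / (i.+1%:R + w).

Section VerticalLine.
Variables (x0 : R) (x00 : 0 < x0).
Local Notation al i := (x0 + i.+1%:R : R).

Let al_gt0 i : 0 < al i. Proof. by rewrite addr_gt0// ltr0n. Qed.

(** Partial fractions: the real part of [1 / ((A + i y) * (B - i y))] is
    [(cauchy_density A y + cauchy_density B y) / (A + B)]. The imaginary parts
    cancel in the symmetric sum. *)
Lemma cmod_real_pole_sum n b y :
  cmod (real_pole_sum n b (x0 +i* y)) ^+ 2 =
  \sum_(i < n) \sum_(j < n) b i * b j / (al i + al j) *
    (cauchy_density (al i) y + cauchy_density (al j) y).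
Proof.
have s0 (A : R) : 0 < A -> A ^+ 2 + y ^+ 2 != 0.
  by move=> A0; rewrite gt_eqF// ltr_pwDl ?exprn_gt0// sqr_ge0.
have inv0 (c A : R) : 0 < A -> c%:C / (A +i* y) =
    (c * A / (A ^+ 2 + y ^+ 2)) +i* (- (c * y / (A ^+ 2 + y ^+ 2))).
  move=> A0; have d0 : A +i* y != 0 by apply/eqP => -[] /eqP; rewrite gt_eqF.
  by apply: (mulIf d0); rewrite divfK//; apply: complex_ext; rewrite !ReIm /=;
    field; exact: s0.
have inv i : (b i)%:C / (i.+1%:R + (x0 +i* y)) =
    (b i * al i / (al i ^+ 2 + y ^+ 2)) +i* (- (b i * y / (al i ^+ 2 + y ^+ 2))).
  rewrite -inv0//; congr (_ / _); rewrite -(rmorph_nat (real_complex R)).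
  by apply: complex_ext; rewrite !ReIm /= ?add0r// addrC.
rewrite cmodE /real_pole_sum Re_sum Im_sum.
under eq_bigr do rewrite inv /=.
under [X in _ + X ^+ 2]eq_bigr do rewrite inv /=.
rewrite !expr2 !mulr_suml -big_split; apply: eq_bigr => i _ /=.
rewrite !mulr_sumr -big_split; apply: eq_bigr => j _ /=.
rewrite /cauchy_density; move: (al_gt0 i) (al_gt0 j).
move: (al i) (al j) => A B A0 B0; field.
by rewrite !s0// gt_eqF// addr_gt0.
Qed.

Lemma real_pole_sum_integrable n b :
  mu.-integrable RT (EFin \o (fun y => cmod (real_pole_sum n b (x0 +i* y)) ^+ 2)).
Proof.
under eq_fun do rewrite cmod_real_pole_sum.
apply: (@integrable_sum_ord RT n (fun i y => \sum_(j < n) b i * b j / (al i + al j) *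
    (cauchy_density (al i) y + cauchy_density (al j) y))) => // i.
apply: (@integrable_sum_ord RT n (fun j y => b i * b j / (al i + al j) *
    (cauchy_density (al i) y + cauchy_density (al j) y))) => // j.
apply: integrable_EFinZ => //.
exact: (integrableD measurableT (cauchy_density_integrable (al_gt0 i))
  (cauchy_density_integrable (al_gt0 j))).
Qed.

(** Plancherel's identity for sums of exponentials: both sides are the quadratic form
    with matrix [2 * pi / (a_i + a_j)], where [a_i = x0 + i + 1]. *)
Lemma Rintegral_real_pole_sum n b :
  (\int[mu]_(y in RT) (cmod (real_pole_sum n b (x0 +i* y)) ^+ 2))%R =
  2 * pi * (\int[mu]_(t in half_line) ((expR (- (x0 * t)) * real_exp_sum n b t) ^+ 2))%R.
Proof.
have iC i j := integrableD measurableT (cauchy_density_integrable (al_gt0 i))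
  (cauchy_density_integrable (al_gt0 j)).
have iK i j : mu.-integrable RT (EFin \o (fun y => b i * b j / (al i + al j) *
    (cauchy_density (al i) y + cauchy_density (al j) y))).
  by apply: integrable_EFinZ => //; exact: iC.
have aij i j : 0 < al i + al j by exact: addr_gt0.
have iE i j : mu.-integrable H (EFin \o (fun t => b i * b j * expR (- ((al i + al j) * t)))).
  by apply: integrable_EFinZ => //; exact: integrable_exp.
transitivity (\sum_(i < n) \sum_(j < n) 2 * pi * (b i * b j / (al i + al j))).
  under eq_Rintegral do rewrite cmod_real_pole_sum.
  rewrite (@Rintegral_sum_ord RT n (fun i y => \sum_(j < n) b i * b j / (al i + al j) *
    (cauchy_density (al i) y + cauchy_density (al j) y)))//; last first.
    move=> i; exact: (@integrable_sum_ord RT n (fun j y => b i * b j / (al i + al j) *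
      (cauchy_density (al i) y + cauchy_density (al j) y))).
  apply: eq_bigr => i _.
  rewrite (@Rintegral_sum_ord RT n (fun j y => b i * b j / (al i + al j) *
    (cauchy_density (al i) y + cauchy_density (al j) y)))//.
  apply: eq_bigr => j _; rewrite RintegralZl//; last exact: iC.
  rewrite RintegralD//; try exact: cauchy_density_integrable.
  by rewrite !Rintegral_cauchy_density//; ring.
rewrite (_ : (\int[mu]_(t in half_line) _)%R = (\int[mu]_(t in half_line)
    \sum_(i < n) \sum_(j < n) b i * b j * expR (- ((al i + al j) * t)))%R); last first.
  apply: eq_Rintegral => t _; rewrite /real_exp_sum mulr_sumr expr2 mulr_suml.
  apply: eq_bigr => i _; rewrite mulr_sumr; apply: eq_bigr => j _.
  have -> : - ((al i + al j) * t) = - (x0 * t) + - (i.+1%:R * t) +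
    (- (x0 * t) + - (j.+1%:R * t)) by ring.
  by rewrite !expRD; ring.
rewrite (@Rintegral_sum_ord H n (fun i t =>
  \sum_(j < n) b i * b j * expR (- ((al i + al j) * t))) mH); last first.
  move=> i; exact: (@integrable_sum_ord H n (fun j t =>
    b i * b j * expR (- ((al i + al j) * t)))).
rewrite mulr_sumr; apply: eq_bigr => i _.
rewrite (@Rintegral_sum_ord H n (fun j t =>
  b i * b j * expR (- ((al i + al j) * t))) mH)//.
rewrite mulr_sumr; apply: eq_bigr => j _.
by rewrite RintegralZl ?Rintegral_exp//; exact: integrable_exp.
Qed.

End VerticalLine.

Definition exp_sum p (t : R) : R[i] :=
  \sum_(i < size p) p`_i * laplace_kernel i.+1%:R t.

Lemma exp_sum_L2 p : exp_sum p \in L2_pred.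
Proof.
apply: (@L2_pred_sum _ _ (fun i t => p`_i * laplace_kernel i.+1%:R t)) => i.
by apply: L2_predZ; apply: laplace_kernel_L2; exact: natr_gt0.
Qed.

Lemma laplace_kernel_nat n t :
  laplace_kernel n.+1%:R t = (expR (- (n.+1%:R * t)))%:C :> R[i].
Proof.
by rewrite /laplace_kernel -(rmorph_nat (real_complex R)) -rmorphM -rmorphN cexp_real.
Qed.

Lemma exp_sumE p t :
  exp_sum p t = p.[(expR (- t))%:C] * (expR (- t))%:C.
Proof.
rewrite /exp_sum horner_coef mulr_suml; apply: eq_bigr => i _.
rewrite laplace_kernel_nat -mulrA -exprSr -rmorphXn -mulrN expRM_natl.
by rewrite -expRM_natl mulrN.
Qed.

Lemma laplace_exp_sum p w : 0 < Re w ->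
  laplace (toL2 (exp_sum p)) w = (Num.sqrt (2 * pi) : R)^-1%:C *
    \sum_(i < size p) p`_i / (i.+1%:R + w).
Proof.
move=> w0; have lam := bounded_laplace w0.
have HF i : laplace_kernel i.+1%:R \in @L2_pred R by exact: laplace_kernel_L2 (natr_gt0 i).
rewrite (@toL2_sum R (size p) (fun i t => p`_i * laplace_kernel i.+1%:R t)); last first.
  by move=> i; exact: L2_predZ.
rewrite (functional_sum lam (size p) (fun i => toL2 (fun t => p`_i * laplace_kernel i.+1%:R t))).
rewrite mulr_sumr; apply: eq_bigr => i _.
rewrite toL2Z// (functionalZ lam) -pow_exp0 laplace_pow_exp//; last exact: natr_gt0.
by rewrite fact0 expr1 mul1r mulrCA.
Qed.

(** Real and imaginary parts of the coefficients are treated separately, at the price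
    of the factor 4; the weight [exp (- x0 * t)] from the vertical line is at
    most 1. *)
Lemma exp_sum_line_bound p (x0 : R) : 0 < x0 ->
  (\int[mu]_y (cmod (laplace (toL2 (exp_sum p)) (x0 +i* y)) ^+ 2)%:E <=
   (4 * L2norm (toL2 (exp_sum p)) ^+ 2)%:E)%E.
Proof.
move=> x00.
pose b i := Re p`_i; pose c i := Im p`_i; pose n := size p.
pose G y := pi^-1 * (cmod (real_pole_sum n b (x0 +i* y)) ^+ 2 +
                    cmod (real_pole_sum n c (x0 +i* y)) ^+ 2) : R.
have ib := real_pole_sum_integrable x00 n b.
have ic := real_pole_sum_integrable x00 n c.
have iG : mu.-integrable RT (EFin \o G).
  by apply: integrable_EFinZ => //; exact: (integrableD measurableT ib ic).
have pole y : cmod (laplace (toL2 (exp_sum p)) (x0 +i* y)) ^+ 2 <= G y.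
  rewrite laplace_exp_sum// cmodM exprMn.
  rewrite cmod_ge0_real ?invr_ge0 ?sqrtr_ge0// exprVn sqr_sqrtr; last first.
    by rewrite mulr_ge0// pi_ge0.
  have -> : \sum_(i < size p) p`_i / (i.+1%:R + (x0 +i* y)) =
     real_pole_sum n b (x0 +i* y) + 'i%C * real_pole_sum n c (x0 +i* y).
    rewrite /real_pole_sum mulr_sumr -big_split; apply: eq_bigr => i _ /=.
    rewrite mulrA -mulrDl; congr (_ / _).
    by apply: complex_ext; rewrite !ReIm /=; ring.
  have := cmodD2 (real_pole_sum n b (x0 +i* y)) ('i%C * real_pole_sum n c (x0 +i* y)) ltr01.
  have i1 : cmod ('i%C : R[i]) = 1.
    by rewrite /cmod /= expr0n add0r expr1n sqrtr1.
  rewrite [cmod ('i%C * _)]cmodM i1 mul1r invr1 -mulrDr => h.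
  have pi0 : 0 < (2 * pi)^-1 :> R by rewrite invr_gt0 mulr_gt0// pi_gt0.
  apply: (le_trans (ler_wpM2l (ltW pi0) h)); rewrite /G mulrA.
  have aux (z : R) : 0 < z -> (2 * z)^-1 * (1 + 1) = z^-1.
    by move=> z0; field; rewrite gt_eqF.
  by rewrite aux// pi_gt0.
have GE : (\int[mu]_(y in RT) G y)%R <= 4 * L2norm (toL2 (exp_sum p)) ^+ 2.
  have Hp := exp_sum_L2 p; have [mp ep] := (L2_pred_integrable _).1 Hp.
  have Re_exp t : Re (exp_sum p t) = real_exp_sum n b t.
    rewrite Re_sum; apply: eq_bigr => i _; rewrite laplace_kernel_nat ReM /=.
    by rewrite mulr0 subr0.
  have Im_exp t : Im (exp_sum p t) = real_exp_sum n c t.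
    rewrite Im_sum; apply: eq_bigr => i _; rewrite laplace_kernel_nat ImM /=.
    by rewrite mulr0 add0r.
  have part (a : nat -> R) : (forall t, `|real_exp_sum n a t| <= cmod (exp_sum p t)) ->
      measurable_fun H (real_exp_sum n a) ->
      (\int[mu]_(t in half_line) ((expR (- (x0 * t)) * real_exp_sum n a t) ^+ 2))%R
      <= L2norm (toL2 (exp_sum p)) ^+ 2.
    move=> le_a ma; rewrite L2norm_toL2//.
    have pt t : H t -> (expR (- (x0 * t)) * real_exp_sum n a t) ^+ 2 <= cmod (exp_sum p t) ^+ 2.
      rewrite half_lineE => t0; rewrite -[leLHS]real_normK ?num_real//; apply: lerXn2r; rewrite ?nnegrE ?cmod_ge0//.
      rewrite normrM ger0_norm ?expR_ge0// (le_trans _ (le_a t))// ler_piMl//.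
      by rewrite -expR0 ler_expR oppr_le0 mulr_ge0// ltW.
    apply: le_Rintegral => //; apply: le_integrable ep => //.
      apply/measurable_EFinP; apply: measurable_funX; apply: measurable_funM => //.
      apply: (measurableT_comp (@measurable_expR R)); apply: measurable_funN.
      exact: measurable_funM.
    move=> t Ht /=; rewrite lee_fin ger0_norm ?sqr_ge0// (le_trans (pt t Ht))//.
    exact: ler_norm.
  have hb : (\int[mu]_(t in half_line) ((expR (- (x0 * t)) * real_exp_sum n b t) ^+ 2))%R
      <= L2norm (toL2 (exp_sum p)) ^+ 2.
    apply: part; first by move=> t; rewrite -Re_exp Re_le_cmod.
    by have [m _] := mp; move: m; under eq_fun do rewrite Re_exp.
  have hc : (\int[mu]_(t in half_line) ((expR (- (x0 * t)) * real_exp_sum n c t) ^+ 2))%R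
      <= L2norm (toL2 (exp_sum p)) ^+ 2.
    apply: part; first by move=> t; rewrite -Im_exp Im_le_cmod.
    by have [_ m] := mp; move: m; under eq_fun do rewrite Im_exp.
  rewrite RintegralZl//; last exact: (integrableD measurableT ib ic).
  rewrite RintegralD// !Rintegral_real_pole_sum// -mulrDr mulrA.
  rewrite (_ : pi^-1 * (2 * pi) = 2 :> R); last first.
    by rewrite mulrCA mulVf ?mulr1// gt_eqF// pi_gt0.
  by move: hb hc; move: (_ ^+ 2) => N; lra.
apply: (@le_trans _ _ (\int[mu]_(y in RT) (G y)%:E)%E).
  apply: ge0_le_integral => //.
  - by move=> y _; rewrite lee_fin sqr_ge0.
  - apply/measurable_EFinP; apply: measurable_funX; apply: cmod_measurable.
    under eq_fun do rewrite laplace_exp_sum//.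
    apply: cmeasurableZ.
    apply: (@cmeasurable_sum _ _ _ (fun i y => p`_i / (i.+1%:R + (x0 +i* y)))) => i.
    apply: cmeasurableZ; apply: cmeasurable_inv => //.
    apply: cmeasurableD; first exact: cmeasurable_cst.
    by split => /=; [exact: measurable_cst|exact: measurable_id].
  - by apply/measurable_EFinP; have /measurable_int/measurable_EFinP := iG.
  - by move=> y _; rewrite lee_fin.
have fG : (\int[mu]_(y in RT) (EFin \o G) y)%E \is a fin_num by exact: integrable_fin_num.
by rewrite -(fineK fG) lee_fin.
Qed.

End HardyHalfPlane.

Section LaplaceHardy.
Context {R : realType}.
Local Notation mu := (@lebesgue_measure R).
Implicit Types (p q : {poly R[i]}) (x : L2 R).

Lemma toL2_exp_sum_lin (a : R[i]) p q :
  toL2 (exp_sum (a *: p + q)) = a *: toL2 (exp_sum p) + toL2 (exp_sum q).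
Proof.
have Hp := exp_sum_L2 p; have Hq := exp_sum_L2 q.
rewrite -toL2Z// -toL2D//; last exact: L2_predZ.
congr toL2; apply/funext => t; rewrite !exp_sumE hornerD hornerZ; ring.
Qed.

(** The closure of the sums of exponentials, shown to be a closed subspace so that
    density of the span turns into approximation by actual sums. *)
Lemma exp_sum_closure_closed :
  closed_subspace [set x : L2 R | forall e : R, 0 < e ->
    exists p, L2norm (x - toL2 (exp_sum p)) < e].
Proof.
split => /=.
- move=> e e0; exists 0; have := toL2_exp_sum_lin (-1) 0 0.
  by rewrite scaler0 addr0 scaleN1r addNr => ->; rewrite subr0 L2norm_0.
- move=> a x y hx hy e e0.
  have a1 : 0 < 2 * (cmod a + 1) by rewrite mulr_gt0// ltr_wpDl ?cmod_ge0.
  have [p hp] := hx (e / (2 * (cmod a + 1))) (divr_gt0 e0 a1).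
  have e2 : 0 < e / 2 by rewrite divr_gt0.
  have [q hq] := hy _ e2.
  exists (a *: p + q); rewrite toL2_exp_sum_lin.
  have -> : a *: x + y - (a *: toL2 (exp_sum p) + toL2 (exp_sum q)) =
      a *: (x - toL2 (exp_sum p)) + (y - toL2 (exp_sum q)).
    by rewrite scalerBr opprD addrACA.
  have small (A N : R) : 0 <= A -> 0 <= N -> N < e / (2 * (A + 1)) -> A * N <= e / 2.
    move=> A0 N0 /ltW; have A1 : 0 < 2 * (A + 1) by rewrite mulr_gt0// ltr_wpDl.
    rewrite ler_pdivlMr// ler_pdivlMr// => h; apply: le_trans h.
    by rewrite -subr_ge0 (_ : _ - _ = 2 * N) ?mulr_ge0//; ring.
  apply: (le_lt_trans (L2normD _ _)); rewrite [X in X + _]L2normZ.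
  rewrite [e in _ < e]splitr; apply: ler_ltD hq.
  exact: small (cmod_ge0 a) (L2norm_ge0 _) hp.
- move=> x h e e0; have e2 : 0 < e / 2 by rewrite divr_gt0.
  have [v hv xv] := h _ e2; have [p hp] := hv _ e2; exists p.
  have -> : x - toL2 (exp_sum p) = (x - v) + (v - toL2 (exp_sum p)).
    by rewrite addrA subrK.
  apply: (le_lt_trans (L2normD _ _)); rewrite [e in _ < e]splitr.
  exact: ltrD.
Qed.

Lemma exp_sum_dense x (e : R) : 0 < e -> exists p, L2norm (x - toL2 (exp_sum p)) < e.
Proof.
apply: (exp_dense exp_sum_closure_closed) => n d d0; exists 'X^n.
have -> : exp_sum ('X^n : {poly R[i]}) = laplace_kernel n.+1%:R.
  apply/funext => t; rewrite exp_sumE hornerXn laplace_kernel_nat -rmorphXn -rmorphM.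
  by rewrite -exprSr -expRM_natl mulrN.
by rewrite subrr L2norm_0.
Qed.

Lemma limn_einf_le (u : nat -> \bar R) (M : \bar R) :
  (forall n, u n <= M)%E -> (limn_einf u <= M)%E.
Proof.
move=> uM; rewrite limn_einf_lim; apply: lime_le; first exact: is_cvg_einfs.
apply: nearW => n; apply: le_trans (uM n).
by apply: ereal_inf_lbound; exists n => //=.
Qed.

(** Approximating [x] by sums of exponentials within distance 1, their transforms
    converge at every point and Fatou's lemma extends the bound. *)
Lemma hardy_laplace x : hardy_half_plane (laplace x).
Proof.
split; first exact: analytic_laplace.
exists (4 * (L2norm x + 1) ^+ 2) => x0 x00.
have pn n : exists p, L2norm (x - toL2 (exp_sum p)) < n.+1%:R^-1.
  by apply: exp_sum_dense; rewrite invr_gt0 ltr0n.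
have [p hp] := choice pn.
pose u n (y : R) := (cmod (laplace (toL2 (exp_sum (p n))) (x0 +i* y)) ^+ 2)%:E.
have mu_ n : measurable_fun (setT : set (measurableTypeR R)) (u n).
  apply/measurable_EFinP; apply: measurable_funX; apply: cmod_measurable.
  under eq_fun do rewrite laplace_exp_sum//.
  apply: cmeasurableZ.
  apply: (@cmeasurable_sum _ _ _ (fun i y => (p n)`_i / (i.+1%:R + (x0 +i* y)))) => i.
  apply: cmeasurableZ; apply: cmeasurable_inv => //.
  apply: cmeasurableD; first exact: cmeasurable_cst.
  by split => /=; [exact: measurable_cst|exact: measurable_id].
have uM n : (\int[mu]_y u n y <= (4 * (L2norm x + 1) ^+ 2)%:E)%E.
  apply: (le_trans (exp_sum_line_bound _ x00)); rewrite lee_fin ler_wpM2l//.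
  rewrite lerXn2r ?nnegrE ?addr_ge0 ?L2norm_ge0//.
  have -> : toL2 (exp_sum (p n)) = x + -1 *: (x - toL2 (exp_sum (p n))).
    by rewrite scaleN1r opprB addrC subrK.
  apply: (le_trans (L2normD _ _)); rewrite lerD2l L2normZ cmodN cmod1 mul1r.
  by rewrite (le_trans (ltW (hp n)))// invf_le1// ler1n.
have uE y : limn_einf (u ^~ y) = (cmod (laplace x (x0 +i* y)) ^+ 2)%:E.
  have lam := @bounded_laplace R (x0 +i* y) x00.
  have [C C0 LC] := laplace_bounded (x00 : 0 < Re (x0 +i* y)).
  have cv : u n y @[n --> \oo] --> (cmod (laplace x (x0 +i* y)) ^+ 2)%:E.
    apply: cvg_EFin; first exact: nearW.
    rewrite [X in X @ _ --> _](_ : _ = fun n =>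
      cmod (laplace (toL2 (exp_sum (p n))) (x0 +i* y)) *
      cmod (laplace (toL2 (exp_sum (p n))) (x0 +i* y))); last first.
      by apply/funext => n; rewrite /= expr2.
    rewrite expr2.
    suff h : cmod (laplace (toL2 (exp_sum (p n))) (x0 +i* y)) @[n --> \oo] -->
      cmod (laplace x (x0 +i* y)) by exact: cvgM.
    apply/cvgrPdist_le => e e0; have Ce : 0 < (C + 1) / e by rewrite divr_gt0// ltr_wpDl.
    exists (Num.truncn ((C + 1) / e)) => // n /= Nn.
    have hn : (C + 1) * n.+1%:R^-1 <= e.
      rewrite ler_pdivrMr ?ltr0n// mulrC -ler_pdivrMr//.
      rewrite (le_trans (ltW (truncnS_gt _)))// ler_nat ltnS//.
    have d : cmod (laplace x (x0 +i* y) - laplace (toL2 (exp_sum (p n))) (x0 +i* y)) <= e.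
      rewrite -(functionalB lam) (le_trans (LC _))// (le_trans _ hn)//.
      apply: ler_pM => //; [exact: L2norm_ge0|by rewrite lerDl|exact: ltW].
    exact: le_trans (cmod_dist _ _) d.
  by rewrite is_cvg_limn_einfE; [exact: cvg_lim|apply/cvg_ex; eexists; exact: cv].
have := fatou mu measurableT mu_ (fun n y _ => _ : (0 <= u n y)%E).
under eq_integral do rewrite uE.
move=> h; apply: le_trans (h _) _; last exact: limn_einf_le uM.
by move=> n y; rewrite lee_fin sqr_ge0.
Qed.

End LaplaceHardy.

(** * Elementary symmetric functions and multiplicative moments *)

Section PowerSequences.
Context {R : realType}.
Implicit Types (s : seq R[i]) (m : nat -> R[i]).

Definition linear_product s : {poly R[i]} := \prod_(y <- s) (1 + y *: 'X).

Lemma linear_product_coef0 s : (linear_product s)`_0 = 1.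
Proof.
rewrite -horner_coef0 /linear_product horner_prod big1_seq// => y _.
by rewrite hornerD hornerZ hornerX mulr0 addr0 hornerC.
Qed.

Lemma linear_product_cons y s k :
  (linear_product (y :: s))`_k.+1 = (linear_product s)`_k.+1 + y * (linear_product s)`_k.
Proof. by rewrite /linear_product big_cons mulrDl mul1r coefD -scalerAl coefZ coefXM. Qed.

Lemma cmod_linear_product_coef s k : (forall y, y \in s -> cmod y <= 1) ->
  cmod (linear_product s)`_k <= 'C(size s, k)%:R.
Proof.
elim: s k => [|y s ih] k s1.
  by rewrite /linear_product big_nil coef1 bin0n cmod_nat.
have {}ih j : cmod (linear_product s)`_j <= 'C(size s, j)%:R.
  by apply: ih => z zs; apply: s1; rewrite inE zs orbT.
case: k => [|k]; first by rewrite linear_product_coef0 cmod1 bin0.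
rewrite linear_product_cons (le_trans (cmodD _ _))// binS natrD lerD// cmodM.
by rewrite (le_trans _ (ih k))// ler_piMl ?cmod_ge0// s1// mem_head.
Qed.

(** The coefficients are the elementary symmetric functions of [s]. The product of the
    first and the [k]-th contains every squarefree monomial of degree [k + 1]
    exactly [k + 1] times; the error consists of the monomials with one squared
    variable, and there are [k * 'C(size s, k)] of them. *)
Lemma linear_product_coef_error s k : (forall y, y \in s -> cmod y <= 1) ->
  cmod ((linear_product s)`_1 * (linear_product s)`_k -
    k.+1%:R * (linear_product s)`_k.+1) <= k%:R * 'C(size s, k)%:R.
Proof.
elim: s k => [|y s ih] k s1.
  rewrite /linear_product big_nil !coef1 /= mul0r mulr0 subr0 cmod0.
  by rewrite mulr_ge0.
have s1' z : z \in s -> cmod z <= 1 by move=> zs; apply: s1; rewrite inE zs orbT.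
have y1 : cmod y <= 1 by rewrite s1// mem_head.
have {}ih j := ih j s1'.
case: k => [|k]; first by rewrite linear_product_coef0 mulr1 mul1r subrr cmod0 mul0r.
rewrite !linear_product_cons linear_product_coef0 mulr1.
set e := fun j => (linear_product s)`_j.
have -> : ((linear_product s)`_1 + y) * ((linear_product s)`_k.+1 + y * (linear_product s)`_k) -
    k.+2%:R * ((linear_product s)`_k.+2 + y * (linear_product s)`_k.+1) =
    (e 1%N * e k.+1 - k.+2%:R * e k.+2) + y * (e 1%N * e k - k.+1%:R * e k.+1) + y * (y * e k).
  by rewrite /e -[k.+2%:R]natr1; ring.
apply: (le_trans (cmodD _ _)); rewrite /= binS.
have -> : k.+1%:R * ('C(size s, k.+1) + 'C(size s, k))%:R =
  k.+1%:R * 'C(size s, k.+1)%:R + k%:R * 'C(size s, k)%:R + 'C(size s, k)%:R :> R.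
  by rewrite natrD -natr1; ring.
have ye z c : cmod z <= c -> cmod (y * z) <= c.
  by move=> zc; rewrite cmodM (le_trans _ zc)// ler_piMl ?cmod_ge0.
apply: lerD; last by apply: (ye); apply: (ye); exact: cmod_linear_product_coef.
by apply: (le_trans (cmodD _ _)); apply: lerD; [exact: ih|exact: ye (ih k)].
Qed.

Lemma eq0_of_mul_nat_le (d c : R) k : 0 <= d ->
  (forall n, (k <= n)%N -> d * n%:R <= c) -> d = 0.
Proof.
move=> d0 h; apply/eqP; rewrite eq_le d0 andbT leNgt; apply/negP => dp.
pose N := maxn k (Num.truncn (c / d)).+1.
have := h N (leq_maxl _ _); rewrite mulrC -ler_pdivlMr// leNgt => /negP; apply.
by apply: lt_le_trans (truncnS_gt _) _; rewrite ler_nat leq_maxr.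
Qed.

(** A polynomial form of the Gleason-Kahane-Zelazko theorem. The hypothesis puts the
    roots of the [n]-th polynomial outside the open unit disk, so its coefficients
    [(- 1) ^ k * 'C(n, k) * m k] are elementary symmetric functions of numbers of
    modulus at most 1. As [m k] is the same for all [n], the approximate relation
    between these functions becomes exact when [n] grows. *)
Lemma powers_of_nonvanishing m : m 0%N = 1 ->
  (forall n t, cmod t < 1 -> \sum_(k < n.+1) 'C(n, k)%:R * (- t) ^+ k * m k != 0) ->
  forall k, m k = m 1%N ^+ k.
Proof.
move=> m0 nz.
suff step k : m k.+1 = m 1%N * m k by elim=> [|k ih]; rewrite ?m0 ?expr0// step ih exprS.
pose Q n := \poly_(j < n.+1) ('C(n, j)%:R * (-1) ^+ j * m j) : {poly R[i]}.
have QE n t : (Q n).[t] = \sum_(j < n.+1) 'C(n, j)%:R * (- t) ^+ j * m j.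
  by rewrite horner_poly; apply: eq_bigr => j _; rewrite -[- t]mulN1r exprMn; ring.
have Q0 n : (Q n).[0] = 1.
  by rewrite horner_coef0 coef_poly /= bin0 expr0 m0 !mulr1.
have factor n : exists s, [/\ Q n = linear_product s, (size s <= n)%N &
    forall y, y \in s -> cmod y <= 1].
  have [r Er] := closed_field_poly_normal (Q n).
  have Qn0 : Q n != 0.
    by apply/eqP => E; have := Q0 n; rewrite E horner0 => /eqP; rewrite eq_sym oner_eq0.
  have root_r z : z \in r -> (Q n).[z] = 0.
    move=> zr; rewrite Er hornerZ horner_prod (big_rem z)//= hornerXsubC subrr.
    by rewrite mul0r mulr0.
  have r0 z : z \in r -> z != 0.
    by move=> /root_r; apply: contra_eq_neq => ->; rewrite Q0 oner_eq0.
  exists [seq - z^-1 | z <- r]; split.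
  - have E : Q n = (Q n).[0] *: linear_product [seq - z^-1 | z <- r].
      rewrite {1}Er [in RHS]Er hornerZ horner_prod -scalerA; congr (_ *: _).
      rewrite /linear_product big_map -scaler_prod !big_seq; apply: eq_bigr => z zr.
      rewrite hornerXsubC sub0r scalerDr scalerA mulrNN mulfV ?r0// scale1r.
      by rewrite addrC alg_polyC polyCN.
    by rewrite {1}E Q0 scale1r.
  - rewrite size_map -ltnS -(size_prod_XsubC r id).
    have /size_scale <- : lead_coef (Q n) != 0 by rewrite lead_coef_eq0.
    by rewrite -Er size_poly.
  - move=> _ /mapP[z zr ->]; rewrite cmodN cmodV invf_le1; last first.
      by rewrite cmod_gt0 r0.
    by rewrite leNgt; apply/negP => /(nz n z); rewrite -QE root_r// eqxx.
have bin0 n : (k <= n)%N -> (0 : R) < 'C(n, k)%:R by rewrite ltr0n bin_gt0.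
have bound n : (k <= n)%N ->
    cmod (n%:R * (m 1%N * m k) - (n - k)%:R * m k.+1) <= k%:R.
  move=> kn; have [s [Qs sn s1]] := factor n.
  have := linear_product_coef_error k s1; rewrite -Qs !coef_poly.
  rewrite [(k < n.+1)%N]ltnS kn.
  have -> : (if (1 < n.+1)%N then 'C(n, 1)%:R * (-1) ^+ 1 * m 1%N else 0) = - (n%:R * m 1%N).
    by rewrite bin1 expr1; case: n {kn Qs sn s1 s} => [|n]; rewrite /= ?mul0r ?oppr0//; ring.
  have -> : k.+1%:R * (if (k.+1 < n.+1)%N then 'C(n, k.+1)%:R * (-1) ^+ k.+1 * m k.+1 else 0)
      = - ((-1) ^+ k * ('C(n, k)%:R * ((n - k)%:R * m k.+1))).
    have -> : (if (k.+1 < n.+1)%N then 'C(n, k.+1)%:R * (-1) ^+ k.+1 * m k.+1 else 0) =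
        'C(n, k.+1)%:R * (-1) ^+ k.+1 * m k.+1.
      by rewrite ltnS; case: ltnP => // nk; rewrite bin_small ?mul0r// ltnS.
    rewrite exprS mulN1r mulrN mulNr mulrN !mulrA -natrM mul_bin_left natrM; ring.
  have -> : - (n%:R * m 1%N) * ('C(n, k)%:R * (-1) ^+ k * m k) -
      - ((-1) ^+ k * ('C(n, k)%:R * ((n - k)%:R * m k.+1))) =
      - ((-1) ^+ k) * ('C(n, k)%:R * (n%:R * (m 1%N * m k) - (n - k)%:R * m k.+1)) by ring.
  rewrite cmodM cmodN cmodX cmodN cmod1 expr1n mul1r cmodM cmod_nat => h.
  rewrite -(ler_pM2l (bin0 n kn)) (le_trans h)// mulrC ler_wpM2r// ler_nat.
  exact: leq_bin2l.
apply/eqP; rewrite eq_sym -subr_eq0 -cmod_eq0; apply/eqP.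
apply: (@eq0_of_mul_nat_le _ (k%:R + k%:R * cmod (m k.+1)) k); first exact: cmod_ge0.
move=> n kn; rewrite mulrC -(cmod_nat n) -cmodM mulrBr.
have -> : n%:R * (m 1%N * m k) - n%:R * m k.+1 =
    (n%:R * (m 1%N * m k) - (n - k)%:R * m k.+1) - k%:R * m k.+1.
  by rewrite natrB//; ring.
rewrite (le_trans (cmodB _ _))// lerD ?bound//.
by rewrite cmodM cmod_nat.
Qed.

End PowerSequences.

(** * Laguerre polynomials *)

Section LaguerrePolynomials.
Context {R : realType}.
Implicit Types (p q : {poly R[i]}) (c : nat -> R[i]) (a b : R[i]).

Definition moments c p : R[i] := \sum_(i < size p) p`_i * c i.

Lemma moments_wide c p n : (size p <= n)%N -> moments c p = \sum_(i < n) p`_i * c i.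
Proof.
move=> pn; rewrite /moments (big_ord_widen n (fun i => p`_i * c i) pn) big_mkcond.
apply: eq_bigr => i _; case: ltnP => // pi.
by rewrite nth_default// mul0r.
Qed.

Lemma moments_lin c a p q : moments c (a *: p + q) = a * moments c p + moments c q.
Proof.
pose n := maxn (size (a *: p + q)) (maxn (size p) (size q)).
rewrite !(@moments_wide c _ n) /n ?leq_max ?leqnn ?orbT//.
rewrite mulr_sumr -big_split; apply: eq_bigr => i _ /=.
by rewrite coefD coefZ; ring.
Qed.

Lemma momentsZ c a p : moments c (a *: p) = a * moments c p.
Proof.
have m0 : moments c 0 = 0 by rewrite /moments size_poly0 big_ord0.
by rewrite -[a *: p]addr0 moments_lin m0 addr0.
Qed.

Lemma momentsD c p q : moments c (p + q) = moments c p + moments c q.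
Proof. by rewrite -{1}[p]scale1r moments_lin mul1r. Qed.

Lemma momentsB c p q : moments c (p - q) = moments c p - moments c q.
Proof. by rewrite -scaleN1r addrC moments_lin mulN1r addrC. Qed.

Definition primitive q : {poly R[i]} :=
  \poly_(i < (size q).+1) (q`_i.-1 / i%:R).

Lemma coef_primitive q i : (primitive q)`_i.+1 = q`_i / i.+1%:R.
Proof.
rewrite coef_poly ltnS; case: ltnP => // qi.
by rewrite nth_default// mul0r.
Qed.

Lemma coef_primitive0 q : (primitive q)`_0 = 0.
Proof. by rewrite coef_poly /= mulr0n invr0 mulr0. Qed.

Lemma deriv_primitive q : (primitive q)^`() = q.
Proof.
by apply/polyP => i; rewrite coef_deriv coef_primitive -[LHS]mulr_natr divfK ?pnatr_eq0.
Qed.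

(** Sends a Laguerre polynomial, up to sign, to the next one. For the functions
    [q t * exp (- t)] it is the isometry that multiplies the Laplace transform by
    [(1 - w) / (1 + w)]. *)
Definition raise q := 2 *: primitive q - q.

(** The integral of [t ^ i * exp (- 2 * t)], so that [sq_norm q] below is the squared
    norm of [q t * exp (- t)]. *)
Definition exp_moment i : R[i] := i`!%:R / 2 ^+ i.+1.

(** Integration by parts. *)
Lemma moments_deriv p : moments exp_moment p^`() = 2 * moments exp_moment p - p`_0.
Proof.
have sp : (size p^`() <= size p)%N.
  exact: leq_trans (size_poly _ _) (leq_pred _).
rewrite (moments_wide _ sp) (moments_wide _ (leqnSn (size p))) big_ord_recl /=.
have -> : exp_moment 0 = 2^-1 by rewrite /exp_moment fact0 mul1r expr1.
set S := (X in 2 * (_ + X)).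
have -> : 2 * (p`_0 * 2^-1 + S) - p`_0 = 2 * S by field.
rewrite /S mulr_sumr; apply: eq_bigr => i _; rewrite coef_deriv /bump /= add1n /exp_moment.
rewrite factS natrM -[_ *+ _]mulr_natr [2 ^+ i.+2]exprS.
have t0 : (2 : R[i]) != 0 by rewrite pnatr_eq0.
by field; rewrite expf_neq0.
Qed.

Lemma moments_power_primitive b q :
  moments (fun i => i`!%:R * b ^+ i) (primitive q) =
  b * moments (fun i => i`!%:R * b ^+ i) q.
Proof.
rewrite (moments_wide _ (size_poly _ _)) big_ord_recl coef_primitive0 mul0r add0r.
rewrite /moments mulr_sumr; apply: eq_bigr => i _; rewrite lift0.
rewrite coef_primitive factS natrM exprS; field.
by rewrite -[1 + i%:R]/(1 + i%:R) nat1r pnatr_eq0.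
Qed.

Lemma moments_power_raise b q :
  moments (fun i => i`!%:R * b ^+ i) (raise q) =
  (2 * b - 1) * moments (fun i => i`!%:R * b ^+ i) q.
Proof. by rewrite /raise momentsB momentsZ moments_power_primitive; ring. Qed.

Local Notation conjp := (map_poly (@conjc R)).

Definition sq_norm q := moments exp_moment (q * conjp q).

(** With [Q] the primitive of [q], the difference of the squared moduli of
    [2 * Q - q] and [q] is [4 * |Q| ^ 2 - 2 * (|Q| ^ 2)'], whose integral against
    [exp (- 2 * t)] vanishes as [Q] vanishes at 0. *)
Lemma raise_isometry q : sq_norm (raise q) = sq_norm q.
Proof.
set Q := primitive q.
have dQ : Q^`() = q by exact: deriv_primitive.
have dQc : (conjp Q)^`() = conjp q by rewrite deriv_map dQ.
have E : raise q * conjp (raise q) - q * conjp q =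
    4 *: (Q * conjp Q) - 2 *: (Q * conjp Q)^`().
  rewrite /raise -/Q derivM dQ dQc rmorphB /= map_polyZ rmorph_nat.
  by rewrite -!mul_polyC !polyC_natr; ring.
apply/eqP; rewrite -subr_eq0 /sq_norm -momentsB E momentsB !momentsZ moments_deriv.
rewrite coefM big_ord1 /= coef_primitive0 mul0r subr0.
by apply/eqP; ring.
Qed.

Lemma moments_raise q : moments exp_moment (raise q) = 0.
Proof.
rewrite /raise momentsB momentsZ -{2}(deriv_primitive q) moments_deriv.
by rewrite coef_primitive0; ring.
Qed.

Lemma moments_raise_conj q : moments exp_moment (conjp (raise q)) = 0.
Proof.
rewrite /raise rmorphB /= map_polyZ rmorph_nat momentsB momentsZ.
rewrite -{2}(deriv_primitive q) -deriv_map moments_deriv coef_map coef_primitive0.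
by ring.
Qed.

(** The constant 1 is orthogonal to the range of [raise]. *)
Lemma sq_norm_add_raise q : sq_norm (1 + raise q) = 2^-1 + sq_norm q.
Proof.
rewrite {1}/sq_norm rmorphD rmorph1.
have -> : (1 + raise q) * (1 + conjp (raise q)) =
    1 + raise q + conjp (raise q) + raise q * conjp (raise q) by ring.
rewrite 3!momentsD moments_raise moments_raise_conj -/(sq_norm (raise q)).
rewrite raise_isometry !addr0.
congr (_ + _); rewrite /moments size_poly1 big_ord1 coef1 /exp_moment.
by rewrite fact0 expr1 !mul1r.
Qed.

Lemma sq_normZ a q : sq_norm (a *: q) = (cmod a ^+ 2)%:C * sq_norm q.
Proof.
rewrite /sq_norm map_polyZ -mul_conj -momentsZ; congr moments.
by rewrite -!mul_polyC polyCM; ring.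
Qed.

(** The polynomial [sum_(k < n) a^* ^ k * raise ^ k 1], the truncated reproducing
    kernel in the Laguerre basis: relative to its norm, no combination of the first
    [n] basis vectors makes the functional with values [a ^ k] on the basis
    larger. *)
Fixpoint laguerre_test (a : R[i]) (n : nat) : {poly R[i]} :=
  if n is m.+1 then 1 + raise (a^* *: laguerre_test a m) else 0.

Lemma sq_norm_test a n :
  sq_norm (laguerre_test a n) = (2^-1 * \sum_(k < n) (cmod a ^+ 2) ^+ k)%:C.
Proof.
elim: n => [|n ih].
  by rewrite big_ord0 mulr0 /sq_norm mul0r /moments size_poly0 big_ord0.
rewrite /= sq_norm_add_raise sq_normZ ih cmod_conj big_ord_recl expr0 mulrDr mulr1.
rewrite rmorphD rmorphV ?unitfE ?pnatr_eq0//= rmorph_nat; congr (_ + _).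
rewrite -rmorphM; congr (_%:C); rewrite mulrCA mulr_sumr; congr (_ * _).
by apply: eq_bigr => i _; rewrite -exprS.
Qed.

Lemma moments_test b n :
  moments (fun i => i`!%:R * b ^+ i) (laguerre_test (2 * b - 1) n) =
  (\sum_(k < n) (cmod (2 * b - 1) ^+ 2) ^+ k)%:C.
Proof.
elim: n => [|n ih]; first by rewrite big_ord0 /moments size_poly0 big_ord0.
rewrite /= momentsD moments_power_raise momentsZ ih mulrA mul_conj.
rewrite big_ord_recl expr0 rmorphD; congr (_ + _).
  by rewrite /moments size_poly1 big_ord1 coef1 fact0 expr0 !mul1r.
rewrite -rmorphM mulr_sumr; congr (_%:C).
by apply: eq_bigr => i _; rewrite -exprS.
Qed.

Definition poly_exp q (t : R) : R[i] := \sum_(i < size q) q`_i * pow_exp i 1 t.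

Lemma poly_expE q t : poly_exp q t = q.[t%:C] * laplace_kernel 1 t.
Proof.
rewrite /poly_exp horner_coef mulr_suml; apply: eq_bigr => i _.
by rewrite /pow_exp mulrA.
Qed.

Lemma poly_exp_L2 q : poly_exp q \in L2_pred.
Proof.
apply: (@L2_pred_sum _ _ (fun i t => q`_i * pow_exp i 1 t)) => i.
by apply: L2_predZ; exact: pow_exp_L2 re1_gt0.
Qed.

Lemma L2norm_poly_exp q :
  (L2norm (toL2 (poly_exp q)) ^+ 2)%:C = sq_norm q.
Proof.
rewrite (L2norm_toL2 (poly_exp_L2 q)).
pose r := q * conjp q.
have two : 0 < Re (2 : R[i]) by exact: (natr_gt0 1).
have E : cintegral half_line (fun t => \sum_(i < size r) r`_i * pow_exp i 2 t) = sq_norm q.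
  rewrite (@cintegral_sum _ _ _ (fun i t => r`_i * pow_exp i 2 t) mH); last first.
    by move=> i; apply: cintegrableZ => //; exact: cintegrable_pow_exp.
  apply: eq_bigr => i _.
  by rewrite (cintegralZ _ mH (cintegrable_pow_exp i two)) cintegral_pow_exp.
have pt t : \sum_(i < size r) r`_i * pow_exp i 2 t = (cmod (poly_exp q t) ^+ 2)%:C.
  rewrite -mul_conj poly_expE.
  have -> : \sum_(i < size r) r`_i * pow_exp i 2 t = r.[t%:C] * laplace_kernel 2 t.
    by rewrite horner_coef mulr_suml; apply: eq_bigr => i _; rewrite /pow_exp mulrA.
  have cq : (conjp q).[t%:C] = Num.conj (q.[t%:C]).
    by rewrite -{1}(conjc_real t) horner_map.
  rewrite /r hornerM cq rmorphM.
  have -> : laplace_kernel 2 t = laplace_kernel 1 t * (laplace_kernel 1 t)^*.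
    have k2 : laplace_kernel 2 t = (expR (- (2 * t)))%:C := laplace_kernel_nat 1 t.
    have k1 : laplace_kernel 1 t = (expR (- (1 * t)))%:C := laplace_kernel_nat 0 t.
    have cr (r : R) : Num.conj (r%:C : R[i]) = r%:C := conjc_real r.
    by rewrite k1 k2 cr -rmorphM -expRD; congr ((expR _)%:C); ring.
  by ring.
rewrite -E; apply: complex_ext => /=.
- by apply: eq_Rintegral => t _; rewrite pt.
- by rewrite /Rintegral integral0_eq// => t _; rewrite pt.
Qed.

(** With [S = sum_(k < n) |2 * b - 1| ^ (2 k)], the test polynomial has squared norm
    [S / 2] and moment [S], so boundedness keeps [S] bounded in [n]. If
    [|2 * b - 1| >= 1] then [S >= n]. *)
Lemma functional_disk_bound (b m0 : R[i]) (C : R) : m0 != 0 ->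
  (forall q, cmod (m0 * moments (fun i => i`!%:R * b ^+ i) q) <=
             C * L2norm (toL2 (poly_exp q))) ->
  cmod (2 * b - 1) < 1.
Proof.
move=> m00 h; rewrite ltNge; apply/negP => be1.
pose S n : R := \sum_(k < n) (cmod (2 * b - 1) ^+ 2) ^+ k.
have S0 n : n%:R <= S n.
  rewrite -[n in n%:R](card_ord n) -sum1_card natr_sum; apply: ler_sum => k _.
  by rewrite exprn_ege1// exprn_ege1.
have m1 : 0 < cmod m0 by rewrite cmod_gt0.
have key n : cmod m0 ^+ 2 * n%:R <= 2^-1 * C ^+ 2.
  have := h (laguerre_test (2 * b - 1) n).
  rewrite moments_test -/(S n) cmodM => le.
  have Sn0 : 0 <= S n by exact: le_trans (S0 n).
  rewrite cmod_ge0_real// in le.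
  have N2 : L2norm (toL2 (poly_exp (laguerre_test (2 * b - 1) n))) ^+ 2 = 2^-1 * S n.
    by apply: complexI; rewrite L2norm_poly_exp sq_norm_test.
  have N0 := L2norm_ge0 (toL2 (poly_exp (laguerre_test (2 * b - 1) n))).
  move: (L2norm _) N0 N2 le => N N0 N2 le.
  have CN0 : 0 <= C * N by apply: le_trans le; rewrite mulr_ge0 ?(ltW m1).
  have sq : (cmod m0 * S n) ^+ 2 <= (C * N) ^+ 2.
    by rewrite lerXn2r ?nnegrE ?CN0 ?(mulr_ge0 (ltW m1)).
  rewrite !exprMn N2 in sq.
  have [->|n0] := eqVneq n 0%N; first by rewrite mulr0 mulr_ge0 ?invr_ge0// sqr_ge0.
  have Sp : 0 < S n by rewrite (lt_le_trans _ (S0 n))// ltr0n lt0n.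
  have le2 : cmod m0 ^+ 2 * S n <= 2^-1 * C ^+ 2.
    by rewrite -(ler_pM2r Sp); lra.
  by apply: le_trans le2; rewrite ler_wpM2l ?sqr_ge0.
have : cmod m0 ^+ 2 = 0.
  apply: (@eq0_of_mul_nat_le _ _ (2^-1 * C ^+ 2) 0%N); first exact: sqr_ge0.
  by move=> n _; exact: key.
by apply/eqP; rewrite sqrf_eq0 gt_eqF.
Qed.

End LaguerrePolynomials.

(** * Functionals without zeros on minimum phase functions *)

Section MinimumPhase.
Context {R : realType}.
Implicit Types (z w t : R[i]) (x f : L2 R).
Local Notation c2pi := ((Num.sqrt (2 * pi))^-1%:C : R[i]).

Lemma one_add_neq0_half_plane w : 0 < Re w -> 1 + w != 0.
Proof.
move=> w0; apply/eqP => /(congr1 (@complex.Re R)); rewrite ReD /= => h.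
by move: w0; rewrite [Re w](_ : _ = -1) ?ltr0N1 //; lra.
Qed.

Lemma one_add_neq0_disk z : cmod z < 1 -> 1 + z != 0.
Proof.
move=> z1; rewrite addrC addr_eq0; apply/eqP => zE.
by move: z1; rewrite zE cmodN cmod1 ltxx.
Qed.

(** An involution exchanging the disk and the right half-plane; it is the change of
    variable in [Phi]. *)
Definition cayley z := (1 - z) / (1 + z).

Lemma cayley_disk w : 0 < Re w -> cmod (cayley w) < 1.
Proof.
move=> w0; have w1 := one_add_neq0_half_plane w0.
have p : 0 < cmod (1 + w) by rewrite cmod_gt0.
rewrite /cayley cmodM cmodV ltr_pdivrMr// mul1r.
rewrite -(@ltr_pXn2r _ 2) ?nnegrE ?cmod_ge0// !cmodE !ReIm /=.
by case: w w0 {w1 p} => a b /= a0; nra.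
Qed.

Lemma cayley_half_plane z : cmod z < 1 -> 0 < Re (cayley z).
Proof.
move=> z1; have p : 0 < cmod (1 + z) by rewrite cmod_gt0 one_add_neq0_disk.
have E : cayley z * (1 + z) = 1 - z by rewrite divfK// one_add_neq0_disk.
have p2 : 0 < cmod (1 + z) ^+ 2 by rewrite exprn_gt0.
have z2 : cmod z ^+ 2 < 1 by rewrite expr_lt1 ?cmod_ge0.
rewrite -(pmulr_lgt0 _ p2).
move: E p2 z2; rewrite !cmodE; case: (cayley z) => x y; case: z {z1 p} => a b.
case=> e1 e2; rewrite /= => p2 z2.
rewrite [X in 0 < X](_ : _ = (1 + a) * (x * (1 + a) - y * (0 + b)) + b * (x * (0 + b) + y * (1 + a))).
  by rewrite e1 e2; nra.
by ring.
Qed.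

Lemma cayleyK z : 1 + z != 0 -> cayley (cayley z) = z.
Proof.
move=> z1; have t0 : (2 : R[i]) != 0 by rewrite pnatr_eq0.
have E : 1 + cayley z = 2 / (1 + z) by rewrite /cayley; field.
by rewrite {1}/cayley E /cayley; field; rewrite z1.
Qed.

Lemma minimum_phase_laplace_neq0 f w : minimum_phase f -> 0 < Re w ->
  laplace f w != 0.
Proof.
move=> [_ _ [lam lam1 E]] w0; apply/eqP => f0.
have := E (cayley w) (cayley_disk w0).
rewrite /Phi -/(cayley (cayley w)) cayleyK ?one_add_neq0_half_plane// f0 mulr0.
move/esym/eqP; rewrite mulf_eq0 (negbTE (cexp_neq0 _)) orbF => /eqP lam0.
by move: lam1; rewrite lam0 cmod0 => /eqP; rewrite eq_sym oner_eq0.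
Qed.

(** Its transform is proportional to [u * (1 - t * u) ^ n] with [u = 1 / (1 + w)]. *)
Definition binomial_mix t n : L2 R :=
  \sum_(k < n.+1) ('C(n, k)%:R * (- t) ^+ k / k`!%:R) *: toL2 (pow_exp k 1).

Lemma binomial_mix_functional (Lam : L2 R -> R[i]) t n : bounded_functional Lam ->
  Lam (binomial_mix t n) =
  \sum_(k < n.+1) 'C(n, k)%:R * (- t) ^+ k * (Lam (toL2 (pow_exp k 1)) / k`!%:R).
Proof.
move=> L; rewrite /binomial_mix
  (functional_sum L _ (fun k => ('C(n, k)%:R * (- t) ^+ k / k`!%:R) *: toL2 (pow_exp k 1))).
by apply: eq_bigr => k _; rewrite functionalZ//; ring.
Qed.

Lemma laplace_binomial_mix t n w : 0 < Re w ->
  laplace (binomial_mix t n) w = c2pi * (1 + w)^-1 * (1 - t / (1 + w)) ^+ n.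
Proof.
move=> w0; have w1 := one_add_neq0_half_plane w0.
rewrite (binomial_mix_functional _ _ (bounded_laplace w0)) exprDn mulr_sumr.
apply: eq_bigr => k _; rewrite laplace_pow_exp ?re1_gt0//.
have k0 : k`!%:R != 0 :> R[i] by rewrite pnatr_eq0 -lt0n fact_gt0.
rewrite expr1n mul1r -[_ ^+ k *+ _]mulr_natl -mulNr expr_div_n exprS; move: c2pi => c; field.
by rewrite k0 w1 expf_neq0.
Qed.

(** Under [w = cayley z] one has [u = (1 + z) / 2], and
    [1 - t * (1 + z) / 2 = (1 - t / 2) * (1 - t / (2 - t) * z)]. *)
Lemma minimum_phase_binomial_mix t n : cmod t < 1 -> minimum_phase (binomial_mix t n).
Proof.
move=> t1.
have t2 : cmod t < cmod (2 - t).
  apply: (lt_le_trans t1); apply: le_trans (Re_le_cmod _); apply: le_trans (ler_norm _).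
  by rewrite ReB [Re 2](_ : _ = 2)//; have := le_trans (ler_norm _) (Re_le_cmod t); lra.
have t20 : 2 - t != 0 by rewrite -cmod_gt0 (le_lt_trans _ t2) ?cmod_ge0.
have two0 : (2 : R[i]) != 0 by rewrite pnatr_eq0.
apply: (@outer_power _ _ ((Num.sqrt pi)%:C * c2pi * (1 - t / 2) ^+ n) (t / (2 - t)) n).
- rewrite !mulf_neq0 ?expf_neq0//.
  + by rewrite (inj_eq (@complexI R) _ 0) gt_eqF// sqrtr_gt0 pi_gt0.
  + by rewrite (inj_eq (@complexI R) _ 0) invr_eq0 gt_eqF// sqrt2pi_gt0.
  + by rewrite (_ : 1 - t / 2 = (2 - t) / 2) ?mulf_neq0 ?invr_neq0//; field.
- by rewrite cmodM cmodV ltr_pdivrMr ?mul1r// (le_lt_trans _ t2) ?cmod_ge0.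
move=> z z1; have z0 := one_add_neq0_disk z1.
rewrite /Phi -/(cayley z) laplace_binomial_mix; last exact: cayley_half_plane.
have E : 1 + cayley z = 2 / (1 + z) by rewrite /cayley; field.
rewrite E.
have -> : 1 - t / (2 / (1 + z)) = (1 - t / 2) * (1 - t / (2 - t) * z).
  by field; rewrite t20 z0.
rewrite exprMn rmorphM rmorph_nat; move: c2pi => c; field.
by rewrite z0.
Qed.

(** The binomial combinations show that the normalized moments are powers of a number
    [b], boundedness that [1 / b - 1] is in the half-plane, and density of the
    [pow_exp k 1] that the two functionals agree. *)
Lemma nonvanishing_functional (Lam : L2 R -> R[i]) : bounded_functional Lam ->
  (forall f, minimum_phase f -> Lam f != 0) ->
  let m0 := Lam (toL2 (pow_exp 0 1)) in
  let m1 := Lam (toL2 (pow_exp 1 1)) in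
  [/\ m0 != 0, m1 != 0, 0 < Re (m0 / m1 - 1)
    & forall x, Lam x =
        (Num.sqrt (2 * pi))%:C * (m0 / m1) * m0 * laplace x (m0 / m1 - 1)].
Proof.
move=> L nz m0 m1.
have m00 : m0 != 0.
  have : cmod (0 : R[i]) < 1 by rewrite cmod0.
  move=> /(minimum_phase_binomial_mix 0) /nz.
  by rewrite binomial_mix_functional// big_ord1 bin0 expr0 !mul1r fact0 divr1.
have e0 : Lam (toL2 (pow_exp 0 1)) = m0 by [].
have e1 : Lam (toL2 (pow_exp 1 1)) = m1 by [].
clearbody m0 m1.
have [b bE mE] : exists2 b, b = m1 / m0 &
    forall k, Lam (toL2 (pow_exp k 1)) = m0 * (k`!%:R * b ^+ k).
  pose m k := Lam (toL2 (pow_exp k 1)) / k`!%:R / m0.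
  have mE k : Lam (toL2 (pow_exp k 1)) = m0 * (k`!%:R * m 1%N ^+ k).
    rewrite -(@powers_of_nonvanishing _ m) /m.
    - by field; rewrite m00 pnatr_eq0 -lt0n fact_gt0.
    - by rewrite e0 fact0 divr1 divff.
    move=> n t t1; have := nz _ (minimum_phase_binomial_mix n t1).
    rewrite binomial_mix_functional//; apply: contra_neq => E.
    rewrite -[RHS](mul0r m0) -[X in _ = X * _]E mulr_suml; apply: eq_bigr => i _.
    by rewrite -[RHS]mulrA divfK.
  by exists (m 1%N) => //; rewrite /m e1 divr1.
have b1 : cmod (2 * b - 1) < 1.
  have [_ [C _ LC]] := L; apply: (@functional_disk_bound R b m0 C m00) => q.
  suff <- : Lam (toL2 (poly_exp q)) = m0 * moments (fun i => i`!%:R * b ^+ i) q by exact: LC.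
  rewrite /poly_exp (@toL2_sum _ _ (fun i (t : R) => q`_i * pow_exp i 1 t)); last first.
    by move=> i; apply: L2_predZ; exact: pow_exp_L2 re1_gt0.
  rewrite (functional_sum L _ (fun i => toL2 (fun t : R => q`_i * pow_exp i 1 t))) /moments mulr_sumr; apply: eq_bigr => i _.
  by rewrite toL2Z ?functionalZ ?mE ?pow_exp_L2 ?re1_gt0//; ring.
have b0 : b != 0.
  by apply: contraTneq b1 => {bE mE} ->; rewrite mulr0 sub0r cmodN cmod1 ltxx.
have m10 : m1 != 0 by move: b0; rewrite bE mulf_eq0 negb_or => /andP[].
have binv : m0 / m1 = b^-1 by rewrite bE invf_div.
have xiE : m0 / m1 - 1 = cayley (2 * b - 1).
  have two0 : (2 : R[i]) != 0 by rewrite pnatr_eq0.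
  rewrite binv /cayley (_ : 1 + _ = 2 * b); last by ring.
  by field; rewrite b0.
have xi0 : 0 < Re (m0 / m1 - 1) by rewrite xiE cayley_half_plane.
split => // x.
set s := (Num.sqrt (2 * pi))%:C; set xi := m0 / m1 - 1.
pose D x := Lam x - s * (m0 / m1) * m0 * laplace x xi.
suff D0 : D x = 0 by apply/eqP; rewrite -subr_eq0; apply/eqP.
have [Ll [C C0 LC]] := L; have [Bl [C' C'0 BC]] := bounded_laplace xi0.
apply: (@functional_eq0_pow_exp _ D).
  split=> [a y z|]; first by rewrite /D Ll Bl; ring.
  exists (C + cmod (s * (m0 / m1) * m0) * C').
    by rewrite addr_ge0// mulr_ge0// cmod_ge0.
  move=> y; rewrite /D (le_trans (cmodB _ _))// mulrDl lerD// cmodM -[leRHS]mulrA.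
  by rewrite ler_wpM2l ?cmod_ge0.
move=> k; rewrite /D mE laplace_pow_exp ?re1_gt0//.
have s0 : s != 0 by rewrite (inj_eq (@complexI R) _ 0) gt_eqF// sqrt2pi_gt0.
have -> : 1 + xi = b^-1 by rewrite /xi binv addrC subrK.
rewrite binv.
have -> : c2pi = s^-1 by rewrite /s -fmorphV.
by rewrite exprVn exprS; field; rewrite s0 b0 expf_neq0.
Qed.

End MinimumPhase.

(** * The operator *)

Section BoundedOperators.
Context {R : realType}.

Lemma continuous_L2_bounded (A : {linear L2 R -> L2 R}) : continuous A ->
  exists2 C : R, 0 <= C & forall x, L2norm (A x) <= C * L2norm x.
Proof.
move=> /linear_bounded_continuous /linear_boundedP /pinfty_ex_gt0 [M M0 AM].
have [MR M0'] : M = (Re M)%:C /\ 0 < Re M.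
  by case: M M0 {AM} => a b; rewrite ltcE /= => /andP[/eqP -> ].
exists (Re M) => [|x]; first exact: ltW.
by have := AM x; rewrite !L2_normE MR -rmorphM lecR.
Qed.

Lemma bounded_laplace_operator (A : {linear L2 R -> L2 R}) (w : R[i]) : continuous A ->
  0 < Re w -> bounded_functional (fun x => laplace (A x) w).
Proof.
move=> /continuous_L2_bounded [C C0 AC] w0.
have [Bl [C' C'0 BC]] := bounded_laplace w0.
split=> [a x y|]; first by rewrite linearP Bl.
exists (C' * C); first exact: mulr_ge0.
by move=> x; rewrite (le_trans (BC _))// -mulrA ler_wpM2l.
Qed.

(** Minimum phase functions are delayed by 0, so the hypothesis applies to them; the
    delay of the image only contributes an exponential factor. *)
Lemma preserving_laplace_neq0 (A : {linear L2 R -> L2 R}) (f : L2 R) (w : R[i]) :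
  A @` shifted_minimum_phase `<=` shifted_minimum_phase ->
  minimum_phase f -> 0 < Re w -> laplace (A f) w != 0.
Proof.
move=> AM mf w0.
have [|g [tau [mg tau0 ->]]] := AM (A f).
  exists f => //; exists f, 0; split => //.
  apply: laplace_injective => z z0.
  by rewrite laplace_shift// mulr0 oppr0 cexp0 mul1r.
by rewrite laplace_shift// mulf_neq0 ?cexp_neq0 ?minimum_phase_laplace_neq0.
Qed.

Lemma laplace_inv_eq (F : R[i] -> R[i]) (x : L2 R) : (forall w, right_half_plane w -> laplace x w = F w) ->
  laplace_inv F = x.
Proof.
move=> xF; apply: laplace_injective => w w0; rewrite (xF _ w0).
exact: (xgetPex 0 (ex_intro [set f | forall w, right_half_plane w -> laplace f w = F w] x xF) _ w0).
Qed.

Lemma hardy_half_plane_eq (F G : R[i] -> R[i]) :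
  (forall w, right_half_plane w -> F w = G w) ->
  hardy_half_plane F -> hardy_half_plane G.
Proof.
move=> FG [aF [M FM]]; split; first exact: (analytic_on_eq open_right_half_plane FG aF).
exists M => x x0; rewrite -[in leLHS](_ : (fun y => (cmod (F (x +i* y)) ^+ 2)%:E) =
  fun y => (cmod (G (x +i* y)) ^+ 2)%:E); first exact: FM.
by apply/funext => y; rewrite FG.
Qed.

End BoundedOperators.

Theorem theorem4 (R : realType) (A : {linear L2 R -> L2 R})
    (A_continuous : continuous A)
    (A_preserves : A @` shifted_minimum_phase `<=` shifted_minimum_phase) :
  exists alpha xi : R[i] -> R[i],
    [/\ hardy_half_plane alpha,
        (forall w, right_half_plane w -> alpha w != 0),
        analytic_on right_half_plane xi,
        (forall w, right_half_plane w -> right_half_plane (xi w))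
      & let kappa w := (Num.sqrt (2 * pi))%:C * (1 + xi w) * alpha w in
        forall f : L2 R,
          hardy_half_plane (mult_op kappa (comp_op xi (laplace f))) /\
          A f = laplace_inv (mult_op kappa (comp_op xi (laplace f)))].
Proof.
pose F0 := laplace (A (toL2 (pow_exp 0 1))).
pose F1 := laplace (A (toL2 (pow_exp 1 1))).
have key (w : R[i]) : 0 < Re w -> [/\ F0 w != 0, F1 w != 0, 0 < Re (F0 w / F1 w - 1)
    & forall x, laplace (A x) w = (Num.sqrt (2 * pi))%:C * (F0 w / F1 w) * F0 w *
        laplace x (F0 w / F1 w - 1)].
  move=> w0; apply: nonvanishing_functional.
    exact: bounded_laplace_operator A_continuous w0.
  by move=> f mf; exact: preserving_laplace_neq0 A_preserves mf w0.
have hF0 : hardy_half_plane F0 := hardy_laplace _.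
have aF1 : analytic_on right_half_plane F1 by exact: analytic_laplace.
clearbody F0 F1; have [aF0 _] := hF0.
exists F0, (fun w => F0 w / F1 w - 1); split => [//|w w0||w w0|kappa f].
- by have [] := key w w0.
- by apply: analytic_quotient => // w w0; have [] := key w w0.
- by have [] := key w w0.
have E w : right_half_plane w ->
    laplace (A f) w = mult_op kappa (comp_op (fun w => F0 w / F1 w - 1) (laplace f)) w.
  move=> w0; have [_ _ _ ->] := key w w0.
  by rewrite /mult_op /comp_op /kappa [1 + _]addrC subrK.
split; first exact: hardy_half_plane_eq E (hardy_laplace _).
by rewrite (laplace_inv_eq E).
Qed.
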